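(* Let $\alpha$ be a fixed infinite countable ordinal. Then for a Tychonoff space $Y$ the following are equivalent. (1) There exists a linear continuous surjection $T: C_p([1,\alpha])\to C_p(Y)$. (2) $Y$ is homeomorphic to $[1,\beta]$, where $\beta$ is a countable ordinal such that either $\beta<\alpha$, or $\alpha\le\beta<\alpha^{\omega}$. (3) $Y$ is homeomorphic to $[1,\beta]$, where $\beta$ is a countable ordinal with the property: if $\alpha\le\beta$, then $C_p([1,\alpha])$ and $C_p([1,\beta])$ are isomorphic.
   Context: For an ordinal $\alpha$, $[1,\alpha]$ denotes the compact space of all ordinals $\gamma$ with $1\le\gamma\le\alpha$, with the order topology. Countable ordinals include finite ones; $\omega$ is the first infinite ordinal and $\alpha^\omega$ is ordinal exponentiation. For a Tychonoff space $X$, $C_p(X)$ is the vector space of all continuous functions $X\to\mathbb{R}$ with the topology of pointwise convergence. ''Isomorphic'' for locally convex spaces means linearly homeomorphic. *)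

(* Defs.v *)
From HB Require Import structures.
From mathcomp Require Import all_boot all_order all_algebra generic_quotient.
From mathcomp Require Import all_classical all_reals all_analysis.
Set Implicit Arguments.
Unset Strict Implicit.
Unset Printing Implicit Defensive.
Import Order.TTheory GRing.Theory Num.Theory.
Import numFieldNormedType.Exports.
Local Open Scope card_scope.
Local Open Scope classical_set_scope.

(* Notations for countable ordinals: [node f] stands for the least ordinal
   strictly greater than all the [f n], i.e. sup_n (f n + 1). Every nonzero
   countable ordinal is of this form, as it is the set of its (countably many)
   predecessors. [tle] compares the denoted ordinals. *)
Inductive ctree := leaf | node of nat -> ctree.

Fixpoint tle (s t : ctree) : Prop :=
  match s, t with
  | leaf, _ => True
  | node _, leaf => False
  | node f, node g => forall n, exists m, tle (f n) (g m)
  end.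

Lemma tle_refl s : tle s s.
Proof. by elim: s => //= f IH n; exists n. Qed.

Lemma tle_trans t s u : tle s t -> tle t u -> tle s u.
Proof.
elim: s t u => // f IH [|g] [|h] //= fg gh n.
by have [m /IH fgm] := fg n; have [k /fgm] := gh m; exists k.
Qed.

Lemma tle_total s t : tle s t \/ tle t s.
Proof.
elim: s t => [|f IH] [|g]; [by left|by left|by right|].
have [|/existsNP[n /forallNP fng]] := pselect (forall n, exists m, tle (f n) (g m)).
  by left.
by right => m; exists n; have [/fng|] := IH n (g m).
Qed.

Lemma tle_nodeN f n : ~ tle (node f) (f n).
Proof.
move E: (f n) => t; elim: t f n E => [f n _ []|g IH f n E fg].
by have [m] := fg n; rewrite E; exact: IH.
Qed.

Lemma tle_nodeP f t : tle (node f) t <-> forall n, ~ tle t (f n).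
Proof.
split=> [ft n tf|]; first exact: (@tle_nodeN f n (tle_trans ft tf)).
elim: t f => [|g IH] f H /=; first exact: (H 0%N I).
move=> n; have := H n; case: (f n) => [_|u]; first by exists 0%N.
move=> /existsNP[k /forallNP gku]; exists k; exact: IH.
Qed.

HB.instance Definition _ := gen_eqMixin ctree.
HB.instance Definition _ := gen_choiceMixin ctree.

Definition teq (s t : ctree) : bool := `[< tle s t >] && `[< tle t s >].

Lemma teq_equiv : equiv_class_of teq.
Proof.
split=> [s|s t|t s u]; rewrite /teq; first by rewrite asboolT//; exact: tle_refl.
- exact: andbC.
- move=> /andP[/asboolP st /asboolP ts] /andP[/asboolP tu /asboolP ut].
  by apply/andP; split; apply/asboolP; exact: (tle_trans (t := t)).
Qed.

Canonical teq_equivRel := EquivRelPack teq_equiv.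

(* The type of all countable ordinals, i.e. omega_1: by [cord_lt_wf],
   [cord_countable_initial] and [cord_countable_bounded] below it is well-ordered
   with countable initial segments and no countable cofinal subset. *)
Definition cord := {eq_quot teq}%qT.
HB.instance Definition _ := Choice.on cord.

Fact cord_display : Order.disp_t. Proof. exact: Order.Disp tt tt. Qed.

Definition cord_le (x y : cord) : bool := `[< tle (repr x) (repr y) >].

Fact cord_le_refl : reflexive cord_le.
Proof. by move=> x; apply/asboolP; exact: tle_refl. Qed.

Fact cord_le_anti : antisymmetric cord_le.
Proof.
move=> x y /andP[xy yx]; rewrite -[x]reprK -[y]reprK; apply/eqmodP.
exact/andP.
Qed.

Fact cord_le_trans : transitive cord_le.
Proof.
by move=> y x z /asboolP xy /asboolP yz; apply/asboolP; exact: tle_trans yz.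
Qed.

HB.instance Definition _ := Order.Le_isPOrder.Build cord_display cord
  cord_le_refl cord_le_anti cord_le_trans.

Fact cord_le_total : total (<=%O : rel cord).
Proof.
move=> x y; have [?|?] := tle_total (repr x) (repr y); apply/orP;
  by [left; apply/asboolP|right; apply/asboolP].
Qed.

HB.instance Definition _ := Order.POrder_isTotal.Build cord_display cord
  cord_le_total.

Local Open Scope quotient_scope.
Local Open Scope order_scope.

Definition cmk (t : ctree) : cord := \pi t.

Lemma cmkK (x : cord) : cmk (repr x) = x. Proof. exact: reprK. Qed.

Lemma cord_leP s t : reflect (tle s t) (cmk s <= cmk t).
Proof.
have K u : tle (repr (cmk u)) u /\ tle u (repr (cmk u)).
  have /eqmodP/andP[/asboolP ? /asboolP ?] : repr (cmk u) = u %[mod cord].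
    exact: reprK.
  by [].
have [s1 s2] := K s; have [t1 t2] := K t.
apply: (iffP (asboolP _)) => st.
  exact: tle_trans s2 (tle_trans st t1).
exact: tle_trans s1 (tle_trans st t2).
Qed.

(* [club u] is the least ordinal strictly greater than all the [u n]. *)
Definition club (u : nat -> cord) : cord := cmk (node (fun n => repr (u n))).

Lemma club_leP u x : reflect (forall n, u n < x) (club u <= x).
Proof.
rewrite -[x]cmkK; apply: (iffP (cord_leP _ _)).
  move=> /tle_nodeP H n; rewrite ltNge; apply/negP; rewrite -[u n]cmkK.
  by move/cord_leP; exact: H.
move=> H; apply/tle_nodeP => n /cord_leP; rewrite !cmkK => xu.
by have := le_lt_trans xu (H n); rewrite cmkK ltxx.
Qed.

Lemma lt_club u n : u n < club u.
Proof. by move: n; apply/club_leP. Qed.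

Definition cord0 : cord := cmk leaf.
Definition csucc (x : cord) : cord := club (fun=> x).
Definition cord1 : cord := csucc cord0.

Lemma cord_le0x x : cord0 <= x.
Proof. by rewrite -[x]cmkK; exact/cord_leP. Qed.

Lemma csucc_leP x y : (csucc x <= y) = (x < y).
Proof. by apply/club_leP/idP => // /(_ 0%N). Qed.

Lemma lt_csucc x : x < csucc x.
Proof. exact: (lt_club (fun=> x) 0%N). Qed.

Lemma cord_lt_wf : well_founded (fun x y : cord => x < y).
Proof.
suff H t x : x <= cmk t -> Acc (fun x y : cord => x < y) x.
  by move=> x; apply: (H (repr x)); rewrite cmkK.
elim: t x => [|f IH] x xt; constructor => y yx; have {yx xt} := lt_le_trans yx xt.
  by rewrite ltNge cord_le0x.
rewrite ltNge -[y]cmkK => /cord_leP/tle_nodeP/existsNP[n /contrapT yf].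
by apply: (IH n); exact/cord_leP.
Qed.

Lemma cord_countable_bounded (A : set cord) : countable A ->
  exists x, forall y, A y -> y < x.
Proof.
have [->|/set0P[a Aa]] := eqVneq A set0; first by exists cord0.
move=> /(pfcard_geP)[A0|[f]]; first by exists cord0 => y; rewrite A0.
exists (club f) => y Ay; have [n _ <-] : exists2 n, setT n & f n = y.
  exact: (@surj _ _ _ _ f).
exact: lt_club.
Qed.

Lemma cord_countable_initial (x : cord) : countable [set y | y < x].
Proof.
rewrite -[x]cmkK; elim: (repr x) => [|f IH].
  rewrite [X in countable X](_ : _ = set0)//; apply/seteqP; split=> // y /=.
  by rewrite ltNge cord_le0x.
pose F n (b : bool) : set cord :=
  if b then [set cmk (f n)] else [set y | y < cmk (f n)].
suff /sub_countable : [set y | y < cmk (node f)] #<= \bigcup_n \bigcup_b F n b.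
  apply; apply: bigcup_countable => // n _; apply: bigcup_countable => // -[_|_].
    exact: countable1.
  exact: IH.
apply: subset_card_le => y /=.
rewrite ltNge -[y]cmkK => /cord_leP/tle_nodeP/existsNP[n /contrapT yf].
have : cmk (repr y) <= cmk (f n) by exact/cord_leP.
rewrite le_eqVlt => /orP[/eqP yfn|yfn]; exists n => //.
  by exists true.
by exists false.
Qed.

Lemma cord_supremums (A : set cord) : countable A -> supremums A !=set0.
Proof.
move=> /cord_countable_bounded[x Ax].
have : ubound A x by move=> y /Ax /ltW.
elim/(well_founded_ind cord_lt_wf): x {Ax} => x IH ubx.
have [[y [yx uby]]|H] := pselect (exists y, y < x /\ ubound A y).
  exact: (IH y).
exists x; split=> // y uby; rewrite leNgt; apply/negP => yx; apply: H.
by exists y.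
Qed.

Definition csup (A : set cord) : cord := supremum cord0 A.

(* The first infinite ordinal. *)
Definition comega : cord := csup (range (fun n => iter n csucc cord0)).

(* Transfinite recursion: [crec z s] sends 0 to z, x + 1 to s (crec z s x), and
   a limit x to sup_(y < x) crec z s y. *)
Definition crec_step (z : cord) (s : cord -> cord) (x : cord)
    (rec : forall y, y < x -> cord) : cord :=
  match pselect (exists y, x = csucc y) with
  | left e => let y := cid e in
      s (rec (projT1 y) (eq_ind_r (fun x => projT1 y < x) (lt_csucc _) (projT2 y)))
  | right _ => if x == cord0 then z
               else csup [set w | exists y (yx : y < x), w = rec y yx]
  end.

Definition crec (z : cord) (s : cord -> cord) : cord -> cord :=
  Fix cord_lt_wf (fun=> cord) (crec_step z s).

Definition climit (x : cord) := x <> cord0 /\ forall y, x <> csucc y.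

Lemma crecE z s x : crec z s x = crec_step z s (fun y (_ : y < x) => crec z s y).
Proof.
rewrite /crec Fix_eq// => {}x f g fg; congr crec_step.
by apply: functional_extensionality_dep => y;
  apply: functional_extensionality_dep => yx.
Qed.

Lemma csucc_inj : injective csucc.
Proof.
move=> x y xy; apply/le_anti; rewrite !leNgt -!csucc_leP -{1}xy {2}xy.
by rewrite !csucc_leP !ltxx.
Qed.

Lemma csucc_neq0 x : csucc x <> cord0.
Proof. by move=> x0; have := lt_csucc x; rewrite x0 ltNge cord_le0x. Qed.

Lemma crec0 z s : crec z s cord0 = z.
Proof.
rewrite crecE /crec_step; case: pselect => [[y /esym/csucc_neq0]//|_].
by rewrite eqxx.
Qed.

Lemma crecS z s x : crec z s (csucc x) = s (crec z s x).
Proof.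
rewrite crecE /crec_step; case: pselect => [e|[]]; last by exists x.
by case: cid => y /= /csucc_inj ->.
Qed.

Lemma crec_lim z s x : climit x ->
  crec z s x = csup [set crec z s y | y in [set y | y < x]].
Proof.
move=> [x0 xS]; rewrite crecE /crec_step.
case: pselect => [[y /xS]//|_]; rewrite (introF eqP x0); congr csup.
by apply/seteqP; split=> w [y]; [move=> [yx ->]; exists y|move=> yx <-; exists y, yx].
Qed.

(* Ordinal sum, product and power. The limit clause of [cpow] is the usual one
   for x >= 1; only infinite bases are used. *)
Definition cadd (x : cord) : cord -> cord := crec x csucc.
Definition cmul (x : cord) : cord -> cord := crec cord0 (fun w => cadd w x).
Definition cpow (x : cord) : cord -> cord := crec cord1 (fun w => cmul w x).

(* The ordinal interval [1, a] with its order topology; empty when a = 0. *)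
Definition cseg (a : cord) : Type := {x : cord | cord1 <= x <= a}.
HB.instance Definition _ a := SubType.on (cseg a).
HB.instance Definition _ a := Choice.on (cseg a).
HB.instance Definition _ a := [SubChoice_isSubOrder of cseg a by <: with cord_display].
HB.instance Definition _ a :=
  OrderTopological.copy (cseg a) (order_topology (cseg a)).

Definition tychonoff_space (X : topologicalType) :=
  completely_regular_space X /\ hausdorff_space X.

Definition homeomorphic (X Y : topologicalType) :=
  exists (f : X -> Y) (g : Y -> X),
    [/\ continuous f, continuous g, cancel f g & cancel g f].

Local Close Scope order_scope.
Local Open Scope ring_scope.

(* C_p(X): continuous real functions with the topology of pointwise convergence
   and the pointwise vector space structure. *)
Definition Cp (R : realType) (X : topologicalType) : Type := continuousType X R.

Section Cp_instances.
Variables (R : realType) (X : topologicalType).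
Implicit Types (f g h : Cp R X).

HB.instance Definition _ := Choice.on (Cp R X).
HB.instance Definition _ := Topological.copy (Cp R X)
  (initial_topology (fun f : Cp R X => (f : X -> R) : {ptws X -> R})).

Fact Cp_add_subproof f g : continuous (fun x => f x + g x).
Proof. by move=> x; apply: cvgD; exact: cts_fun. Qed.
Fact Cp_opp_subproof f : continuous (fun x => - f x).
Proof. by move=> x; apply: cvgN; exact: cts_fun. Qed.
Fact Cp_scale_subproof (c : R) f : continuous (fun x => c * f x).
Proof. by move=> x; apply: cvgMr; exact: cts_fun. Qed.

Definition Cp_zero : Cp R X := cst 0.
Definition Cp_add f g : Cp R X := mkcts (@Cp_add_subproof f g).
Definition Cp_opp f : Cp R X := mkcts (@Cp_opp_subproof f).
Definition Cp_scale (c : R) f : Cp R X := mkcts (@Cp_scale_subproof c f).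

Fact Cp_addA : associative Cp_add.
Proof. by move=> f g h; apply/continuousEP => x; exact: addrA. Qed.
Fact Cp_addC : commutative Cp_add.
Proof. by move=> f g; apply/continuousEP => x; exact: addrC. Qed.
Fact Cp_add0 : left_id Cp_zero Cp_add.
Proof. by move=> f; apply/continuousEP => x; exact: add0r. Qed.
Fact Cp_addN : left_inverse Cp_zero Cp_opp Cp_add.
Proof. by move=> f; apply/continuousEP => x; exact: addNr. Qed.

HB.instance Definition _ := GRing.isZmodule.Build (Cp R X)
  Cp_addA Cp_addC Cp_add0 Cp_addN.

Fact Cp_scaleA a b f : Cp_scale a (Cp_scale b f) = Cp_scale (a * b) f.
Proof. by apply/continuousEP => x; exact: mulrA. Qed.
Fact Cp_scale1 : left_id 1 Cp_scale.
Proof. by move=> f; apply/continuousEP => x; exact: mul1r. Qed.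
Fact Cp_scaleDr : right_distributive Cp_scale +%R.
Proof. by move=> c f g; apply/continuousEP => x; exact: mulrDr. Qed.
Fact Cp_scaleDl f : {morph Cp_scale^~ f : a b / a + b}.
Proof. by move=> a b; apply/continuousEP => x; exact: mulrDl. Qed.

HB.instance Definition _ := GRing.Zmodule_isLmodule.Build R (Cp R X)
  Cp_scaleA Cp_scale1 Cp_scaleDr Cp_scaleDl.

End Cp_instances.

(* Linear homeomorphism between C_p(X) and C_p(Y). *)
Definition Cp_isomorphic (R : realType) (X Y : topologicalType) :=
  exists (f : {linear Cp R X -> Cp R Y}) (g : {linear Cp R Y -> Cp R X}),
    [/\ continuous f, continuous g, cancel f g & cancel g f].

(* Main.v *)
Require Import Defs.
From HB Require Import structures.
From mathcomp Require Import all_boot all_order all_algebra.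
From mathcomp Require Import all_classical all_reals all_analysis.
Import Defs.
From mathcomp Require Import ring lra.
Set Implicit Arguments.
Unset Strict Implicit.
Unset Printing Implicit Defensive.
Import Order.TTheory GRing.Theory Num.Theory.
Import numFieldNormedType.Exports.
Local Open Scope classical_set_scope.
Local Open Scope order_scope.

(** Let l be the least infinite ordinal with a < l^omega; it has the form
omega^(omega^d), and l <= a. The three conditions are linked by two facts: the
space C_p([1, a]) is determined by l, and it cannot be mapped onto C_p([1, b])
when b >= l^omega = a^omega.

The first fact ([iso_Cspace]) is an instance of Pelczynski's decomposition
method ([pelczynski]). For a <= b the space C([1, a]) is a direct summand of
C([1, b]). As l is additively indecomposable, [1, l) can be cut into pieces whose
lengths run through a cofinal sequence with arbitrary repetitions, so C([1, l])
contains its own c_0-sum as a summand ([retr_c0_Cspace]). Cutting [1, l m] into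
blocks of length l shows that C([1, l m]) is a summand of the sum of C([1, m])
and a c_0-sum of copies of C([1, l]) ([retr_product]); hence every C([1, l^n]) is
a summand of C([1, l]). All operators involved have rows that are finitely
supported and bounded in l_1 ([kop]): they are continuous for the pointwise
topology and are compatible with c_0-sums.

The second fact ([not_separates_omega]) concerns a bounded operator T from
C([1, a]) to C([1, b]) whose adjoint sends the points of [1, b] to functionals at
mutual distance at least c > 0. By induction one may take a = l and suppose that
no such operator leads from C([1, x]), x < l, to C([1, l]). Then at the multiples
of l in [1, b] the functionals have mass at most M - c / 16 away from the point l,
where M bounds the norms ([sep_mass_drop]): otherwise the functionals near such a
multiple live, up to small errors, on some (0, x] and at l, their values at l
almost agree, and their restrictions to (0, x] separate the points of a copy of
[1, l]. The multiples of l in [1, l^(n + 1)] form a copy of [1, l^n]; repeating the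
argument n times gives n c / 16 <= M, so that b < l^omega.

It remains to see that a surjection T from C_p([1, a]) to C_p(Y) makes Y an
interval [1, b] and gives a separating operator. Pointwise continuity makes the
functionals f |-> T f y finitely supported ([finite_support]). The uniform
boundedness principle on Y and surjectivity give the constant c ([adj_sep]). As
[1, a] is countable, the finitely supported functionals form a norm-separable
space, so a norm-separated family of them is countable ([countable_range]). Y is
pseudocompact because each of the functionals f |-> T f y is bounded
([pseudocompact_range]), and a countable pseudocompact Tychonoff space is compact
([compact_range]). A countable compact Hausdorff space is an interval [1, b] by the theorem of Mazurkiewicz and Sierpinski
([isord_setT]), and uniform boundedness on [1, a] gives M. *)

(** * Arithmetic of countable ordinals *)

Section Ordinals.
Implicit Types x y z w : cord.

Lemma lt_csuccE x y : (x < csucc y) = (x <= y).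
Proof. by rewrite ltNge csucc_leP -leNgt. Qed.

Lemma csucc_le x y : (csucc x <= csucc y) = (x <= y).
Proof. by rewrite csucc_leP lt_csuccE. Qed.

Lemma cord_le0 x : (x <= cord0) = (x == cord0).
Proof. by rewrite eq_le cord_le0x andbT. Qed.

Lemma cord_gt0 x : (cord0 < x) = (x != cord0).
Proof. by rewrite lt_def cord_le0x andbT. Qed.

Lemma csucc_gt0 x : cord0 < csucc x.
Proof. by rewrite lt_csuccE cord_le0x. Qed.

Lemma cord1_le x : (cord1 <= x) = (cord0 < x).
Proof. by rewrite csucc_leP. Qed.

Lemma cord_case x : [\/ x = cord0, exists y, x = csucc y | climit x].
Proof.
have [->|x0] := eqVneq x cord0; first by constructor 1.
have [?|H] := pselect (exists y, x = csucc y); first by constructor 2.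
constructor 3; split; first exact/eqP.
by move=> y xy; apply: H; exists y.
Qed.

Lemma climit_gt0 x : climit x -> cord0 < x.
Proof. by case=> x0 _; rewrite cord_gt0; apply/eqP. Qed.

Lemma climit_lt x y : climit x -> y < x -> csucc y < x.
Proof.
move=> [_ xS] yx; rewrite lt_neqAle csucc_leP yx andbT.
by apply/eqP => /esym/xS.
Qed.

Lemma cord_ind (P : cord -> Prop) :
  (forall x, (forall y, y < x -> P y) -> P x) -> forall x, P x.
Proof. by move=> H; exact: (well_founded_ind cord_lt_wf). Qed.

Lemma cord_ind3 (P : cord -> Prop) :
  P cord0 -> (forall x, P x -> P (csucc x)) ->
  (forall x, climit x -> (forall y, y < x -> P y) -> P x) -> forall x, P x.
Proof.
move=> P0 PS PL; apply: cord_ind => x IH.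
have [->//|[y xy]|xl] := cord_case x; last exact: PL.
by rewrite xy; apply: PS; apply: IH; rewrite xy lt_csucc.
Qed.

Lemma cord_least (P : cord -> Prop) x : P x ->
  exists y, P y /\ forall z, P z -> y <= z.
Proof.
elim/cord_ind: x => x IH Px.
have [[y [yx Py]]|H] := pselect (exists y, y < x /\ P y); first exact: (IH y).
exists x; split=> // z Pz; rewrite leNgt; apply/negP => zx.
by apply: H; exists z.
Qed.

Lemma csup_le (A : set cord) y : countable A ->
  (csup A <= y) <-> (forall x, A x -> x <= y).
Proof.
move=> /cord_supremums A0; have [H1 H2] : supremums A (csup A).
  have [u Au] := A0.
  rewrite /csup /supremum; case: ifPn => [/eqP ->|_].
    by split=> [x []|x _]; exact: cord_le0x.
  by case: xgetP => [z _|/(_ u)].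
split=> [Ay x Ax|/H2//]; exact: le_trans (H1 _ Ax) Ay.
Qed.

Lemma countable_crec z s x : countable [set crec z s y | y in [set y | y < x]].
Proof. by exact: sub_countable (card_image_le _ _) (cord_countable_initial x). Qed.

Lemma crec_lim_le z s x w : climit x ->
  (crec z s x <= w) <-> (forall y, y < x -> crec z s y <= w).
Proof.
move=> xl; rewrite crec_lim// csup_le; last exact: countable_crec.
split=> [H y yx|H _ [y /= yx <-]]; last exact: H.
by apply: H; exists y.
Qed.

Lemma crec_lim_lt z s x w : climit x ->
  (w < crec z s x) <-> (exists2 y, y < x & w < crec z s y).
Proof.
move=> xl; split=> [wx|[y yx wy]].
  apply: contrapT => H; have : crec z s x <= w.
    apply/(crec_lim_le _ _ _ xl) => y yx; rewrite leNgt; apply/negP => wy.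
    by apply: H; exists y.
  by rewrite leNgt wx.
apply: lt_le_trans wy _.
by have /(crec_lim_le _ _ _ xl) := lexx (crec z s x); apply.
Qed.

Lemma crec_homo z s x y : (forall w, w < s w) -> x < y -> crec z s x < crec z s y.
Proof.
move=> ss; elim/cord_ind3: y => [|y IH|y yl IH].
- by rewrite ltNge cord_le0x.
- rewrite lt_csuccE crecS le_eqVlt => /orP[/eqP->//|xy].
  exact: lt_trans (IH xy) _.
- move=> xy; apply/crec_lim_lt => //; exists (csucc x).
    exact: climit_lt.
  by rewrite crecS.
Qed.

(** Ordinal sums and products are normal in the right argument, and the algebraic
    laws below come from the uniqueness of normal functions satisfying the same
    recursion. *)
Definition normal (F : cord -> cord) :=
  {homo F : x y / x < y} /\
  forall x, climit x -> forall w, w < F x -> exists2 y, y < x & w < F y.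

Lemma normal_crec z s : (forall w, w < s w) -> normal (crec z s).
Proof.
move=> ss; split=> [x y|x xl w]; first exact: crec_homo.
by move/crec_lim_lt; exact.
Qed.

Section Normal.
Variables (F : cord -> cord) (nF : normal F).

Lemma normal_lt : {mono F : x y / x < y}.
Proof.
move=> x y; apply/idP/idP; last exact: nF.1.
by apply: contraTT; rewrite -!leNgt le_eqVlt => /orP[/eqP->//|/nF.1/ltW].
Qed.

Lemma normal_le : {mono F : x y / x <= y}.
Proof. by move=> x y; rewrite !leNgt normal_lt. Qed.

Lemma normal_inj : injective F.
Proof. by move=> x y xy; apply/le_anti; rewrite -normal_le -[y <= x]normal_le xy lexx. Qed.

Lemma normal_id x : x <= F x.
Proof.
elim/cord_ind: x => x IH; rewrite leNgt; apply/negP => Fx.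
by have := IH _ Fx; rewrite normal_le leNgt Fx.
Qed.

(** By continuity there is a largest x with F x <= w. This gives subtraction and
    division of ordinals. *)
Lemma normal_floor w : F cord0 <= w -> exists x, F x <= w < F (csucc x).
Proof.
move=> F0w; have [y [wy ymin]] : exists y, w < F y /\ forall z, w < F z -> y <= z.
  apply: (@cord_least _ (csucc w)); apply: lt_le_trans (lt_csucc w) _.
  exact: normal_id.
have [y0|[x yx]|yl] := cord_case y.
- by move: wy; rewrite y0 ltNge F0w.
- exists x; rewrite -yx wy andbT leNgt; apply/negP => /ymin.
  by rewrite yx leNgt lt_csucc.
- by have [z zy /ymin] := nF.2 y yl w wy; rewrite leNgt zy.
Qed.

Lemma normal_lim x : climit x -> climit (F x).
Proof.
move=> xl; split=> [F0|y Fy].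
  have := nF.1 _ _ (climit_gt0 xl); rewrite F0; by rewrite ltNge cord_le0x.
have [z zx yz] : exists2 z, z < x & y < F z by apply: nF.2 => //; rewrite Fy lt_csucc.
by have := nF.1 _ _ zx; rewrite Fy lt_csuccE leNgt yz.
Qed.

End Normal.

Lemma normal_comp F G : normal F -> normal G -> normal (F \o G).
Proof.
move=> nF nG; split=> [x y xy|x xl w /=]; first by apply: nF.1; exact: nG.1.
move=> /(nF.2 _ (normal_lim nG xl))[u uG wu].
by have [v vx uv] := nG.2 _ xl _ uG; exists v => //; apply: lt_trans wu _; exact: nF.1.
Qed.

Lemma normal_ext F G : normal F -> normal G -> F cord0 = G cord0 ->
  (forall x, F x = G x -> F (csucc x) = G (csucc x)) -> F =1 G.
Proof.
move=> nF nG FG0 FGS; elim/cord_ind3 => // x xl IH.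
apply/le_anti/andP; split; rewrite leNgt; apply/negP.
  by move=> /(nF.2 _ xl)[y yx]; rewrite IH// => /lt_trans/(_ (nG.1 _ _ yx)); rewrite ltxx.
by move=> /(nG.2 _ xl)[y yx]; rewrite -IH// => /lt_trans/(_ (nF.1 _ _ yx)); rewrite ltxx.
Qed.

(** ** Addition *)

Lemma normal_add x : normal (cadd x).
Proof. by apply: normal_crec => w; exact: lt_csucc. Qed.

Lemma caddx0 x : cadd x cord0 = x. Proof. exact: crec0. Qed.
Lemma caddxS x y : cadd x (csucc y) = csucc (cadd x y). Proof. exact: crecS. Qed.

Lemma cadd_ltr x : {mono cadd x : y z / y < z}.
Proof. exact: normal_lt (normal_add x). Qed.
Lemma cadd_ler x : {mono cadd x : y z / y <= z}.
Proof. exact: normal_le (normal_add x). Qed.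
Lemma caddI x : injective (cadd x).
Proof. exact: normal_inj (normal_add x). Qed.
Lemma le_caddr x y : y <= cadd x y.
Proof. exact: normal_id (normal_add x) _. Qed.

Lemma le_caddl x y : x <= cadd x y.
Proof. by rewrite -{1}(caddx0 x) cadd_ler cord_le0x. Qed.
Lemma lt_caddl x y : (x < cadd x y) = (cord0 < y).
Proof. by rewrite -{1}(caddx0 x) cadd_ltr. Qed.

Lemma normal_idfun : normal id.
Proof.
split=> // x xl w wx; exists (csucc w); first exact: climit_lt.
exact: lt_csucc.
Qed.

Lemma cadd0x x : cadd cord0 x = x.
Proof.
apply: (normal_ext (normal_add _) normal_idfun); first exact: caddx0.
by move=> y yE; rewrite caddxS yE.
Qed.

Lemma caddA x y z : cadd x (cadd y z) = cadd (cadd x y) z.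
Proof.
apply: (normal_ext (normal_comp (normal_add x) (normal_add y)) (normal_add _)).
  by rewrite /= !caddx0.
by move=> w /= wE; rewrite !caddxS wE.
Qed.

Lemma cadd_subK x y : x <= y -> exists z, y = cadd x z.
Proof.
move=> xy; have [|z /andP[zy]] := normal_floor (normal_add x) (w := y).
  by rewrite caddx0.
by rewrite caddxS lt_csuccE => yz; exists z; apply/le_anti; rewrite yz.
Qed.

Lemma cadd_lim_lt x y w : climit y -> w < cadd x y ->
  exists2 z, z < y & w < cadd x z.
Proof. by move=> yl; exact: (normal_add x).2. Qed.

Lemma cadd_le2l x y z : x <= y -> cadd x z <= cadd y z.
Proof.
move=> xy; elim/cord_ind3: z => [|z|z zl IH]; first by rewrite !caddx0.
  by rewrite !caddxS csucc_le.
rewrite leNgt; apply/negP => /(cadd_lim_lt zl)[u uz].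
rewrite ltNge => /negP; apply; apply: le_trans (IH _ uz) _.
by rewrite cadd_ler ltW.
Qed.

(** ** Multiplication *)

Lemma cmulx0 x : cmul x cord0 = cord0. Proof. exact: crec0. Qed.
Lemma cmulxS x y : cmul x (csucc y) = cadd (cmul x y) x. Proof. exact: crecS. Qed.

Lemma normal_mul x : cord0 < x -> normal (cmul x).
Proof. by move=> x0; apply: normal_crec => w; rewrite lt_caddl. Qed.

Lemma cmulx1 x : cmul x cord1 = x.
Proof. by rewrite cmulxS cmulx0 cadd0x. Qed.

Lemma cmul1x x : cmul cord1 x = x.
Proof.
apply: (normal_ext (normal_mul (csucc_gt0 _)) normal_idfun); first exact: cmulx0.
by move=> y yE; rewrite cmulxS yE caddxS caddx0.
Qed.

Lemma cmulDr x y z : cord0 < x -> cmul x (cadd y z) = cadd (cmul x y) (cmul x z).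
Proof.
move=> x0; apply: (normal_ext (normal_comp (normal_mul x0) (normal_add y))
  (normal_comp (normal_add _) (normal_mul x0))).
  by rewrite /= cmulx0 !caddx0.
by move=> w /= wE; rewrite caddxS !cmulxS wE caddA.
Qed.

Lemma cmul_gt0 x y : cord0 < x -> cord0 < y -> cord0 < cmul x y.
Proof. by move=> x0 y0; rewrite -(cmulx0 x); exact: (normal_mul x0).1. Qed.

Lemma cmulA x y z : cord0 < x -> cord0 < y -> cmul x (cmul y z) = cmul (cmul x y) z.
Proof.
move=> x0 y0; apply: (normal_ext (normal_comp (normal_mul x0) (normal_mul y0))
  (normal_mul (cmul_gt0 x0 y0))).
  by rewrite /= !cmulx0.
by move=> w /= wE; rewrite !cmulxS cmulDr// wE.
Qed.

Lemma cmul_le x y z : cord0 < x -> y <= z -> cmul x y <= cmul x z.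
Proof. by move=> x0 yz; rewrite (normal_le (normal_mul x0)). Qed.

Lemma cmul_lt x y z : cord0 < x -> y < z -> cmul x y < cmul x z.
Proof. by move=> x0; exact: (normal_mul x0).1. Qed.

Lemma cmul_le2l x y z : x <= y -> cmul x z <= cmul y z.
Proof.
move=> xy; have [x0|x0] := eqVneq x cord0.
  suff -> : cmul x z = cord0 by exact: cord_le0x.
  rewrite x0; elim/cord_ind3: z => [|z|z zl IH]; first by rewrite cmulx0.
    by rewrite cmulxS => ->; rewrite caddx0.
  apply/eqP; rewrite -cord_le0; apply/crec_lim_le => // w /IH; rewrite /cmul => ->.
  exact: lexx.
rewrite -cord_gt0 in x0; elim/cord_ind3: z => [|z|z zl IH]; first by rewrite !cmulx0.
  rewrite !cmulxS => IH; apply: le_trans (cadd_le2l _ IH) _.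
  by rewrite cadd_ler.
rewrite leNgt; apply/negP => /((normal_mul x0).2 _ zl)[u uz].
rewrite ltNge => /negP; apply; apply: le_trans (IH _ uz) _.
by apply: cmul_le (ltW uz); exact: lt_le_trans x0 xy.
Qed.

(** Remainders are taken in (0, x], since the blocks (x y, x (y + 1)] are clopen;
    the multiples of x by limits lie in no block. *)
Lemma cmul_div x w : cord0 < x -> cord0 < w ->
  (exists2 y, climit y & w = cmul x y) \/
  exists y r, (cord0 < r <= x) /\ w = cadd (cmul x y) r.
Proof.
move=> x0 w0; have nx := normal_mul x0.
have [|y /andP[yw wy]] := normal_floor nx (w := w).
  by rewrite cmulx0 cord_le0x.
have [r wr] := cadd_subK yw; move: wy; rewrite {1}wr cmulxS cadd_ltr => rx.
have [r0|r0] := eqVneq r cord0; last first.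
  by right; exists y, r; rewrite cord_gt0 r0 (ltW rx).
move: wr; rewrite r0 caddx0 => wE.
have [y0|[z yz]|yl] := cord_case y; last by left; exists y.
  by move: w0; rewrite wE y0 cmulx0 ltxx.
by right; exists z, x; rewrite lexx x0 wE yz cmulxS.
Qed.

Lemma cmul_div_uniq x y r y' r' : cord0 < x ->
  cord0 < r <= x -> cord0 < r' <= x ->
  cadd (cmul x y) r = cadd (cmul x y') r' -> y = y' /\ r = r'.
Proof.
move=> x0 rx rx' E; suff yy' : y = y'.
  by split=> //; move: E; rewrite yy' => /caddI.
wlog : y r y' r' rx rx' E / y < y'.
  move=> H; have [yy'|yy'|//] := ltgtP y y'; first exact: (H y r y' r').
  by symmetry; exact: (H y' r' y r).
rewrite -csucc_leP => /(cmul_le x0); rewrite cmulxS.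
have /andP[r0 rx1] := rx; have /andP[r'0 _] := rx' => yy'.
have : cadd (cmul x y) r < cadd (cmul x y') r'.
  apply: le_lt_trans (_ : cmul x y' < _); last by rewrite lt_caddl.
  by apply: le_trans yy'; rewrite cadd_ler.
by rewrite E ltxx.
Qed.

Lemma cmul_lim_neq x y y' r' : cord0 < x -> climit y -> cord0 < r' <= x ->
  cmul x y <> cadd (cmul x y') r'.
Proof.
move=> x0 yl /andP[r0 rx] E; have nx := normal_mul x0.
have y'y : y' < y by rewrite -(normal_lt nx) E lt_caddl.
have := nx.1 _ _ (climit_lt yl y'y); rewrite E cmulxS ltNge cadd_ler.
by rewrite rx.
Qed.

(** ** Finite powers *)

Definition natc n : cord := iter n csucc cord0.

(** The base is the left factor because the inductions on n below consider the
    multiples of x in [1, x^(n + 1)], which form a copy of [1, x^n]. *)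
Definition cpown x n : cord := iter n (cmul x) cord1.

Lemma cpown_gt0 x n : cord0 < x -> cord0 < cpown x n.
Proof. by move=> x0; elim: n => [|n IH]; [exact: csucc_gt0|exact: cmul_gt0]. Qed.

Lemma cpownSr x n : cord0 < x -> cpown x n.+1 = cmul (cpown x n) x.
Proof.
move=> x0; elim: n => [|n IH]; first by rewrite /= cmulx1 cmul1x.
by rewrite [LHS](_ : _ = cmul x (cpown x n.+1))// {1}IH cmulA// cpown_gt0.
Qed.

Lemma natcS n : natc n.+1 = csucc (natc n). Proof. by []. Qed.

Lemma cpow_nat x n : cord0 < x -> cpow x (natc n) = cpown x n.
Proof.
move=> x0; elim: n => [|n IH]; first exact: crec0.
by rewrite cpownSr// natcS /cpow crecS -/(cpow x _) IH.
Qed.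

Lemma countable_range_nat (f : nat -> cord) : countable (range f).
Proof. by exact: sub_countable (card_image_le _ _) (countableP _). Qed.

Lemma natc_lt_omega n : natc n < comega.
Proof.
apply: lt_le_trans (lt_csucc _) _; rewrite -natcS.
by have /(csup_le _ (countable_range_nat _)) := lexx comega; apply; exists n.+1.
Qed.

Lemma lt_omegaP x : x < comega -> exists n, x = natc n.
Proof.
move=> xo; suff [n xn] : exists n, x <= natc n.
  elim: n x xn {xo} => [|n IH] x; first by rewrite cord_le0 => /eqP; exists 0%N.
  rewrite natcS le_eqVlt => /orP[/eqP->|]; first by exists n.+1.
  by rewrite lt_csuccE => /IH.
apply: contrapT => H; move: xo; rewrite ltNge => /negP; apply.
apply/(csup_le _ (countable_range_nat _)) => _ [n _ <-]; rewrite leNgt; apply/negP => nx.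
by apply: H; exists n; rewrite ltW.
Qed.

Lemma comega_lim : climit comega.
Proof.
split=> [E|y oy]; first by have := natc_lt_omega 0; rewrite E ltxx.
have /lt_omegaP[n yn] : y < comega by rewrite oy lt_csucc.
by have := natc_lt_omega n.+1; rewrite oy yn ltxx.
Qed.

Lemma lt_cpow_omega x y : cord0 < x ->
  y < cpow x comega <-> exists n, y < cpown x n.
Proof.
move=> x0; rewrite (crec_lim_lt _ _ _ comega_lim); split.
  by move=> [_ /lt_omegaP[n ->]]; rewrite -/(cpow x _) cpow_nat//; exists n.
by move=> [n]; rewrite -cpow_nat//; exists (natc n) => //; exact: natc_lt_omega.
Qed.

Lemma cpow_omega_le x y : cord0 < x ->
  cpow x comega <= y <-> forall n, cpown x n <= y.
Proof.
move=> x0; split=> [H n|H].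
  rewrite leNgt; apply/negP => yn; have : y < cpow x comega.
    by apply/lt_cpow_omega => //; exists n.
  by rewrite ltNge H.
rewrite leNgt; apply/negP => /(lt_cpow_omega _ x0)[n].
by rewrite ltNge H.
Qed.

Lemma cpown_le x y n : x <= y -> cord0 < x -> cpown x n <= cpown y n.
Proof.
move=> xy x0; elim: n => [//|n IH] /=.
by apply: le_trans (cmul_le2l _ xy) _; apply: cmul_le => //; exact: lt_le_trans xy.
Qed.

Lemma cpownD x m n : cord0 < x -> cpown x (m + n) = cmul (cpown x m) (cpown x n).
Proof.
move=> x0; elim: m => [|m IH]; first by rewrite add0n cmul1x.
by rewrite addSn /= IH cmulA// cpown_gt0.
Qed.

Lemma cpownM x m n : cord0 < x -> cpown (cpown x m) n = cpown x (m * n).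
Proof.
move=> x0; elim: n => [|n IH]; first by rewrite muln0.
by rewrite /= IH mulnS cpownD.
Qed.

Lemma cpow_omega_le2 x y : cord0 < x -> x < cpow y comega -> cord0 < y ->
  cpow x comega <= cpow y comega.
Proof.
move=> x0 + y0; move=> /(lt_cpow_omega _ y0)[m xm].
apply/cpow_omega_le => // n; apply: le_trans (cpown_le n (ltW xm) x0) _.
by rewrite cpownM//; move/cpow_omega_le: (lexx (cpow y comega)); apply.
Qed.

Lemma comega_gt1 : cord1 < comega. Proof. exact: (natc_lt_omega 1). Qed.
Lemma comega_gt0 : cord0 < comega. Proof. exact: (natc_lt_omega 0). Qed.

Lemma lt_cpow_omega_self x : cord1 < x -> x < cpow x comega.
Proof.
move=> x1; have x0 := lt_trans (csucc_gt0 _) x1.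
apply/lt_cpow_omega => //; exists 2%N => /=.
by rewrite cmulx1 -{1}(cmulx1 x); exact: cmul_lt.
Qed.

(** ** Indecomposable ordinals *)

(** These are the ordinals omega^d with d >= 1. *)
Definition indec x := climit x /\ forall y, y < x -> cadd y x = x.

Lemma indecD x y z : indec x -> y < x -> z < x -> cadd y z < x.
Proof. by move=> [_ H] yx zx; rewrite -(H y yx) cadd_ltr. Qed.

(** These are the ordinals omega^(omega^d), the least elements of the classes of
    infinite ordinals with a given omega-th power. *)
Definition pow_closed x := comega <= x /\
  forall y, comega <= y -> y < x -> cpow y comega <= x.

Lemma natcD m n : cadd (natc m) (natc n) = natc (m + n).
Proof.
elim: n => [|n IH]; first by rewrite caddx0 addn0.
by rewrite natcS caddxS IH addnS.
Qed.

Lemma pow_closed_indec x : pow_closed x -> indec x.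
Proof.
move=> [ox H].
have D y z : y < x -> z < x -> cadd y z < x.
  move=> yx zx; wlog yz : y z yx zx / y <= z.
    move=> W; have [/W->//|/ltW zy] := leP y z.
    apply: le_lt_trans (W y y _ _ (lexx _)) => //.
    by rewrite cadd_ler.
  apply: le_lt_trans (cadd_le2l _ yz) _.
  have [oz|zo] := leP comega z; last first.
    have [n ->] := lt_omegaP zo; rewrite natcD.
    exact: lt_le_trans (natc_lt_omega _) ox.
  apply: lt_le_trans (H z oz zx); have z1 := lt_le_trans comega_gt1 oz.
  have z0 := lt_le_trans comega_gt0 oz.
  apply: le_lt_trans (_ : cpown z 2 < _).
    rewrite (_ : cadd z z = cmul z (natc 2)).
      by rewrite /= cmulx1; apply: cmul_le => //; apply: le_trans oz; apply: ltW;
        exact: (natc_lt_omega 2).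
    by rewrite /natc /= !cmulxS cmulx0 cadd0x.
  apply/lt_cpow_omega => //; exists 3%N; rewrite (cpownSr 2 z0).
  by rewrite -{1}(cmulx1 (cpown z 2)); apply: cmul_lt => //; exact: cpown_gt0.
have xl : climit x.
  split=> [x0|y xy].
    by have := lt_le_trans comega_gt0 ox; rewrite x0 ltxx.
  have yx : y < x by rewrite xy lt_csucc.
  have := D y cord1 yx (lt_le_trans comega_gt1 ox).
  by rewrite caddxS caddx0 xy ltxx.
split=> // y yx; apply/le_anti; rewrite le_caddr andbT leNgt; apply/negP.
move=> /(cadd_lim_lt xl)[z zx]; apply/negP; rewrite -leNgt.
by apply: ltW; exact: D.
Qed.

(** The least infinite y with x < y^omega works: a smaller infinite z has
    z^omega <= x, and z^omega > y would imply y^omega <= z^omega. *)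
Lemma pow_closed_exists x : comega <= x ->
  exists y, [/\ pow_closed y, y <= x & x < cpow y comega].
Proof.
move=> ox; have [y [[oy xy] ymin]] : exists y,
    (comega <= y /\ x < cpow y comega) /\
    forall z, comega <= z /\ x < cpow z comega -> y <= z.
  apply: (@cord_least _ x); split=> //.
  by apply: lt_cpow_omega_self; exact: lt_le_trans comega_gt1 ox.
have x1 := lt_le_trans comega_gt1 ox.
exists y; split=> //; last by apply: ymin; split=> //; exact: lt_cpow_omega_self.
split=> // z oz zy; rewrite leNgt; apply/negP => yz.
have z0 := lt_le_trans comega_gt0 oz; have y0 := lt_le_trans comega_gt0 oy.
have : y <= z.
  apply: ymin; split=> //; apply: lt_le_trans xy _.
  exact: cpow_omega_le2.
by rewrite leNgt zy.
Qed.

(** The neighbourhood (a, x y] contains a copy of (0, x]: a whole block if y is a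
    limit, and otherwise a tail of the last block, which has length x again because
    x is indecomposable. *)
Lemma indec_tail x y a : indec x -> cord0 < y -> a < cmul x y ->
  exists2 b, a <= b & cadd b x <= cmul x y.
Proof.
move=> xi y0 ay; have x0 := climit_gt0 xi.1.
have [yE|[z yz]|yl] := cord_case y.
- by rewrite yE ltxx in y0.
- move: ay; rewrite yz cmulxS => az; have [c cx ac] := cadd_lim_lt xi.1 az.
  by exists (cadd (cmul x z) c); [exact: ltW|rewrite -caddA xi.2].
- have [z zy az] := (normal_mul x0).2 _ yl _ ay; exists (cmul x z); first exact: ltW.
  by rewrite -cmulxS; apply: cmul_le => //; rewrite csucc_leP.
Qed.

End Ordinals.

Local Open Scope ring_scope.
Local Open Scope order_scope.

(** * Function spaces and operators with finitely supported rows *)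

Section Operators.
Variable R : realType.

(** A combination of evaluations whose coefficients have total mass at most C. *)
Definition frep (S : Type) (C : R) (phi : (S -> R) -> R) :=
  exists l : seq (R * S), \sum_(p <- l) `|p.1| <= C /\
    forall f, phi f = \sum_(p <- l) p.1 * f p.2.

(** Finitely supported rows make such operators continuous for the pointwise
    topology; the uniform bound makes them act on c_0-sums. *)
Definition kop (S S' : Type) (L : (S -> R) -> S' -> R) :=
  exists C, forall s, frep C (fun f => L f s).

Lemma frep_eval S (s : S) : frep 1 (fun f => f s).
Proof. by exists [:: (1, s)]; split=> [|f]; rewrite big_seq1 ?normr1// mul1r. Qed.

Lemma frep0 S C : 0 <= C -> frep C (fun _ : S -> R => 0).
Proof. by exists [::]; split=> [|f]; rewrite big_nil. Qed.

Lemma frep_le S C C' (phi : (S -> R) -> R) : frep C phi -> C <= C' -> frep C' phi.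
Proof. by move=> [l [lC lE]] CC'; exists l; split=> //; exact: le_trans CC'. Qed.

Lemma frepD S C C' (phi psi : (S -> R) -> R) : frep C phi -> frep C' psi ->
  frep (C + C') (fun f => phi f + psi f).
Proof.
move=> [l [lC lE]] [l' [lC' lE']]; exists (l ++ l'); split=> [|f].
  by rewrite big_cat lerD.
by rewrite big_cat lE lE'.
Qed.

Lemma frepZ S C c (phi : (S -> R) -> R) : frep C phi ->
  frep (`|c| * C) (fun f => c * phi f).
Proof.
move=> [l [lC lE]]; exists [seq (c * p.1, p.2) | p <- l]; split=> [|f].
  rewrite big_map /=; under eq_bigr do rewrite normrM.
  by rewrite -mulr_sumr ler_wpM2l.
by rewrite big_map lE mulr_sumr; apply: eq_bigr => p _; rewrite mulrA.
Qed.

Lemma frepB S C C' (phi psi : (S -> R) -> R) : frep C phi -> frep C' psi ->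
  frep (C + C') (fun f => phi f - psi f).
Proof.
move=> H /(frepZ (-1)); rewrite normrN1 mul1r => /(frepD H).
by under eq_fun do rewrite mulN1r.
Qed.

Lemma frep_if S C (b : bool) (phi psi : (S -> R) -> R) : frep C phi ->
  frep C psi -> frep C (fun f => if b then phi f else psi f).
Proof. by case: b. Qed.

Lemma frep_ge0 S C (phi : (S -> R) -> R) : frep C phi -> 0 <= C.
Proof. by move=> [l [lC _]]; apply: le_trans lC; exact: sumr_ge0. Qed.

Lemma frep_bound S C (phi : (S -> R) -> R) f e : frep C phi -> 0 <= e ->
  (forall s, `|f s| <= e) -> `|phi f| <= C * e.
Proof.
move=> [l [lC lE]] e0 fe; rewrite lE; apply: le_trans (ler_norm_sum _ _ _) _.
apply: le_trans (_ : (\sum_(p <- l) `|p.1|) * e <= _); last by rewrite ler_wpM2r.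
by rewrite mulr_suml; apply: ler_sum => p _; rewrite normrM ler_wpM2l.
Qed.

Lemma frep_lin S C (phi : (S -> R) -> R) f g c : frep C phi ->
  phi (fun s => f s + c * g s) = phi f + c * phi g.
Proof.
move=> [l [_ lE]]; rewrite !lE mulr_sumr -big_split /=.
by apply: eq_bigr => p _; ring.
Qed.

Lemma frep_comp S S' C C' (L : (S -> R) -> S' -> R) (phi : (S' -> R) -> R) :
  (forall s, frep C (fun f => L f s)) -> frep C' phi -> 0 <= C ->
  frep (C * C') (fun f => phi (L f)).
Proof.
move=> HL [l [lC lE]] C0.
suff [l' [l'C l'E]] : frep (C * \sum_(p <- l) `|p.1|) (fun f => phi (L f)).
  by exists l'; split=> //; apply: le_trans l'C _; rewrite ler_wpM2l.
have {lC lE} -> : (fun f => phi (L f)) = (fun f => \sum_(p <- l) p.1 * L f p.2).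
  by apply/funext => f; rewrite lE.
elim: l => [|p l IH].
  rewrite big_nil mulr0 (_ : (fun f => _) = fun=> 0); first exact: frep0.
  by apply/funext => f; rewrite big_nil.
rewrite (_ : (fun f => _) =
    fun f => p.1 * L f p.2 + \sum_(p <- l) p.1 * L f p.2); last first.
  by apply/funext => f; rewrite big_cons.
apply: frep_le (frepD (frepZ p.1 (HL p.2)) IH) _.
by rewrite big_cons mulrDr (mulrC `|p.1|).
Qed.

Lemma kop_ge0 S S' (L : (S -> R) -> S' -> R) : kop L ->
  exists2 C, 0 < C & forall s, frep C (fun f => L f s).
Proof.
move=> [C HC]; exists (`|C| + 1) => [|s]; first by rewrite ltr_wpDl.
apply: frep_le (HC s) _; apply: le_trans (ler_norm _) _.
by rewrite lerDl.
Qed.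

Lemma kop_id S : kop (fun f : S -> R => f).
Proof. by exists 1 => s; exact: frep_eval. Qed.

Lemma kop_comp S S' S'' (L : (S -> R) -> S' -> R) (L' : (S' -> R) -> S'' -> R) :
  kop L -> kop L' -> kop (fun f => L' (L f)).
Proof.
move=> /kop_ge0[C C0 HC] [C' HC']; exists (C * C') => s.
exact: (frep_comp HC (HC' s) (ltW C0)).
Qed.

Lemma kopB S S' (L L' : (S -> R) -> S' -> R) :
  kop L -> kop L' -> kop (fun f s => L f s - L' f s).
Proof. by move=> [C HC] [C' HC']; exists (C + C') => s; exact: frepB. Qed.

Lemma kop_lin S S' (L : (S -> R) -> S' -> R) f g c : kop L ->
  L (fun s => f s + c * g s) = (fun s => L f s + c * L g s).
Proof.
by move=> [C HC]; apply/funext => s; exact: (frep_lin f g c (HC s)).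
Qed.

(** ** Isomorphisms and retracts *)

Definition mor S S' (A : set (S -> R)) (B : set (S' -> R)) L :=
  kop L /\ forall f, A f -> B (L f).

Definition iso S S' (A : set (S -> R)) (B : set (S' -> R)) :=
  exists L L', [/\ mor A B L, mor B A L', forall f, A f -> L' (L f) = f &
    forall g, B g -> L (L' g) = g].

Definition retr S S' (A : set (S -> R)) (B : set (S' -> R)) :=
  exists i r, [/\ mor A B i, mor B A r & forall f, A f -> r (i f) = f].

Definition subsp S (A : set (S -> R)) :=
  A (fun _ => 0) /\ forall f g c, A f -> A g -> A (fun s => f s + c * g s).

Definition prodS S S' (A : set (S -> R)) (B : set (S' -> R)) :
    set (S + S' -> R) :=
  [set f | A (fun s => f (inl s)) /\ B (fun s => f (inr s))].

(** The c_0-sum of the spaces [A i]. Smallness is expressed by finite sets so that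
    the index set need not be ordered. *)
Definition c0S (I : Type) S (A : I -> set (S -> R)) : set (I * S -> R) :=
  [set F | (forall i, A i (fun s => F (i, s))) /\
    forall e, 0 < e -> finite_set [set i | exists s, e <= `|F (i, s)|]].

Lemma mor_comp S1 S2 S3 (A : set (S1 -> R)) (B : set (S2 -> R)) (C : set (S3 -> R))
    L L' : mor A B L -> mor B C L' -> mor A C (fun f => L' (L f)).
Proof.
by move=> [kL AB] [kL' BC]; split=> [|f /AB/BC]; first exact: kop_comp.
Qed.

Section Category.
Context {S1 S2 S3 S4 : Type}.
Implicit Types (A : set (S1 -> R)) (B : set (S2 -> R)) (C : set (S3 -> R))
  (D : set (S4 -> R)).

Lemma iso_sym A B : iso A B -> iso B A.
Proof. by move=> [L [L' [? ? ? ?]]]; exists L', L; split. Qed.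

Lemma iso_trans A B C : iso A B -> iso B C -> iso A C.
Proof.
move=> [L [L' [m m' K K']]] [M [M' [n n' J J']]].
exists (fun f => M (L f)), (fun f => L' (M' f)); split.
- exact: (mor_comp m n).
- exact: (mor_comp n' m').
- by move=> f Af; rewrite J ?K//; exact: m.2.
- by move=> f Af; rewrite K' ?J'//; exact: n'.2.
Qed.

Lemma retr_trans A B C : retr A B -> retr B C -> retr A C.
Proof.
move=> [L [L' [m m' K]]] [M [M' [n n' J]]].
exists (fun f => M (L f)), (fun f => L' (M' f)); split.
- exact: (mor_comp m n).
- exact: (mor_comp n' m').
- by move=> f Af; rewrite J ?K//; exact: m.2.
Qed.

Lemma iso_retr A B : iso A B -> retr A B.
Proof. by move=> [L [L' [m m' K _]]]; exists L, L'; split. Qed.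

Definition prod_map (L : (S1 -> R) -> S2 -> R) (M : (S3 -> R) -> S4 -> R)
    (f : S1 + S3 -> R) (s : S2 + S4) : R :=
  match s with
  | inl s => L (fun x => f (inl x)) s
  | inr s => M (fun x => f (inr x)) s
  end.

Lemma kop_prod L M : kop L -> kop M -> kop (prod_map L M).
Proof.
move=> /kop_ge0[C C0 HC] /kop_ge0[C' C'0 HC']; exists (C + C') => -[s|s] /=.
  apply: frep_le (_ : C <= _); last by rewrite lerDl ltW.
  have [l [lC lE]] := HC s; exists [seq (p.1, inl p.2) | p <- l].
  by rewrite big_map; split=> // f; rewrite lE big_map.
apply: frep_le (_ : C' <= _); last by rewrite lerDr ltW.
have [l [lC lE]] := HC' s; exists [seq (p.1, inr p.2) | p <- l].
by rewrite big_map; split=> // f; rewrite lE big_map.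
Qed.

Lemma mor_prod A B C D L M : mor A B L -> mor C D M ->
  mor (prodS A C) (prodS B D) (prod_map L M).
Proof.
move=> [kL AB] [kM CD]; split; first exact: kop_prod.
by move=> f [/AB Bf /CD Df].
Qed.

End Category.

Lemma iso_refl S (A : set (S -> R)) : iso A A.
Proof. by exists id, id; split=> //; split=> //; exact: kop_id. Qed.

Lemma iso_prod S1 S2 S3 S4 (A : set (S1 -> R)) (B : set (S2 -> R))
    (C : set (S3 -> R)) (D : set (S4 -> R)) :
  iso A B -> iso C D -> iso (prodS A C) (prodS B D).
Proof.
move=> [L [L' [m m' K K']]] [M [M' [n n' J J']]].
exists (prod_map L M), (prod_map L' M'); split; try exact: mor_prod.
- move=> f [Af Cf]; apply/funext => -[s|s] /=.
    exact: (congr1 (@^~ s) (K _ Af)).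
  exact: (congr1 (@^~ s) (J _ Cf)).
- move=> f [Af Cf]; apply/funext => -[s|s] /=.
    exact: (congr1 (@^~ s) (K' _ Af)).
  exact: (congr1 (@^~ s) (J' _ Cf)).
Qed.

Lemma retr_prod S1 S2 S3 S4 (A : set (S1 -> R)) (B : set (S2 -> R))
    (C : set (S3 -> R)) (D : set (S4 -> R)) :
  retr A B -> retr C D -> retr (prodS A C) (prodS B D).
Proof.
move=> [L [L' [m m' K]]] [M [M' [n n' J]]].
exists (prod_map L M), (prod_map L' M'); split; try exact: mor_prod.
move=> f [Af Cf]; apply/funext => -[s|s] /=.
  exact: (congr1 (@^~ s) (K _ Af)).
exact: (congr1 (@^~ s) (J _ Cf)).
Qed.

Lemma kop_relabel S S' (h : S' -> S) : kop (fun f : S -> R => f \o h).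
Proof. by exists 1 => s; exact: frep_eval. Qed.

Lemma iso_relabel S S' (A : set (S -> R)) (B : set (S' -> R)) (h : S' -> S) h' :
  cancel h h' -> cancel h' h ->
  (forall f, A f -> B (f \o h)) -> (forall f, B f -> A (f \o h')) -> iso A B.
Proof.
move=> hK h'K AB BA; exists (fun f => f \o h), (fun f => f \o h'); split.
- by split=> //; exact: kop_relabel.
- by split=> //; exact: kop_relabel.
- by move=> f _; apply/funext => s /=; rewrite h'K.
- by move=> f _; apply/funext => s /=; rewrite hK.
Qed.

Lemma iso_prodC S S' (A : set (S -> R)) (B : set (S' -> R)) :
  iso (prodS A B) (prodS B A).
Proof.
pose sw X Y (s : X + Y) : Y + X := match s with inl x => inr x | inr y => inl y end.
by apply: (@iso_relabel _ _ _ _ (sw _ _) (sw _ _)) => [[]|[]|f []|f []].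
Qed.

Lemma iso_prodA S S' S'' (A : set (S -> R)) (B : set (S' -> R))
    (C : set (S'' -> R)) : iso (prodS (prodS A B) C) (prodS A (prodS B C)).
Proof.
pose h (s : S + (S' + S'')) : (S + S') + S'' :=
  match s with inl x => inl (inl x) | inr (inl x) => inl (inr x) | inr (inr x) => inr x end.
pose h' (s : (S + S') + S'') : S + (S' + S'') :=
  match s with inl (inl x) => inl x | inl (inr x) => inr (inl x) | inr x => inr (inr x) end.
apply: (@iso_relabel _ _ _ _ h h') => [[|[]]|[[]|]|f [[]]|f [? []]] //.
Qed.

Section C0.
Variable I : Type.

Definition c0_map S S' (L : I -> (S -> R) -> S' -> R) (F : I * S -> R) (p : I * S') :=
  L p.1 (fun s => F (p.1, s)) p.2.

Lemma mor_c0 S S' (A : I -> set (S -> R)) (B : I -> set (S' -> R)) L C :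
  (forall i s, frep C (fun f => L i f s)) -> (forall i f, A i f -> B i (L i f)) ->
  mor (c0S A) (c0S B) (c0_map L).
Proof.
move=> HC AB; split.
  exists C => -[i s]; have [l [lC lE]] := HC i s.
  exists [seq (p.1, (i, p.2)) | p <- l]; rewrite big_map; split=> // f.
  by rewrite /c0_map lE big_map.
move=> F [AF F0]; split=> [i|e e0]; first exact: (AB i _ (AF i)).
have [[p Cp]|noI] := pselect (exists p : I * S', 0 <= C); last first.
  apply: sub_finite_set (finite_set0 _) => i [s _]; apply: noI.
  by exists (i, s); exact: frep_ge0 (HC i s).
have C1 : 0 < C + 1 by rewrite ltr_wpDl.
apply: sub_finite_set (F0 (e / (C + 1)) _); last by rewrite divr_gt0.
move=> i [s es]; apply: contrapT => H.
have : `|c0_map L F (i, s)| <= C * (e / (C + 1)).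
  apply: (frep_bound (HC i s)); first by rewrite divr_ge0 ?ltW.
  move=> s'; rewrite leNgt; apply/negP => /ltW es'; apply: H.
  by exists s'.
apply/negP; rewrite -ltNge; apply: lt_le_trans es.
rewrite mulrCA gtr_pMr// ltr_pdivrMr// mul1r ltrDl//.
Qed.

Lemma iso_c0 S S' (A : set (S -> R)) (B : set (S' -> R)) :
  iso A B -> iso (c0S (fun _ : I => A)) (c0S (fun _ : I => B)).
Proof.
move=> [L [L' [[[C HC] m] [[C' HC'] m'] K K']]].
exists (c0_map (fun=> L)), (c0_map (fun=> L')); split.
- exact: (mor_c0 (fun=> HC)).
- exact: (mor_c0 (fun=> HC')).
- by move=> F [AF _]; apply/funext => -[i s]; exact: (congr1 (@^~ s) (K _ (AF i))).
- by move=> F [AF _]; apply/funext => -[i s]; exact: (congr1 (@^~ s) (K' _ (AF i))).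
Qed.

Lemma retr_c0 S S' (A : set (S -> R)) (B : set (S' -> R)) :
  retr A B -> retr (c0S (fun _ : I => A)) (c0S (fun _ : I => B)).
Proof.
move=> [L [L' [[[C HC] m] [[C' HC'] m'] K]]].
exists (c0_map (fun=> L)), (c0_map (fun=> L')); split.
- exact: (mor_c0 (fun=> HC)).
- exact: (mor_c0 (fun=> HC')).
- by move=> F [AF _]; apply/funext => -[i s]; exact: (congr1 (@^~ s) (K _ (AF i))).
Qed.

Lemma c0_prod S S' (A : set (S -> R)) (B : set (S' -> R)) :
  iso (c0S (fun _ : I => prodS A B)) (prodS (c0S (fun _ : I => A)) (c0S (fun _ : I => B))).
Proof.
pose h (p : I * S + I * S') : I * (S + S') :=
  match p with inl (i, s) => (i, inl s) | inr (i, s) => (i, inr s) end.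
pose h' (p : I * (S + S')) : I * S + I * S' :=
  match p with (i, inl s) => inl (i, s) | (i, inr s) => inr (i, s) end.
apply: (@iso_relabel _ _ _ _ h h') => [[[]|[]]|[i []]|F [AF F0]|F [[AF F0] [BF G0]]] //.
  split; split=> [i|e e0]; try exact: (AF i).1; try exact: (AF i).2.
    by apply: sub_finite_set (F0 e e0) => i [s es]; exists (inl s).
  by apply: sub_finite_set (F0 e e0) => i [s es]; exists (inr s).
split=> [i|e e0]; first by split; [exact: AF|exact: BF].
have : finite_set ([set i | exists s, e <= `|F (inl (i, s))|] `|`
    [set i | exists s, e <= `|F (inr (i, s))|]).
  by rewrite finite_setU; split; [exact: F0|exact: G0].
by apply: sub_finite_set => i [[s|s] es]; [left|right]; exists s.
Qed.

Lemma retr_c0_c0 J S (A : J -> set (S -> R)) :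
  retr (c0S (fun _ : I => c0S A)) (c0S (fun ij : I * J => A ij.2)).
Proof.
pose h (p : (I * J) * S) : I * (J * S) := (p.1.1, (p.1.2, p.2)).
pose h' (p : I * (J * S)) : (I * J) * S := ((p.1, p.2.1), p.2.2).
apply: iso_retr; apply: (@iso_relabel _ _ _ _ h h') => [[[]]|[i []]|F [AF F0]|F [AF F0]] //.
  split=> [[i j]|e e0]; first exact: (AF i).1.
  apply: sub_finite_set (_ : _ `<=` \bigcup_(i in
      [set i | exists s, e <= `|F (i, s)|])
    [set ij | ij.1 = i /\ exists s, e <= `|F (i, (ij.2, s))|]) _.
    move=> [i j] [s es] /=; exists i; last by split=> //; exists s.
    by exists (j, s).
  apply: bigcup_finite; first exact: F0.
  move=> i _; apply: sub_finite_set (finite_image (pair i) ((AF i).2 e e0)).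
  by move=> [i' j] /= [-> es]; exists j.
split=> [i|e e0].
  split=> [j|e e0]; first exact: (AF (i, j)).
  apply: sub_finite_set (finite_image snd (F0 e e0)) => j [s es].
  by exists (i, j) => //; exists s.
apply: sub_finite_set (finite_image fst (F0 e e0)) => i [[j s] es].
by exists (i, j) => //; exists s.
Qed.

(** Extension by zero is a section of the restriction along [h]. *)
Lemma retr_c0_reindex J S (A : I -> set (S -> R)) (B : J -> set (S -> R))
    (h : I -> J) : injective h -> (forall i, A i = B (h i)) ->
  (forall j, B j (fun _ => 0)) -> retr (c0S A) (c0S B).
Proof.
move=> hI AB B0.
pose k j : option I := if pselect (exists i, h i = j) is left e then Some (projT1 (cid e)) else None.
have kh i : k (h i) = Some i.
  by rewrite /k; case: pselect => [e|[]]; [case: cid => i' /= /hI ->|exists i].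
have hk j i : k j = Some i -> h i = j.
  by rewrite /k; case: pselect => [e|//]; case: cid => i' /= <- [->].
exists (fun F p => if k p.1 is Some i then F (i, p.2) else 0), (fun F p => F (h p.1, p.2)).
split.
- split=> [|F [AF F0]].
    by exists 1 => -[j s] /=; case: (k j) => [i|]; [exact: frep_eval|exact: frep0].
  split=> [j /=|e e0].
    case E: (k j) => [i|//]; rewrite -(hk _ _ E) -AB; exact: AF.
  apply: sub_finite_set (finite_image h (F0 e e0)) => j [s] /=.
  case E: (k j) => [i|]; last by rewrite normr0 leNgt e0.
  by move=> es; exists i; [exists s|exact: hk].
- split=> [|F [AF F0]].
    by exists 1 => p; exact: frep_eval.
  split=> [i /=|e e0]; first by rewrite AB; exact: AF.
  have hI' : {in h @^-1` [set j | exists s, e <= `|F (j, s)|] &, injective h}.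
    by move=> x y _ _; exact: hI.
  apply: sub_finite_set (finite_preimage hI' (F0 e e0)) => i [s es].
  by exists s.
- by move=> F _; apply/funext => -[i s] /=; rewrite kh.
Qed.

End C0.

Lemma c0_shift S (A : set (S -> R)) :
  iso (c0S (fun _ : nat => A)) (prodS A (c0S (fun _ : nat => A))).
Proof.
pose h (p : S + nat * S) : nat * S :=
  match p with inl s => (0%N, s) | inr (n, s) => (n.+1, s) end.
pose h' (p : nat * S) : S + nat * S :=
  match p with (0%N, s) => inl s | (n.+1, s) => inr (n, s) end.
apply: (@iso_relabel _ _ _ _ h h') => [[|[]]|[[]]|F [AF F0]|F [AF [BF F0]]] //.
  split=> /=; first exact: AF.
  split=> [n /=|e e0]; first exact: AF.
  have hI' : {in succn @^-1` [set j | exists s, e <= `|F (j, s)|] &, injective succn}.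
    by move=> x y _ _ [].
  apply: sub_finite_set (finite_preimage hI' (F0 e e0)) => i [s es].
  by exists s.
split=> [[|n] /=|e e0]; [exact: AF|exact: BF|].
have : finite_set ([set 0%N] `|` succn @` [set i | exists s, e <= `|F (inr (i, s))|]).
  by rewrite finite_setU; split; [exact: finite_set1|apply: finite_image; exact: F0].
by apply: sub_finite_set => -[|n] [s es]; [left|right; exists n => //; exists s].
Qed.

(** The complement is the kernel of the retraction. *)
Lemma retr_summand S S' (A : set (S -> R)) (B : set (S' -> R)) : subsp B ->
  retr A B -> exists W : set (S' -> R), iso B (prodS A W).
Proof.
move=> [B0 Blin] [i [r [[ki AB] [kr BA] K]]].
have r0 (g h : S' -> R) : B g -> B h -> r (fun s => g s - h s) = (fun s => r g s - r h s).
  move=> Bg Bh; have := kop_lin g h (-1) kr; under eq_fun do rewrite mulN1r.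
  by move=> ->; apply/funext => s; rewrite mulN1r.
exists [set g | B g /\ r g = fun=> 0].
exists (fun g s => match s with inl s => r g s | inr s => g s - i (r g) s end).
exists (fun g s => i (fun s => g (inl s)) s + g (inr s)); split.
- split.
    have [C C0 HC] := kop_ge0 kr.
    have [C' C'0 HC'] := kop_ge0 (kopB (kop_id _) (kop_comp kr ki)).
    exists (C + C') => -[s|s].
      by apply: frep_le (HC s) _; rewrite lerDl ltW.
    by apply: frep_le (HC' s) _; rewrite lerDr ltW.
  move=> g Bg; have Brg := BA _ Bg; have Birg := AB _ Brg; split=> //=; split=> /=.
    have := Blin _ _ (-1) Bg Birg.
    by under eq_fun do rewrite mulN1r.
  by rewrite r0// K//; apply/funext => s; rewrite subrr.
- split.
    have [C C0 HC] := kop_ge0 ki; exists (C + 1) => s; apply: frepD.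
      have [l [lC lE]] := HC s; exists [seq (p.1, inl p.2) | p <- l].
      by rewrite big_map; split=> // f; rewrite lE big_map.
    exact: frep_eval.
  move=> g [Ag [Bg rg]]; have := Blin _ _ 1 (AB _ Ag) Bg.
  by under eq_fun do rewrite mul1r.
- move=> g Bg; apply/funext => s /=.
  by rewrite -[X in X + _]/(i (r g) s) addrC subrK.
- move=> g [Ag [Bg rg]]; have E : r (fun s => i (fun s => g (inl s)) s + g (inr s)) =
      fun s => g (inl s).
    have := kop_lin (i (fun s => g (inl s))) (fun s => g (inr s)) 1 kr.
    under eq_fun do rewrite mul1r; move=> ->.
    by rewrite rg K//; apply/funext => s; rewrite mulr0 addr0.
  apply/funext => -[s|s]; rewrite E//.
  by rewrite addrC addKr.
Qed.

(** Pelczynski's decomposition method. Write B = A + V and A = B + U. Once B is known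
    to be isomorphic to c_0(B), it absorbs both B and A: B = c_0(A + V) =
    A + c_0(A + V) = A + B. Hence A = B + U = B + B + U = B + A = B. *)
Lemma pelczynski S S' (A : set (S -> R)) (B : set (S' -> R)) :
  subsp A -> subsp B -> retr A B -> retr B A ->
  retr (c0S (fun _ : nat => B)) B -> iso A B.
Proof.
move=> sA sB AB BA cBB.
have [V BV] := retr_summand sB AB; have [U AU] := retr_summand sA BA.
have [W BW] := retr_summand sB cBB.
(* c_0(B) = c_0(c_0(B) + W) absorbs W, and c_0(B) + W is B. *)
have cB : iso (c0S (fun _ : nat => B)) B.
  apply: iso_trans (iso_c0 nat BW) _; apply: iso_trans (c0_prod _ _ _) _.
  apply: iso_trans (iso_prod (iso_refl _) (c0_shift _)) _.
  apply: iso_trans (iso_prodC _ _) _; apply: iso_trans (iso_prodA _ _ _) _.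
  apply: iso_trans (iso_prod (iso_refl _) (iso_prodC _ _)) _.
  apply: iso_trans (iso_prod (iso_refl _) (iso_sym (c0_prod _ _ _))) _.
  apply: iso_trans (iso_prod (iso_refl _) (iso_sym (iso_c0 nat BW))) _.
  exact: iso_trans (iso_prodC _ _) (iso_sym BW).
have BB : iso (prodS B B) B.
  apply: iso_trans (iso_prod (iso_refl _) (iso_sym cB)) _.
  exact: iso_trans (iso_sym (c0_shift _)) cB.
have BA' : iso B (prodS A B).
  apply: iso_trans (iso_sym cB) _; apply: iso_trans (iso_c0 nat BV) _.
  apply: iso_trans (c0_prod _ _ _) _.
  apply: iso_trans (iso_prod (c0_shift _) (iso_refl _)) _.
  apply: iso_trans (iso_prodA _ _ _) _; apply: iso_prod; first exact: iso_refl.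
  apply: iso_trans (iso_sym (c0_prod _ _ _)) _.
  exact: iso_trans (iso_sym (iso_c0 nat BV)) cB.
apply: iso_trans (AU) _; apply: iso_trans (iso_prod (iso_sym BB) (iso_refl _)) _.
apply: iso_trans (iso_prodA _ _ _) _.
apply: iso_trans (iso_prod (iso_refl _) (iso_sym AU)) _.
exact: iso_trans (iso_prodC _ _) (iso_sym BA').
Qed.

End Operators.

(** * Continuous functions on ordinal intervals *)

Section Functions.
Variable R : realType.
Implicit Types (f g h : cord -> R) (a b x y z : cord).

(** Continuity for the order topology: no ordinal lies between x and x + 1, so the
    intervals (a, x] form a neighbourhood base of x. *)
Definition ccont_at f x := forall e, 0 < e ->
  exists2 a, a < x & forall z, a < z <= x -> `|f z - f x| < e.

(** The continuous functions on [1, a], extended by zero so that the spaces for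
    different a consist of functions on the same type. *)
Definition Cspace a : set (cord -> R) :=
  [set f | (forall x, cord0 < x <= a -> ccont_at f x) /\
           forall x, ~~ (cord0 < x <= a) -> f x = 0].

Definition Cspace0 a : set (cord -> R) := [set f | Cspace a f /\ f a = 0].

Lemma ccont_at_cst x c : cord0 < x -> ccont_at (fun=> c) x.
Proof.
by move=> x0 e e0; exists cord0 => // z _; rewrite subrr normr0.
Qed.

Lemma ccont_at_lin f g c x :
  ccont_at f x -> ccont_at g x -> ccont_at (fun z => f z + c * g z) x.
Proof.
move=> cf cg e e0.
have c1 : 0 < `|c| + 1 by rewrite ltr_wpDl.
have [a ax Ha] := cf _ (divr_gt0 e0 (ltr0Sn _ 1)).
have [b bx Hb] := cg (e / 2 / (`|c| + 1)) ltac:(by rewrite !divr_gt0).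
exists (Order.max a b) => [|z]; first by rewrite gt_max ax.
rewrite gt_max -andbA => /and3P[az bz zx].
have {}Ha := Ha z; have {}Hb := Hb z; rewrite az bz zx in Ha Hb.
rewrite (_ : _ - _ = (f z - f x) + c * (g z - g x)); last by ring.
apply: le_lt_trans (ler_normD _ _) _.
rewrite -[e in _ < e](@divfK _ 2)// mulr_natr mulr2n.
apply: ltr_leD; first exact: Ha.
rewrite normrM; apply: le_trans (_ : (`|c| + 1) * (e / 2 / (`|c| + 1)) <= _).
  by apply: ler_pM => //; [rewrite lerDl|apply: ltW; exact: Hb].
by rewrite mulrC divfK// gt_eqF.
Qed.

Lemma ccont_at_local f g x a : a < x ->
  (forall z, a < z <= x -> f z = g z) -> ccont_at g x -> ccont_at f x.
Proof.
move=> ax fg cg e e0; have [b bx H] := cg e e0.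
exists (Order.max a b) => [|z]; first by rewrite gt_max ax.
rewrite gt_max -andbA => /and3P[az bz zx].
by rewrite !fg ?az ?ax ?lexx//; apply: H; rewrite bz.
Qed.

Lemma ccont_atB f g x :
  ccont_at f x -> ccont_at g x -> ccont_at (fun z => f z - g z) x.
Proof.
move=> cf cg; have := ccont_at_lin (-1) cf cg.
by under eq_fun do rewrite mulN1r.
Qed.

Lemma ccont_atD f g x :
  ccont_at f x -> ccont_at g x -> ccont_at (fun z => f z + g z) x.
Proof.
move=> cf cg; have := ccont_at_lin 1 cf cg.
by under eq_fun do rewrite mul1r.
Qed.

Lemma ccont_at_succ f x : ccont_at f (csucc x).
Proof.
move=> e e0; exists x; first exact: lt_csucc.
move=> z; rewrite -csucc_leP => /le_anti ->; by rewrite subrr normr0.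
Qed.

Lemma normal_nbhs F x b : normal F -> cord0 < x -> b < F x ->
  exists2 a, a < x & forall z, a < z <= x -> b < F z <= F x.
Proof.
move=> nF x0 bF; have [x00|[y xy]|xl] := cord_case x.
- by rewrite x00 ltxx in x0.
- exists y; first by rewrite xy lt_csucc.
  move=> z; rewrite -csucc_leP -xy => /le_anti <-; by rewrite bF lexx.
- have [y yx by_] := nF.2 _ xl _ bF; exists y => // z /andP[yz zx].
  by rewrite (lt_trans by_) ?(normal_le nF)//; exact: nF.1.
Qed.

Lemma ccont_at_normal F f x : normal F -> cord0 < x ->
  ccont_at f (F x) -> ccont_at (f \o F) x.
Proof.
move=> nF x0 cf e e0; have [b bx H] := cf e e0.
have [a ax Ha] := normal_nbhs nF x0 bx.
by exists a => // z /Ha; exact: H.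
Qed.

Lemma ccont_at_shift a y g h : cord0 < y ->
  (forall z, cord0 < z <= y -> h (cadd a z) = g z) ->
  ccont_at g y -> ccont_at h (cadd a y).
Proof.
move=> y0 hg cg e e0; have [b bx H] := cg e e0.
exists (cadd a b) => [|z /andP[az]]; first by rewrite cadd_ltr.
have [u zu] : exists u, z = cadd a u.
  by apply: cadd_subK; apply: le_trans (ltW az); exact: le_caddl.
move: az; rewrite zu cadd_ltr cadd_ler => bu uy.
rewrite !hg ?lexx ?y0 ?uy ?(le_lt_trans (cord_le0x b))//.
by apply: H; rewrite bu.
Qed.

Lemma subsp_Cspace a : subsp (Cspace a).
Proof.
split=> [|f g c [cf f0] [cg g0]].
  by split=> // x /andP[x0 _]; exact: ccont_at_cst.
split=> x xa; first by apply: ccont_at_lin; [exact: cf|exact: cg].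
by rewrite f0// g0// mulr0 addr0.
Qed.

Lemma Cspace_cont a f x : Cspace a f -> cord0 < x -> ccont_at f x.
Proof.
move=> [cf f0] x0; have [xa|ax] := leP x a; first by apply: cf; rewrite x0.
apply: (@ccont_at_local _ (fun=> 0) _ a) => //; last exact: ccont_at_cst.
by move=> z /andP[az _]; rewrite f0// negb_and -ltNge az orbT.
Qed.

(** Compactness of [1, a] enters as an induction on the end point. *)
Lemma Cspace_bounded a f : Cspace a f -> exists2 C, 0 <= C & forall x, `|f x| <= C.
Proof.
move=> Ef; suff H y : exists2 C, 0 <= C & forall x, cord0 < x <= y -> `|f x| <= C.
  have [C C0 HC] := H a; exists C => // x; have [/HC//|xa] := boolP (cord0 < x <= a).
  by rewrite Ef.2// normr0.
elim/cord_ind: y => y IH; have [->|] := eqVneq y cord0.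
  by exists 0 => // x /andP[x0]; rewrite leNgt x0.
rewrite -cord_gt0 => y0; have [b by_ Hb] := Cspace_cont Ef y0 ltr01.
have [C C0 HC] := IH _ by_; exists (C + (`|f y| + 1)) => [|x /andP[x0 xy]].
  by rewrite addr_ge0 ?addr_ge0.
have [xb|bx] := leP x b.
  by apply: le_trans (HC _ _) _; rewrite ?x0// lerDl addr_ge0.
have /ltW := Hb x ltac:(by rewrite bx); move=> H.
apply: le_trans (_ : `|f y| + 1 <= _); last by rewrite lerDr.
rewrite -[f x](subrK (f y)) addrC; apply: le_trans (ler_normD _ _) _.
by rewrite lerD2l.
Qed.

Definition restr a f x := if cord0 < x <= a then f x else 0.

Lemma kop_restr a : kop (restr a).
Proof.
by exists 1 => x; apply: frep_if; [exact: frep_eval|exact: frep0].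
Qed.

Lemma Cspace_restr a f : (forall x, cord0 < x <= a -> ccont_at f x) -> Cspace a (restr a f).
Proof.
move=> cf; split=> x xa; last by rewrite /restr (negbTE xa).
have /andP[x0 xa'] := xa.
apply: (@ccont_at_local _ f _ cord0) => // [z /andP[z0 zx]|]; last exact: cf.
by rewrite /restr z0 (le_trans zx).
Qed.

Lemma restr_id a f : Cspace a f -> restr a f = f.
Proof.
by move=> [_ f0]; apply/funext => x; rewrite /restr; case: ifPn => // /f0.
Qed.

Lemma Cspace_le a b : a <= b -> Cspace a `<=` Cspace b.
Proof.
move=> ab f Ef; split=> x xb; first by have /andP[x0 _] := xb; exact: Cspace_cont Ef x0.
by apply: Ef.2; apply: contra xb => /andP[-> /le_trans->].
Qed.

Lemma retr_Cspace a b : a <= b -> retr (Cspace a) (Cspace b).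
Proof.
move=> ab; exists id, (restr a); split.
- by split; [exact: kop_id|exact: Cspace_le].
- split=> [|f Ef]; first exact: kop_restr.
  by apply: Cspace_restr => x /andP[x0 _]; exact: Cspace_cont Ef x0.
- by move=> f Ef; exact: restr_id.
Qed.

Definition csub a x : cord :=
  if pselect (exists z, x = cadd a z) is left e then projT1 (cid e) else cord0.

Lemma caddKl a x : csub a (cadd a x) = x.
Proof.
by rewrite /csub; case: pselect => [e|[]]; [case: cid => z /= /caddI|exists x].
Qed.

(** ** Functions vanishing at the end point *)

Lemma retr_vanishing_Cspace a : retr (Cspace0 a) (Cspace a).
Proof.
exists id, (fun f x => restr a f x - restr a (fun=> f a) x); split.
- by split=> [|f []//]; exact: kop_id.
- split=> [|f Ef].
    by exists (1 + 1) => x; apply: frepB; apply: frep_if;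
      by [exact: frep_eval|exact: frep0].
  split; last first.
    by rewrite /restr; case: ifP => _; rewrite subrr.
  have E1 : Cspace a (restr a (fun=> f a)).
    by apply: Cspace_restr => x /andP[x0 _]; exact: ccont_at_cst.
  rewrite restr_id//; have := (subsp_Cspace a).2 _ _ (-1) Ef E1.
  by under eq_fun do rewrite mulN1r.
- move=> f [Ef fa]; rewrite restr_id//; apply/funext => x.
  by rewrite fa /restr if_same subr0.
Qed.

(** The value at the end point is moved to the front; there is room for it since
    1 + a = a. *)
Lemma retr_Cspace_vanishing a : indec a -> retr (Cspace a) (Cspace0 a).
Proof.
move=> ia; have a0 := climit_gt0 ia.1; have a1 : cord1 < a by exact: climit_lt ia.1 a0.
have A1 : cadd cord1 a = a by exact: ia.2.
pose i f x := if cord0 < x <= a then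
  if x == cord1 then f a else f (csub cord1 x) - f a else 0.
pose r f z := restr a (fun z => f (cadd cord1 z)) z + restr a (fun=> f cord1) z.
have iE f z : cord0 < z <= a -> i f (cadd cord1 z) = f z - f a.
  move=> /andP[z0 za]; rewrite /i (lt_le_trans z0 (le_caddr _ _)) /=.
  rewrite -[X in _ <= X]A1 cadd_ler za caddKl gt_eqF//.
  by rewrite -[X in X < _]caddx0 cadd_ltr.
exists i, r; split.
- split=> [|f Ef].
    exists (1 + 1) => x; apply: frep_if; last by exact: frep0.
    apply: frep_if; last by apply: frepB; exact: frep_eval.
    by apply: frep_le (frep_eval _ _) _; rewrite lerDl.
  split; last by rewrite -[X in i _ X]A1 iE ?a0 ?lexx// subrr.
  split=> x xa; last by rewrite /i (negbTE xa).
  have /andP[x0 xa'] := xa.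
  have [z xz] : exists z, x = cadd cord1 z by apply: cadd_subK; rewrite csucc_leP.
  have [z0|] := eqVneq z cord0.
    by rewrite xz z0 caddx0; exact: ccont_at_succ.
  rewrite -cord_gt0 => z0; have za : z <= a.
    by rewrite -(cadd_ler cord1) A1 -xz.
  rewrite xz; apply: (ccont_at_shift (g := fun z => f z - f a)) => //.
    by move=> u /andP[u0 uz]; apply: iE; rewrite u0 (le_trans uz).
  by apply: ccont_atB; [exact: Cspace_cont Ef z0|exact: ccont_at_cst].
- split=> [|f [Ef fa]].
    by exists (1 + 1) => x; apply: frepD; apply: frep_if;
      by [exact: frep_eval|exact: frep0].
  have E1 : Cspace a (restr a (fun=> f cord1)).
    by apply: Cspace_restr => x /andP[x0 _]; exact: ccont_at_cst.
  have E2 : Cspace a (restr a (fun z => f (cadd cord1 z))).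
    apply: Cspace_restr => x /andP[x0 _].
    apply: (ccont_at_normal (normal_add _) x0); apply: Cspace_cont Ef _.
    exact: lt_le_trans x0 (le_caddr _ _).
  have := (subsp_Cspace a).2 _ _ 1 E2 E1.
  by under eq_fun do rewrite mul1r.
- move=> f Ef; apply/funext => x; rewrite /r /restr; case: ifPn => xa.
    by rewrite iE// /i csucc_gt0 ltW// eqxx subrK.
  by rewrite Ef.2// addr0.
Qed.

(** ** Cutting an interval into countably many pieces *)

Lemma finite_set_bounded (A : set cord) x : cord0 < x -> finite_set A ->
  (forall y, A y -> y < x) -> exists2 a, a < x & forall y, A y -> y <= a.
Proof.
move=> x0 /finite_seqP[s ->]; elim: s => [|z s IH] H; first by exists cord0.
have [|a ax Ha] := IH; first by move=> y ys; apply: H; rewrite /= inE orbC ys.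
exists (Order.max a z) => [|y /=].
  by rewrite gt_max ax H//= inE eqxx.
by rewrite inE le_max => /orP[/eqP ->|/Ha ->//]; rewrite lexx orbT.
Qed.

Lemma finite_set_nat_bounded (A : set nat) : finite_set A ->
  exists N, forall n, A n -> (n < N)%N.
Proof.
move=> /finite_seqP[s ->]; exists (\max_(n <- s) n).+1 => n /= ns.
by rewrite ltnS (big_rem n)//= leq_maxl.
Qed.

Definition psum (b : nat -> cord) n : cord := iteri n (fun k z => cadd z (b k)) cord0.

Section Pack.
Variables (b : nat -> cord) (t : cord).
Hypotheses (bt : forall n, psum b n < t)
  (tb : forall a, a < t -> exists n, a < psum b n).

Lemma psumS n : psum b n.+1 = cadd (psum b n) (b n). Proof. by []. Qed.

Lemma psum_le m n : (m <= n)%N -> psum b m <= psum b n.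
Proof.
move=> /subnK <-; elim: (n - m)%N => [//|k IH].
by rewrite addSn psumS; apply: le_trans IH (le_caddl _ _).
Qed.

Lemma psum_lt_inv m n : psum b m < psum b n -> (m < n)%N.
Proof. by move=> mn; rewrite ltnNge; apply/negP => /psum_le; rewrite leNgt mn. Qed.

Lemma psum_div x : cord0 < x -> x < t -> exists n y, cord0 < y <= b n /\
  x = cadd (psum b n) y.
Proof.
move=> x0 /tb[n /ltW]; elim: n => [|n IH]; first by rewrite leNgt x0.
rewrite psumS => xn; have [/IH//|nx] := leP x (psum b n).
have [y xy] := cadd_subK (ltW nx); exists n, y; split=> //.
by move: nx xn; rewrite xy lt_caddl cadd_ler => -> ->.
Qed.

Lemma psum_div_uniq m n y z : cord0 < y <= b m -> cord0 < z <= b n ->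
  cadd (psum b m) y = cadd (psum b n) z -> m = n /\ y = z.
Proof.
have H k l u v : cord0 < u <= b k -> cord0 < v <= b l ->
    cadd (psum b k) u = cadd (psum b l) v -> (k <= l)%N.
  move=> /andP[u0 uk] /andP[v0 vl] uv.
  rewrite -ltnS; apply: psum_lt_inv; apply: lt_le_trans (_ : cadd (psum b k) u <= _).
    by rewrite lt_caddl.
  by rewrite uv psumS cadd_ler.
move=> Hy Hz yz; have mn : m = n.
  by apply/eqP; rewrite eqn_leq (H _ _ _ _ Hy Hz yz) (H _ _ _ _ Hz Hy).
by split=> //; move: yz; rewrite mn => /caddI.
Qed.

Definition pidx x : nat * cord := xget (0%N, cord0)
  [set p | cord0 < p.2 <= b p.1 /\ x = cadd (psum b p.1) p.2].

Lemma pidxE n y : cord0 < y <= b n -> pidx (cadd (psum b n) y) = (n, y).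
Proof.
move=> yn; rewrite /pidx; case: xgetP => [[m z] _ /= [zm]|/(_ (n, y))[]//].
by move=> /(psum_div_uniq yn zm)[-> ->].
Qed.

(** A function vanishing at t is small near t, so its restrictions to consecutive
    pieces of lengths [b n] form a sequence that tends uniformly to 0. *)
Lemma iso_pack : iso (Cspace0 t) (c0S (fun n => Cspace (b n))).
Proof.
have t0 : cord0 < t by exact: (bt 0).
pose L f (p : nat * cord) := restr (b p.1) (fun y => f (cadd (psum b p.1) y)) p.2.
pose L' (F : nat * cord -> R) x := if cord0 < x < t then F (pidx x) else 0.
have Lt n y : cord0 < y <= b n -> cord0 < cadd (psum b n) y < t.
  move=> /andP[y0 yb]; rewrite (lt_le_trans y0 (le_caddr _ _)) /=.
  by apply: le_lt_trans (bt n.+1); rewrite psumS cadd_ler.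
have L'E F n y : cord0 < y <= b n -> L' F (cadd (psum b n) y) = F (n, y).
  by move=> yn; rewrite /L' Lt// pidxE.
exists L, L'; split.
- split=> [|f [Ef ft]].
    by exists 1 => -[n y]; apply: frep_if; [exact: frep_eval|exact: frep0].
  split=> [n|e e0].
    apply: Cspace_restr => x /andP[x0 _].
    apply: (ccont_at_normal (normal_add _) x0); apply: Cspace_cont Ef _.
    exact: lt_le_trans x0 (le_caddr _ _).
  have [a /tb[N aN] Ha] := Cspace_cont Ef t0 e0.
  apply: sub_finite_set (finite_II N) => n [y]; rewrite /L /restr /=.
  case: ifPn => [yn|_]; last by rewrite normr0 leNgt e0.
  rewrite -[f _]subr0 -ft leNgt => /negP H; rewrite ltnNge; apply/negP => Nn.
  apply: H; apply: Ha; have /andP[_ /ltW ->] := Lt _ _ yn; rewrite andbT.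
  apply: lt_le_trans aN _; apply: le_trans (psum_le Nn) _; exact: le_caddl.
- split=> [|F [AF F0]].
    by exists 1 => x; apply: frep_if; [exact: frep_eval|exact: frep0].
  split; last by rewrite /L' ltxx andbF.
  split=> x xt; last first.
    rewrite /L'; case: ifP => // /andP[x0 /ltW xt'].
    by move: xt; rewrite x0 xt'.
  have /andP[x0] := xt; rewrite le_eqVlt => /orP[/eqP ->|xt'].
    move=> e e0; have [N HN] := finite_set_nat_bounded (F0 e e0).
    exists (psum b N) => // z /andP[Nz]; rewrite le_eqVlt => /orP[/eqP ->|zt].
      by rewrite subrr normr0.
    rewrite [X in _ - X](_ : _ = 0) ?subr0; last by rewrite /L' ltxx andbF.
    have [n [y [yn zE]]] := psum_div (le_lt_trans (cord_le0x _) Nz) zt.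
    rewrite zE L'E// ltNge; apply/negP => eF.
    have /HN nN : exists s, e <= `|F (n, s)| by exists y.
    have : psum b N < psum b n.+1.
      by apply: lt_le_trans Nz _; rewrite zE psumS cadd_ler; case/andP: yn.
    by move/psum_lt_inv; rewrite ltnS leqNgt nN.
  have [n [y [yn xE]]] := psum_div x0 xt'; have /andP[y0 yb] := yn.
  rewrite xE; apply: (ccont_at_shift (g := fun y => F (n, y))) => //.
    by move=> z /andP[z0 zy]; apply: L'E; rewrite z0 (le_trans zy).
  exact: Cspace_cont (AF n) y0.
- move=> f [Ef ft]; apply/funext => x; rewrite /L'; case: ifPn => [/andP[x0 xt]|xt].
    have [n [y [yn xE]]] := psum_div x0 xt.
    by rewrite xE pidxE// /L /restr yn.
  have [->//|xt'] := eqVneq x t; rewrite Ef.2//.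
  by apply: contra xt => /andP[-> xt]; rewrite lt_neqAle xt'.
- move=> F [AF F0]; apply/funext => -[n y]; rewrite /L /restr /=.
  case: ifPn => [yn|yn]; first by rewrite L'E.
  by rewrite (AF n).2.
Qed.

End Pack.

(** Finite sums of ordinals below t stay below t, so nothing but cofinality restricts
    the sequence of lengths; in particular lengths can be repeated. *)
Lemma indec_pack t (b : nat -> cord) : indec t -> (forall n, b n < t) ->
  (forall a, a < t -> exists n, a < b n) -> iso (Cspace0 t) (c0S (fun n => Cspace (b n))).
Proof.
move=> it bt tb; apply: (iso_pack (t := t)) => [n|a /tb[n an]].
- elim: n => [|n IH]; first exact: climit_gt0 it.1.
  by rewrite psumS; apply: indecD.
- by exists n.+1; rewrite psumS; apply: lt_le_trans an (le_caddr _ _).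
Qed.

Lemma climit_cofinal t : climit t -> exists b : nat -> cord,
  (forall n, b n < t) /\ forall a, a < t -> exists n, a < b n.
Proof.
move=> tl; have := cord_countable_initial t.
move=> /(pfcard_geP)[A0|[f]].
  have : [set y | y < t] cord0 by exact: climit_gt0.
  by rewrite A0.
exists (fun n => csucc (f n)); split=> [n|a at_].
  by apply: climit_lt => //; exact: (@funS _ _ _ _ f).
have [n _ <-] : exists2 n, setT n & f n = a by exact: (@surj _ _ _ _ f).
by exists n; exact: lt_csucc.
Qed.

(** C([1, t]) is a summand of a c_0-sum of spaces C([1, b n]). The c_0-sum of
    countably many copies of the latter has the same form, with every length
    repeated infinitely often, and by [indec_pack] it fits into C([1, t]) again. *)
Lemma retr_c0_Cspace t : indec t -> retr (c0S (fun _ : nat => Cspace t)) (Cspace t).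
Proof.
move=> it; have [b [bt tb]] := climit_cofinal it.1.
have pieces := retr_trans (retr_Cspace_vanishing it) (iso_retr (indec_pack it bt tb)).
apply: retr_trans (retr_c0 nat pieces) _.
apply: retr_trans (retr_c0_c0 _ _) _.
pose c m := if unpickle m is Some p then b (p : nat * nat).2 else b 0.
have cE : iso (Cspace0 t) (c0S (fun n => Cspace (c n))).
  apply: indec_pack => // [n|a /tb[n an]].
    by rewrite /c; case: unpickle.
  by exists (pickle (0%N, n)); rewrite /c pickleK.
apply: retr_trans (retr_trans (iso_retr (iso_sym cE)) (retr_vanishing_Cspace _)).
apply: (@retr_c0_reindex _ _ _ _ _ _ pickle (pcan_inj pickleK)) => [p|n].
- by rewrite /c pickleK.
- exact: (subsp_Cspace _).1.
Qed.

End Functions.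

(** ** Functions on the interval up to a product *)

Section Products.
Variable R : realType.
Implicit Types (f g h : cord -> R) (a b x y z : cord).

Section Product.
Variables (l m : cord).
Hypothesis l0 : cord0 < l.

Let nl := normal_mul l0.

Definition block : Type := {y : cord | y < m}.

(** By induction on y: near a limit multiple l y the function is close to its value
    there, so that only the blocks below some l u with u < y matter. *)
Lemma finite_blocks f e y : Cspace (cmul l m) f -> 0 < e -> y <= m ->
  finite_set [set i | i < y /\ exists r, cord0 < r <= l /\
    e <= `|f (cadd (cmul l i) r) - f (cadd (cmul l i) l)|].
Proof.
move=> Ef e0; elim/cord_ind3: y => [_|y IH ym|y yl IH ym].
- apply: sub_finite_set (finite_set0 _) => i [].
  by rewrite ltNge cord_le0x.
- have /IH F : y <= m by apply: le_trans ym; exact: ltW (lt_csucc _).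
  apply: (@sub_finite_set _ _ ([set y] `|` [set i | i < y /\ exists r, cord0 < r <= l /\
    e <= `|f (cadd (cmul l i) r) - f (cadd (cmul l i) l)|])).
    move=> i [iy H]; move: iy; rewrite lt_csuccE le_eqVlt => /orP[/eqP ->|iy].
      by left.
    by right.
  by rewrite finite_setU; split => //; exact: finite_set1.
- have ly0 : cord0 < cmul l y by apply: cmul_gt0 => //; exact: climit_gt0.
  have [a al Ha] := Cspace_cont Ef ly0 (divr_gt0 e0 (ltr0Sn _ 1)).
  have [u uy au] := nl.2 _ yl _ al.
  have /(IH _ uy) F : u <= m by apply: le_trans ym; exact: ltW.
  apply: sub_finite_set F => i [iy [r [/andP[r0 rl] er]]].
  split; last by exists r; rewrite r0.
  rewrite ltNge; apply/negP => ui; move: er; rewrite leNgt => /negP; apply.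
  have H v : cord0 < v <= l -> `|f (cadd (cmul l i) v) - f (cmul l y)| < e / 2.
    move=> /andP[v0 vl]; apply: Ha; apply/andP; split.
      apply: lt_le_trans au _; apply: le_trans (cmul_le l0 ui) _; exact: le_caddl.
    apply: le_trans (_ : cmul l (csucc i) <= _).
      by rewrite cmulxS cadd_ler.
    by apply: cmul_le => //; rewrite csucc_leP.
  rewrite -(subrKA (f (cmul l y))) [e]splitr; apply: le_lt_trans (ler_normD _ _) _.
  apply: ltrD; first by apply: H; rewrite r0.
  by rewrite distrC; apply: H; rewrite l0 lexx.
Qed.

Definition mul_lim x := exists2 y, climit y & x = cmul l y.

Definition mdiv x : cord * cord := xget (cord0, cord0)
  [set p | cord0 < p.2 <= l /\ x = cadd (cmul l p.1) p.2].

Lemma mdivE y r : cord0 < r <= l -> mdiv (cadd (cmul l y) r) = (y, r).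
Proof.
move=> rl; rewrite /mdiv; case: xgetP => [[z u] _ /= [ul]|/(_ (y, r))[]//].
by move=> /(cmul_div_uniq l0 rl ul)[-> ->].
Qed.

Definition mdiv_lim x : cord := xget cord0 [set y | x = cmul l y].

Lemma mdiv_limE y : mdiv_lim (cmul l y) = y.
Proof.
rewrite /mdiv_lim; case: xgetP => [z _ /= |/(_ y)[]//].
by move/(normal_inj nl).
Qed.

(** A function on (0, l m] is glued from its values at the multiples of l
    and, on each block (l y, l (y + 1)], its deviation from its value at the end
    of the block. *)
Definition unglue f (p : cord + block * cord) : R :=
  match p with
  | inl y => restr m (fun y => f (cmul l y)) y
  | inr (i, r) => restr l (fun r => f (cadd (cmul l (val i)) r)) r -
      restr l (fun=> f (cadd (cmul l (val i)) l)) r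
  end.

Definition glue (G : cord + block * cord -> R) x : R :=
  if `[< mul_lim x >] then G (inl (mdiv_lim x)) else
  if insub (mdiv x).1 is Some i then G (inr (i, (mdiv x).2)) + G (inl (csucc (val i)))
  else 0.

Lemma glue_lim G y : climit y -> glue G (cmul l y) = G (inl y).
Proof. by move=> yl; rewrite /glue asboolT ?mdiv_limE//; exists y. Qed.

Lemma glue_block G (i : block) r : cord0 < r <= l ->
  glue G (cadd (cmul l (val i)) r) = G (inr (i, r)) + G (inl (csucc (val i))).
Proof.
move=> rl; rewrite /glue asboolF; last first.
  by move=> [y yl /esym]; exact: cmul_lim_neq.
by rewrite mdivE //= valK.
Qed.

Lemma kop_unglue : kop unglue.
Proof.
exists (1 + 1) => -[y|[i r]] /=.
  apply: frep_le (_ : 1 <= _); last by rewrite lerDl.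
  by apply: frep_if; [exact: frep_eval|exact: frep0].
by apply: frepB; apply: frep_if; by [exact: frep_eval|exact: frep0].
Qed.

Lemma kop_glue : kop glue.
Proof.
exists (1 + 1) => x; apply: frep_if.
  by apply: frep_le (frep_eval _ _) _; rewrite lerDl.
by case: insub => [i|]; [apply: frepD; exact: frep_eval|exact: frep0].
Qed.

Lemma block_inv x : cord0 < x -> x <= cmul l m ->
  (exists y, [/\ climit y, y <= m & x = cmul l y]) \/
  exists (i : block) r, cord0 < r <= l /\ x = cadd (cmul l (val i)) r.
Proof.
move=> x0 xm; have [[y yl xE]|[y [r [rl xE]]]] := cmul_div l0 x0.
  by left; exists y; split=> //; move: xm; rewrite xE (normal_le nl).
have ym : y < m.
  rewrite -(normal_lt nl); apply: lt_le_trans xm.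
  by rewrite xE lt_caddl; case/andP: rl.
by right; exists (exist _ y ym), r.
Qed.

Lemma mor_unglue :
  mor (Cspace (cmul l m)) (prodS (Cspace m) (c0S (fun _ : block => Cspace l))) unglue.
Proof.
split=> [|f Ef]; first exact: kop_unglue.
split=> /=.
  apply: Cspace_restr => x /andP[x0 _]; apply: (ccont_at_normal nl x0).
  by apply: Cspace_cont Ef _; exact: cmul_gt0.
split=> [i /=|e e0].
  have E1 : Cspace l (restr l (fun=> f (cadd (cmul l (val i)) l))).
    by apply: Cspace_restr => x /andP[x0 _]; exact: ccont_at_cst.
  have E2 : Cspace l (restr l (fun r => f (cadd (cmul l (val i)) r))).
    apply: Cspace_restr => x /andP[x0 _].
    apply: (ccont_at_normal (normal_add _) x0); apply: Cspace_cont Ef _.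
    exact: lt_le_trans x0 (le_caddr _ _).
  have := (subsp_Cspace _ l).2 _ _ (-1) E2 E1.
  by under eq_fun do rewrite mulN1r.
have F := finite_blocks Ef e0 (lexx m).
have valI : {in val @^-1` [set i | i < m /\ exists r, cord0 < r <= l /\
    e <= `|f (cadd (cmul l i) r) - f (cadd (cmul l i) l)|] &,
    injective (val : block -> cord)}.
  by move=> i j _ _; exact: val_inj.
apply: sub_finite_set (finite_preimage valI F) => i [r] /=.
rewrite /restr; case: ifPn => [rl er|_].
  by split; [exact: (valP i)|exists r].
by rewrite subrr normr0 leNgt e0.
Qed.

Lemma glue_cont G x : Cspace m (fun y => G (inl y)) ->
  c0S (fun _ : block => Cspace l) (fun p => G (inr p)) ->
  cord0 < x -> x <= cmul l m -> ccont_at (glue G) x.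
Proof.
move=> EG [AG G0] x0 xm; have [|] := block_inv x0 xm; last first.
  move=> [i [r [/andP[r0 rl] xE]]]; rewrite xE.
  apply: (ccont_at_shift (g := fun r => G (inr (i, r)) + G (inl (csucc (val i))))) => //.
    by move=> u /andP[u0 ur]; apply: glue_block; rewrite u0 (le_trans ur).
  by apply: ccont_atD; [exact: Cspace_cont (AG i) r0|exact: ccont_at_cst].
move=> [y [yl ym xE]] e e0; have e2 : 0 < e / 2 by exact: divr_gt0.
have y0 := climit_gt0 yl.
have [a ay Ha] := Cspace_cont EG y0 e2.
(* Past the finitely many blocks with a large component the values at the
   block ends dominate. *)
have F := finite_image (val : block -> cord) (G0 _ e2).
have [b by_ Hb] : exists2 b, b < y & forall i : block, val i < y ->
    (exists r, e / 2 <= `|G (inr (i, r))|) -> val i <= b.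
  have [|z [_ zy]//|b by_ Hb] := @finite_set_bounded
    ((val @` [set i : block | exists s, e / 2 <= `|G (inr (i, s))|]) `&` [set z | z < y]) y y0.
    by apply: sub_finite_set F => z [].
  by exists b => // i iy Hi; apply: Hb; split=> //; exists i.
pose c := csucc (Order.max a b).
have cy : c < y by apply: climit_lt => //; rewrite gt_max ay.
have ac : a < c by rewrite lt_csuccE le_max lexx.
have bc : b < c by rewrite lt_csuccE le_max lexx orbT.
exists (cmul l c); first by rewrite xE; exact: cmul_lt.
move=> z /andP[cz zx]; rewrite xE (glue_lim _ yl).
have [|] := block_inv (le_lt_trans (cord_le0x _) cz) (le_trans zx xm).
  move=> [u [ul um zE]]; move: cz zx.
  rewrite xE zE (glue_lim _ ul) (normal_lt nl) (normal_le nl) => cu uy.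
  apply: lt_trans (Ha _ _) _; first by rewrite (lt_trans ac).
  by rewrite gtr_pMr// invf_lt1// ltr1n.
move=> [i [r [/andP[r0 rl] zE]]]; move: cz zx; rewrite xE zE => cz zx.
have ci : c <= val i.
  rewrite -lt_csuccE -(normal_lt nl); apply: lt_le_trans cz _.
  by rewrite cmulxS cadd_ler.
have iy : val i < y.
  by rewrite -(normal_lt nl); apply: lt_le_trans zx; rewrite lt_caddl.
rewrite glue_block ?r0// -addrA [e]splitr.
apply: le_lt_trans (ler_normD _ _) _; apply: ltrD.
  rewrite ltNge; apply/negP => er.
  have : val i <= b by apply: Hb => //; exists r.
  by rewrite leNgt (lt_le_trans bc ci).
apply: Ha; rewrite csucc_leP iy andbT.
by apply: lt_trans (lt_le_trans ac ci) (lt_csucc _).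
Qed.

Lemma retr_product_blocks :
  retr (@Cspace R (cmul l m)) (prodS (Cspace m) (c0S (fun _ : block => Cspace l))).
Proof.
exists unglue, (fun G => restr (cmul l m) (glue G)); split.
- exact: mor_unglue.
- split=> [|G [EG cG]]; first exact: kop_comp kop_glue (kop_restr _ _).
  by apply: Cspace_restr => x /andP[x0 xm]; exact: glue_cont.
- move=> f Ef; apply/funext => x; rewrite /restr; case: ifPn => [/andP[x0 xm]|xm].
    have [[y [yl ym xE]]|[i [r [rl xE]]]] := block_inv x0 xm.
      by rewrite xE (glue_lim _ yl) /= /restr climit_gt0 ?ym.
    have im : val i < m := valP i.
    by rewrite xE glue_block//= /restr rl csucc_gt0 csucc_leP im cmulxS subrK.
  by rewrite Ef.2.
Qed.

End Product.

Lemma retr_product l m : cord0 < l ->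
  retr (@Cspace R (cmul l m)) (prodS (@Cspace R m) (c0S (fun _ : nat => @Cspace R l))).
Proof.
move=> l0; apply: retr_trans (retr_product_blocks m l0) _.
apply: retr_prod; first exact: iso_retr (iso_refl _).
have /countable_injP[h hI] := cord_countable_initial m.
apply: (@retr_c0_reindex _ _ _ _ _ _ (fun i : block m => h (val i))) => // [i j hij|j].
  by apply: val_inj; apply: hI; rewrite ?inE /=; [exact: (valP i)|exact: (valP j)|].
exact: (subsp_Cspace _ _).1.
Qed.

(** The factor l gained at each step is absorbed by the c_0-sum. The norms of the
    operators grow with n, which is why l^omega is not reached. *)
Lemma retr_cpown l n : indec l -> retr (@Cspace R (cpown l n)) (@Cspace R l).
Proof.
move=> li; have l0 := climit_gt0 li.1; elim: n => [|n IH].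
  by apply: retr_Cspace; rewrite csucc_leP.
apply: retr_trans (retr_product _ l0) _.
apply: retr_trans (retr_prod IH (iso_retr (iso_refl _))) _.
apply: retr_trans (iso_retr (iso_sym (c0_shift _))) _.
exact: retr_c0_Cspace.
Qed.

Theorem iso_Cspace l a : indec l -> l <= a -> a < cpow l comega -> iso (@Cspace R a) (@Cspace R l).
Proof.
move=> li la /(lt_cpow_omega _ (climit_gt0 li.1))[n an].
apply: pelczynski; try exact: subsp_Cspace; last exact: retr_c0_Cspace.
  exact: retr_trans (retr_Cspace _ (ltW an)) (retr_cpown _ li).
exact: retr_Cspace.
Qed.

End Products.

(** * Operators separating the points of a long interval *)

Section Separation.
Variable R : realType.
Implicit Types (f g h : cord -> R) (a b x y z : cord).

(** The adjoint of [T] maps the points of [1, b] to functionals at mutual distance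
    at least [c]. *)
Record sep_op a b (T : (cord -> R) -> cord -> R) (M c : R) : Prop := SepOp {
  sep_gt0 : 0 < c;
  sep_lin : forall f g k y, Cspace a f -> Cspace a g -> cord0 < y <= b ->
    T (fun x => f x + k * g x) y = T f y + k * T g y;
  sep_cont : forall f y, Cspace a f -> cord0 < y <= b -> ccont_at (T f) y;
  sep_bound : forall f y, Cspace a f -> (forall x, `|f x| <= 1) -> cord0 < y <= b ->
    `|T f y| <= M;
  sep_sep : forall y z, cord0 < y <= b -> cord0 < z <= b -> y <> z ->
    exists f, [/\ Cspace a f, forall x, `|f x| <= 1 & c <= T f y - T f z] }.

Definition separates a b := exists T M c, sep_op a b T M c.

Lemma sep_reparam a b b' F T M c : normal F -> F b' <= b ->
  sep_op a b T M c -> sep_op a b' (fun f => T f \o F) M c.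
Proof.
move=> nF Fb [c0 Tl Tc Tb Ts].
have FP y : cord0 < y <= b' -> cord0 < F y <= b.
  move=> /andP[y0 yb]; rewrite (lt_le_trans y0 (normal_id nF _)) /=.
  by apply: le_trans Fb; rewrite (normal_le nF).
split=> // [f g k y Ef Eg /FP|f y Ef yb|f y Ef f1 /FP|y z /FP yb /FP zb yz].
- exact: Tl.
- have /andP[y0 _] := yb; apply: (ccont_at_normal nF y0).
  by apply: Tc => //; exact: FP.
- exact: Tb.
- by apply: Ts => // /(normal_inj nF).
Qed.

Lemma sep_le a b b' T M c : b' <= b -> sep_op a b T M c -> sep_op a b' T M c.
Proof. by move=> bb; exact: (sep_reparam normal_idfun). Qed.

Lemma separates_le a b b' : b' <= b -> separates a b -> separates a b'.
Proof. by move=> bb [T [M [c H]]]; exists T, M, c; exact: sep_le bb H. Qed.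

Section Ops.
Variables (a b : cord) (T : (cord -> R) -> cord -> R) (M c : R).
Hypothesis HT : sep_op a b T M c.

Lemma sep_zero y : cord0 < y <= b -> T (fun=> 0) y = 0.
Proof.
move=> yb; have := sep_lin HT (-1) (subsp_Cspace _ a).1 (subsp_Cspace _ a).1 yb.
rewrite (_ : (fun _ => _) = fun=> 0); first by lra.
by apply/funext => x; rewrite mulr0 addr0.
Qed.

Lemma sep_scale f k y : Cspace a f -> cord0 < y <= b -> T (fun x => k * f x) y = k * T f y.
Proof.
move=> Ef yb; have := sep_lin HT k (subsp_Cspace _ a).1 Ef yb.
by rewrite sep_zero// add0r => <-; congr (T _ y); apply/funext => x; rewrite add0r.
Qed.

Lemma sep_norm f y e : 0 < e -> Cspace a f -> (forall x, `|f x| <= e) ->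
  cord0 < y <= b -> `|T f y| <= M * e.
Proof.
move=> e0 Ef fe yb.
have Eg : Cspace a (fun x => e^-1 * f x).
  have := (subsp_Cspace _ a).2 _ _ e^-1 (subsp_Cspace _ a).1 Ef.
  by under eq_fun do rewrite add0r.
have /(sep_bound HT Eg) : forall x, `|e^-1 * f x| <= 1.
  by move=> x; rewrite normrM gtr0_norm ?invr_gt0// ler_pdivrMl// mulr1.
move=> /(_ _ yb); rewrite sep_scale// normrM gtr0_norm ?invr_gt0//.
by rewrite ler_pdivrMl// mulrC.
Qed.

End Ops.

(** Composition with an isomorphism changes the distances of functionals by a
    bounded factor only. *)
Lemma separates_iso a a' b : iso (@Cspace R a) (@Cspace R a') -> separates a b -> separates a' b.
Proof.
move=> [L [L' [[kL mL] [kL' mL'] K _]]] [T [M [c HT]]].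
have [C C0 HC] := kop_ge0 kL; have [C' C'0 HC'] := kop_ge0 kL'.
exists (fun f => T (L' f)), (M * C'), (c / C).
split=> [|f g k y Ef Eg yb|f y Ef yb|f y Ef f1 yb|y z yb zb yz].
- by rewrite divr_gt0 ?(sep_gt0 HT).
- by rewrite (kop_lin _ _ _ kL') (sep_lin HT)//; exact: mL'.
- by apply: (sep_cont HT) => //; exact: mL'.
- apply: (sep_norm HT) => //; first exact: mL'.
  by move=> x; rewrite -[leRHS]mulr1; exact: frep_bound (HC' x) _ _.
- have [f [Ef f1 cf]] := sep_sep HT yb zb yz.
  have E1 : Cspace a' (fun x => C^-1 * L f x).
    have := (subsp_Cspace _ a').2 _ _ C^-1 (subsp_Cspace _ a').1 (mL _ Ef).
    by under eq_fun do rewrite add0r.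
  have L'E : L' (fun x => C^-1 * L f x) = fun x => C^-1 * f x.
    have := kop_lin (fun=> 0) (L f) C^-1 kL'.
    under eq_fun do rewrite add0r; move=> ->; rewrite K//.
    apply/funext => x; suff -> : L' (fun=> 0) x = 0 by rewrite add0r.
    by have [l [_ ->]] := HC' x; apply: big1 => p _; rewrite mulr0.
  exists (fun x => C^-1 * L f x); split=> // [x|].
    rewrite normrM gtr0_norm ?invr_gt0// ler_pdivrMl//.
    by exact: frep_bound (HC x) _ _.
  rewrite L'E !(sep_scale HT)// -mulrBr mulrC ler_wpM2l// invr_ge0 ltW//.
Qed.

(** ** Loss of mass at an indecomposable end point *)

(** [B] bounds the mass of the functionals f |-> T f y away from the end point l. If
    at l y0 that mass exceeded B - c / 16, it would be attained up to c / 16 by a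
    function f0 supported in (0, x0] with x0 < l. Then at all points near l y0 the
    mass on the part of (x0, l] away from l is small, and the mass at l is almost
    constant because the value at the indicator function of (x0, l] is continuous.
    So the points near l y0, among which there is a translate of (0, l], would be
    separated by functions supported in (0, x0]. *)
Lemma sep_mass_drop l m T M c B : indec l -> (forall x, x < l -> ~ separates x l) ->
  sep_op l (cmul l m) T M c ->
  (forall x f y, x < l -> Cspace x f -> (forall z, `|f z| <= 1) ->
     cord0 < y <= cmul l m -> T f y <= B) ->
  forall x f y, x < l -> Cspace x f -> (forall z, `|f z| <= 1) -> cord0 < y <= m ->
    T f (cmul l y) <= B - c / 16.
Proof.
move=> il nsep HT HB x0 f0 y0 x0l Ef0 f01 /andP[y00 y0m].
have l0 := climit_gt0 il.1.
set e := c / 16; have e0 : 0 < e by rewrite divr_gt0 ?(sep_gt0 HT).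
have E_l x (f : cord -> R) : x <= l -> Cspace x f -> Cspace l f by move=> xl; exact: Cspace_le xl _.
rewrite leNgt; apply/negP => Tf0.
have ly0 : cord0 < cmul l y0 <= cmul l m by rewrite cmul_gt0//= cmul_le.
have Ef0l : Cspace l f0 by exact: E_l (ltW x0l) Ef0.
pose one a : cord -> R := restr a (fun=> 1).
have E_restrl x (g : cord -> R) : x <= l -> (forall z, cord0 < z -> ccont_at g z) ->
    Cspace l (restr x g).
  move=> xl cg; apply: E_l xl _; apply: Cspace_restr => z /andP[z0 _]; exact: cg.
have EB (g h : cord -> R) a : Cspace a g -> Cspace a h -> Cspace a (fun x => g x - h x).
  move=> Eg Eh; have := (subsp_Cspace _ a).2 _ _ (-1) Eg Eh.
  by under eq_fun do rewrite mulN1r.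
pose u x := one l x - one x0 x.
have Eu : Cspace l u.
  by by apply: EB; apply: E_restrl; rewrite ?lexx ?(ltW x0l)// => z z0;
    exact: ccont_at_cst.
have [a1 a1y H1] := sep_cont HT Ef0l ly0 (etrans (subr_gt0 _ _) Tf0).
have [a2 a2y H2] := sep_cont HT Eu ly0 e0.
have ay : Order.max a1 a2 < cmul l y0 by rewrite gt_max a1y.
have [b ab bl] := indec_tail il y00 ay.
have bP y : cord0 < y -> a1 < cadd b y /\ a2 < cadd b y.
  move=> yp; have bb : Order.max a1 a2 < cadd b y.
    by apply: le_lt_trans ab _; rewrite lt_caddl.
  by move: bb; rewrite gt_max => /andP.
have bl' y : y <= l -> cadd b y <= cmul l y0.
  by move=> yl; apply: le_trans bl; rewrite cadd_ler.
have blm y : cord0 < y <= l -> cord0 < cadd b y <= cmul l m.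
  move=> /andP[yp yl]; rewrite (lt_le_trans yp (le_caddr _ _)) /=.
  by apply: le_trans (bl' _ yl) _; case/andP: ly0.
(* The operator f |-> T f (b + .) on functions supported in (0, x0] contradicts
   the hypothesis on l. *)
apply: (nsep x0 x0l); exists (fun f y => T f (cadd b y)), M, (c / 2).
split.
- by rewrite divr_gt0 ?(sep_gt0 HT).
- move=> f g k y Ef Eg yl; apply: (sep_lin HT); last exact: blm.
    exact: E_l (ltW x0l) Ef.
  exact: E_l (ltW x0l) Eg.
- move=> f y Ef yl; have /andP[yp _] := yl.
  apply: (ccont_at_normal (normal_add b) yp).
  by apply: (sep_cont HT); [exact: E_l (ltW x0l) Ef|exact: blm].
- move=> f y Ef f1 yl; apply: (sep_bound HT) => //; last exact: blm.
  exact: E_l (ltW x0l) Ef.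
move=> y z yl zl yz.
have [f [Ef f1 cf]] := sep_sep HT (blm _ yl) (blm _ zl) (fun H => yz (caddI H)).
have M0 : 0 <= M by apply: le_trans (sep_bound HT Ef f1 (blm _ yl)).
pose d := e / (M + 1); have d0 : 0 < d by rewrite divr_gt0// ltr_wpDl.
have Md : M * d <= e.
  rewrite /d mulrCA -[leRHS]mulr1 ler_pM2l// ler_pdivrMr ?ltr_wpDl// mul1r.
  by rewrite lerDl.
have [a3 a3l H3] := Cspace_cont Ef l0 d0.
pose x1 := Order.max a3 x0; have x1l : x1 < l by rewrite gt_max a3l.
have x01 : x0 <= x1 by rewrite le_max lexx orbT.
have a31 : a3 <= x1 by rewrite le_max lexx.
pose k x := f x - f l.
have ck w : cord0 < w -> ccont_at k w.
  by move=> w0; apply: ccont_atB; [exact: Cspace_cont Ef w0|exact: ccont_at_cst].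
pose f' := restr x0 f.
pose g x := restr x1 k x - restr x0 k x.
pose h x := restr l k x - restr x1 k x.
have Ef'0 : Cspace x0 f' by apply: Cspace_restr => w /andP[w0 _]; exact: Cspace_cont Ef w0.
have Ef' : Cspace l f' by exact: E_l (ltW x0l) Ef'0.
have Eg1 : Cspace x1 g.
  apply: EB; first by apply: Cspace_restr => w /andP[w0 _]; exact: ck.
  apply: (Cspace_le x01); apply: Cspace_restr => w /andP[w0 _]; exact: ck.
have Eg : Cspace l g by exact: E_l (ltW x1l) Eg1.
have Eh : Cspace l h by apply: EB; apply: E_restrl; rewrite ?lexx ?(ltW x1l).
(* The four terms: f on (0, x0], the value at l on (x0, l], and f - f l on
   (x0, x1] and on (x1, l], where it is at most d. *)
have fE : f = fun x => ((f' x + f l * u x) + 1 * g x) + 1 * h x.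
  apply/funext => x; rewrite /u /g /h /f' /one -{1}(restr_id Ef) /restr /k.
  by case: ifP => _; case: ifP => _; case: ifP => _; ring.
have Elin (p q : cord -> R) s : Cspace l p -> Cspace l q -> Cspace l (fun x => p x + s * q x).
  by move=> Ep Eq; exact: (subsp_Cspace _ l).2.
have TfE w : cord0 < w <= cmul l m ->
    T f w = ((T f' w + f l * T u w) + 1 * T g w) + 1 * T h w.
  move=> wm; rewrite {1}fE (sep_lin HT)//; last exact: (Elin _ _ _ (Elin _ _ _ Ef' Eu) Eg).
  by rewrite (sep_lin HT)//; [rewrite (sep_lin HT)|exact: Elin].
have Th w : cord0 < w <= cmul l m -> `|T h w| <= e.
  move=> wm; apply: le_trans Md; apply: (sep_norm HT) => // x.
  rewrite /h /restr; case: ifPn => [/andP[xp xl]|xl]; last first.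
    rewrite ifN; first by rewrite subrr normr0 ltW.
    by apply: contra xl => /andP[-> xx1]; exact: le_trans xx1 (ltW x1l).
  rewrite xp /=; have [_|x1x] := leP x x1; first by rewrite subrr normr0 ltW.
  by rewrite subr0 ltW// H3// xl (le_lt_trans a31 x1x).
have Tg w : cord0 < w <= l -> `|T g (cadd b w)| <= 2 * e.
  move=> wl; have wm := blm _ wl; have /andP[w0 wl'] := wl.
  have Tf0w : B - e < T f0 (cadd b w).
    have := H1 (cadd b w); rewrite (bP _ w0).1 bl'// => /(_ isT).
    by rewrite ltr_norml => /andP[+ _]; lra.
  (* f0 and g / 2 have norm at most 1 and disjoint supports. *)
  have P s : `|s| = 1 / 2 -> T f0 (cadd b w) + s * T g (cadd b w) <= B.
    move=> s12; rewrite -(sep_lin HT)//; apply: (HB x1) => //.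
      apply: (subsp_Cspace _ x1).2 => //; exact: Cspace_le x01 _ Ef0.
    move=> x; have [xx0|x0x] := boolP (cord0 < x <= x0).
      rewrite /g /restr xx0; have /andP[-> xx0'] := xx0.
      by rewrite (le_trans xx0' x01) subrr mulr0 addr0.
    rewrite Ef0.2// add0r normrM s12 /g /restr (negbTE x0x) subr0.
    case: ifP => _; last by rewrite normr0 mulr0.
    apply: le_trans (_ : 1 / 2 * (1 + 1) <= _); last by lra.
    rewrite ler_pM2l//; apply: le_trans (ler_normB _ _) _; exact: lerD.
  have := P (1 / 2) ltac:(by rewrite ger0_norm).
  have := P (- (1 / 2)) ltac:(by rewrite normrN ger0_norm).
  by rewrite ler_norml => ? ?; apply/andP; split; lra.
have Tu : `|f l * T u (cadd b y) - f l * T u (cadd b z)| <= 2 * e.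
  rewrite -mulrBr normrM -[leRHS]mul1r; apply: ler_pM => //.
  have Hu w : cord0 < w <= l -> `|T u (cadd b w) - T u (cmul l y0)| < e.
    by move=> /andP[w0 wl]; apply: H2; rewrite (bP _ w0).2 bl'.
  have := Hu _ yl; have := Hu _ zl; rewrite !ltr_norml => /andP[? ?] /andP[? ?].
  by rewrite ler_norml; apply/andP; split; lra.
exists f'; split=> // [x|].
  by rewrite /f' /restr; case: ifP => _; rewrite ?normr0.
move: cf; rewrite (TfE _ (blm _ yl)) (TfE _ (blm _ zl)).
have := Tg _ yl; have := Tg _ zl; have := Th _ (blm _ yl); have := Th _ (blm _ zl).
move: Tu; rewrite !ler_norml => /andP[? ?] /andP[? ?] /andP[? ?] /andP[? ?] /andP[? ?].
have : c = 16 * e by rewrite /e mulrC divfK.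
lra.
Qed.

(** Passing from l^(n + 1) to l^n by restriction to the multiples of l costs c / 16
    of the mass, which is at most M initially and never negative. *)
Lemma not_separates_power l : indec l -> (forall x, x < l -> ~ separates x l) ->
  ~ separates l (cpow l comega).
Proof.
move=> il nsep [T [M [c HT]]]; have l0 := climit_gt0 il.1.
have H n T' B : sep_op l (cpown l n) T' M c ->
    (forall x f y, x < l -> Cspace x f -> (forall z, `|f z| <= 1) ->
     cord0 < y <= cpown l n -> T' f y <= B) -> n%:R * (c / 16) <= B.
  elim: n T' B => [|n IH] T' B HT' HB.
    rewrite mul0r -(sep_zero HT' (y := cord1)); last by rewrite csucc_gt0 lexx.
    apply: (HB cord0) => //; first exact: (subsp_Cspace _ _).1.
      by move=> z; rewrite normr0.
    by rewrite csucc_gt0 lexx.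
  rewrite -natr1 mulrDl mul1r -lerBrDr.
  apply: (IH (fun f => T' f \o cmul l)).
    apply: sep_reparam HT'; last exact: lexx.
    exact: normal_mul.
  exact: (sep_mass_drop il nsep HT' HB).
have {}H n : n%:R * (c / 16) <= M.
  have nl : cpown l n <= cpow l comega.
    by move/(cpow_omega_le _ l0): (lexx (cpow l comega)); apply.
  apply: (H n T M); first exact: sep_le nl HT.
  move=> x f y xl Ef f1 yl; apply: le_trans (ler_norm _) _.
  apply: (sep_bound HT) => //; first exact: Cspace_le (ltW xl) _ Ef.
  by have /andP[-> /le_trans->] := yl.
have c0 : 0 < c / 16 by rewrite divr_gt0 ?(sep_gt0 HT).
have := H (Num.bound `|M / (c / 16)|); rewrite -ler_pdivlMr//.
rewrite leNgt => /negP; apply; apply: le_lt_trans (ler_norm _) _.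
exact: archi_boundP.
Qed.

(** On a finite-dimensional space pointwise convergence of functionals is norm
    convergence, so the functionals at n tend in norm to the one at omega. *)
Lemma not_separates_finite n : ~ separates (natc n) comega.
Proof.
move=> [T [M [c HT]]].
have o0 : cord0 < comega <= comega by rewrite comega_gt0 lexx.
have H k (e : R) : (k <= n)%N -> 0 < e -> exists2 a, a < comega & forall z, a < z <= comega ->
    forall f, Cspace (natc k) f -> (forall x, `|f x| <= 1) -> `|T f z - T f comega| < e.
  have natc_le i j : (i <= j)%N -> natc i <= natc j.
    move=> /subnK <-; elim: (j - i)%N => [//|p IH].
    by rewrite addSn natcS; apply: le_trans IH (ltW (lt_csucc _)).
  elim: k e => [|k IH] e kn e0.
    exists cord0; first exact: comega_gt0.
    move=> z zo f [_ f0] _; have -> : f = fun=> 0.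
      by apply/funext => x; apply: f0; rewrite negb_and -!leNgt -ltNge; case: ltP.
    by rewrite !(sep_zero HT)// subrr normr0.
  have e2 : 0 < e / 2 by exact: divr_gt0.
  have [a ao Ha] := IH _ (ltnW kn) e2.
  pose u x : R := restr (natc k.+1) (fun=> 1) x - restr (natc k) (fun=> 1) x.
  have E1 j : (j <= n)%N -> Cspace (natc n) (restr (natc j) (fun=> 1 : R)).
    move=> jn; apply: Cspace_le (natc_le _ _ jn) _ _; apply: Cspace_restr => x /andP[x0 _].
    exact: ccont_at_cst.
  have Eu : Cspace (natc n) u.
    have := (subsp_Cspace _ (natc n)).2 _ _ (-1) (E1 _ kn) (E1 _ (ltnW kn)).
    by under eq_fun do rewrite mulN1r.
  have [b bo Hb] := sep_cont HT Eu o0 e2.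
  exists (Order.max a b) => [|z]; first by rewrite gt_max ao.
  rewrite gt_max -andbA => /and3P[az bz zo] f Ef f1.
  have z0 : cord0 < z <= comega by rewrite zo (le_lt_trans (cord_le0x a)).
  have Ef' : Cspace (natc k) (restr (natc k) f).
    by apply: Cspace_restr => x /andP[x0 _]; exact: Cspace_cont Ef x0.
  have Ef'n : Cspace (natc n) (restr (natc k) f) by exact: Cspace_le (natc_le _ _ (ltnW kn)) _ Ef'.
  have -> : f = fun x => restr (natc k) f x + f (natc k.+1) * u x.
    apply/funext => x; rewrite /u /restr -{1}(restr_id Ef) /restr natcS.
    have [x0|] /= := ltP cord0 x; last by rewrite subrr mulr0 addr0.
    rewrite -lt_csuccE lt_csuccE; have [xk|kx] := leP x (natc k).
      by rewrite (le_trans xk (ltW (lt_csucc _))) subrr mulr0 addr0.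
    have [xk1|_] := leP x (csucc (natc k)); last by rewrite subrr mulr0 addr0.
    have -> : x = csucc (natc k) by apply/le_anti; rewrite xk1 csucc_leP.
    by rewrite subr0 mulr1 add0r.
  rewrite !(sep_lin HT)// [e]splitr opprD addrACA -mulrBr.
  apply: le_lt_trans (ler_normD _ _) _; apply: ltr_leD.
    apply: Ha; rewrite ?az//= => x; rewrite /restr.
    by case: ifP => _; rewrite ?normr0.
  rewrite normrM -[leRHS]mul1r; apply: ler_pM => //; apply: ltW.
  by apply: Hb; rewrite bz.
have [a ao Ha] := H n c (leqnn n) (sep_gt0 HT).
have ao' := climit_lt comega_lim ao.
have ab : cord0 < csucc a <= comega by rewrite csucc_gt0 ltW.
have ne : csucc a <> comega by move=> aE; rewrite aE ltxx in ao'.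
have [f [Ef f1]] := sep_sep HT ab o0 ne.
rewrite leNgt => /negP; apply; apply: le_lt_trans (ler_norm _) _.
by apply: Ha => //; rewrite lt_csucc ltW.
Qed.

(** The first element l of the class of a has an isomorphic function space, and all
    infinite x < l satisfy x^omega <= l, so that the induction hypothesis for x
    excludes operators from C([1, x]) to C([1, l]). *)
Theorem not_separates_omega a : comega <= a -> ~ separates a (cpow a comega).
Proof.
elim/cord_ind: a => a IH oa; have [l [lc la al]] := pow_closed_exists oa.
have li := pow_closed_indec lc; have l0 := climit_gt0 li.1.
have a0 := lt_le_trans l0 la.
move=> /(separates_iso (iso_Cspace _ li la al)) /(@separates_le _ _ (cpow l comega)) S.
apply: (not_separates_power li) => [x xl|]; last first.
  apply: S; apply: cpow_omega_le2 => //; apply: le_lt_trans la _.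
  apply: lt_cpow_omega_self; exact: lt_le_trans comega_gt1 oa.
have [ox|/lt_omegaP[n ->]] := leP comega x.
  move=> /(separates_le (lc.2 _ ox xl)); apply: IH => //.
  exact: lt_le_trans xl la.
by move=> /(separates_le lc.1); exact: not_separates_finite.
Qed.

End Separation.

(** * Uniform boundedness for bounded continuous functions *)

Section UniformBoundedness.
Variable R : realType.

Lemma continuous_realP (Z : topologicalType) (f : Z -> R) :
  continuous f <-> forall z e, 0 < e -> \forall y \near z, `|f z - f y| < e.
Proof.
split=> [cf z e e0|H z]; first by have /cvgrPdist_lt := cf z; apply.
by apply/cvgrPdist_lt => e e0; exact: H.
Qed.

(** The intervals [s n z - r n, s n z + r n] are nested, so the supremum of their left
    end points lies in all of them. *)
Lemma geo_limit (Z : topologicalType) (s : nat -> Z -> R) :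
  (forall n, continuous (s n)) ->
  (forall n z, `|s n.+1 z - s n z| <= 4 ^- n) ->
  exists F, continuous F /\ forall n z, `|F z - s n z| <= 4 / 3 * 4 ^- n.
Proof.
move=> cs ds; pose r n : R := 4 / 3 * 4 ^- n.
have r0 n : 0 < r n by rewrite /r mulr_gt0// ?divr_gt0// invr_gt0 exprn_gt0.
have rS n : r n = 4 ^- n + r n.+1 by rewrite /r exprS invfM; field; rewrite expf_neq0.
have lo n k z : s n z - r n <= s (n + k)%N z - r (n + k)%N.
  elim: k => [|k IH]; first by rewrite addn0.
  apply: le_trans IH _; rewrite addnS (rS (n + k)%N).
  by have := ds (n + k)%N z; rewrite ler_norml => /andP[? ?]; lra.
have hi n k z : s (n + k)%N z + r (n + k)%N <= s n z + r n.
  elim: k => [|k IH]; first by rewrite addn0.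
  apply: le_trans IH; rewrite addnS (rS (n + k)%N).
  by have := ds (n + k)%N z; rewrite ler_norml => /andP[? ?]; lra.
have lohi m n z : s m z - r m <= s n z + r n.
  apply: le_trans (lo m n z) _; apply: le_trans (hi n m z); rewrite addnC.
  by have := r0 (n + m)%N; lra.
pose F z := sup (range (fun n => s n z - r n)).
have HF n z : `|F z - s n z| <= r n.
  rewrite ler_norml; apply/andP; split.
    suff : s n z - r n <= F z by lra.
    apply: ub_le_sup; last by exists n.
    by exists (s 0%N z + r 0%N) => _ [m _ <-].
  suff : F z <= s n z + r n by lra.
  by apply: ge_sup => [|_ [m _ <-]//]; exists (s 0%N z - r 0%N), 0%N.
exists F; split=> //; apply/continuous_realP => z e e0.
have e3 : 0 < e / 3 by rewrite divr_gt0.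
have [n rn] : exists n, r n < e / 3.
  pose b := Num.bound (4 / (e : R)); exists b.
  have bE : 4 / e < b%:R by apply: archi_boundP; rewrite divr_ge0// ltW.
  have b4 : b%:R <= 4 ^+ b :> R.
    by rewrite -natrX ler_nat ltnW// ltn_expl.
  have p4 : 0 < 4 ^+ b :> R by rewrite exprn_gt0.
  rewrite /r ltr_pdivrMr// -/b.
  have := lt_le_trans bE b4; rewrite ltr_pdivrMr// => H; lra.
have /continuous_realP/(_ z _ e3) := cs n; apply: filterS => y Hy.
rewrite (_ : F z - F y = (F z - s n z) + (s n z - s n y) - (F y - s n y)); last by ring.
apply: le_lt_trans (ler_normB _ _) _; apply: le_lt_trans (lerD (ler_normD _ _) (lexx _)) _.
by have := HF n z; have := HF n y; lra.
Qed.

Variable Z : topologicalType.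

Definition bcont (f : Z -> R) := continuous f /\ exists C, forall z, `|f z| <= C.

Lemma continuous_lin (f g : Z -> R) c :
  continuous f -> continuous g -> continuous (fun z => f z + c * g z).
Proof. by move=> cf cg z; apply: cvgD; [exact: cf|apply: cvgMr; exact: cg]. Qed.

Lemma bcont_lin f g c : bcont f -> bcont g -> bcont (fun z => f z + c * g z).
Proof.
move=> [cf [C fC]] [cg [D gD]]; split; first exact: continuous_lin.
exists (C + `|c| * D) => z; apply: le_trans (ler_normD _ _) _.
by rewrite lerD// normrM ler_wpM2l.
Qed.

Lemma bcont0 : bcont (fun=> 0).
Proof. by split=> [z|]; [exact: cvg_cst|exists 0 => z; rewrite normr0]. Qed.

Definition lin_on (phi : (Z -> R) -> R) := forall f g c, bcont f -> bcont g ->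
  phi (fun z => f z + c * g z) = phi f + c * phi g.

Definition ball1 (f : Z -> R) := continuous f /\ forall z, `|f z| <= 1.

Lemma ball1_bcont f : ball1 f -> bcont f.
Proof. by move=> [cf f1]; split=> //; exists 1. Qed.

Lemma ball1N f : ball1 f -> ball1 (fun z => - f z).
Proof.
move=> [cf f1]; split=> z; last by rewrite normrN.
by apply: cvgN; exact: cf.
Qed.

Section Functional.
Variables (phi : (Z -> R) -> R) (phiL : lin_on phi).

Lemma lin_on0 : phi (fun=> 0) = 0.
Proof.
have := phiL (-1) bcont0 bcont0.
rewrite (_ : (fun _ => _) = fun=> 0); first by lra.
by apply/funext => x; rewrite mulr0 addr0.
Qed.

Lemma lin_onZ f c : bcont f -> phi (fun z => c * f z) = c * phi f.
Proof.
move=> bf; have := phiL c bcont0 bf; rewrite lin_on0 add0r => <-.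
by congr phi; apply/funext => x; rewrite add0r.
Qed.

Lemma lin_on_scale f e B : 0 < e -> continuous f -> (forall z, `|f z| <= e) ->
  (forall g, ball1 g -> `|phi g| <= B) -> `|phi f| <= B * e.
Proof.
move=> e0 cf fe HB; have bf : bcont f by split=> //; exists e.
have cg : continuous (fun z => e^-1 * f z) by move=> z; apply: cvgMr; exact: cf.
have /HB : ball1 (fun z => e^-1 * f z).
  split=> // z; rewrite normrM gtr0_norm ?invr_gt0// ler_pdivrMl// mulr1.
  exact: fe.
rewrite lin_onZ// normrM gtr0_norm ?invr_gt0// ler_pdivrMl// mulrC.
by [].
Qed.

(** The factor 2 leaves room because the supremum may not be attained. *)
Lemma norming K : (forall f, ball1 f -> `|phi f| <= K) ->
  exists2 h, ball1 h & forall f, ball1 f -> `|phi f| <= 2 * `|phi h|.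
Proof.
move=> HK; have b0 : ball1 (fun=> 0) by split=> [z|z]; [exact: cvg_cst|rewrite normr0].
pose S := [set `|phi f| | f in ball1].
have S0 : has_sup S.
  split; first by exists `|phi (fun=> 0)|, (fun=> 0).
  by exists K => _ [f bf <-]; exact: HK.
have Sle f : ball1 f -> `|phi f| <= sup S.
  by move=> bf; apply: ub_le_sup; [exact: S0.2|exists f].
have [S1|S1] := leP (sup S) 0.
  exists (fun=> 0) => // f /Sle /le_trans -> //.
  by apply: le_trans S1 _; rewrite mulr_ge0.
have [_ [h bh <-] hS] := sup_adherent (divr_gt0 S1 (ltr0Sn _ 1)) S0.
by exists h => // f /Sle /le_trans; apply; move: hS; lra.
Qed.

End Functional.

(** Gliding hump: with phi_k almost attaining a huge norm at h_k, signs can be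
    chosen such that phi_k is large at the k-th partial sum of
    [sum_k +-4^-k h_k]; the rest of the series is too small to undo this. *)
Theorem uniform_boundedness (I : Type) (phi : I -> (Z -> R) -> R) :
  (forall i, lin_on (phi i)) ->
  (forall i, exists K, forall f, ball1 f -> `|phi i f| <= K) ->
  (forall f, bcont f -> exists B, forall i, `|phi i f| <= B) ->
  exists M, forall i f, ball1 f -> `|phi i f| <= M.
Proof.
move=> phiL phiK phiB; apply: contrapT => noM.
have big X : exists ih : I * (Z -> R), [/\ ball1 ih.2, X < `|phi ih.1 ih.2| &
    forall f, ball1 f -> `|phi ih.1 f| <= 2 * `|phi ih.1 ih.2|].
  apply: contrapT => H; apply: noM; exists (2 * X) => i f bf.
  have [K HK] := phiK i; have [h bh Hh] := norming HK.
  apply: le_trans (Hh f bf) _; rewrite ler_pM2l// leNgt; apply/negP => Xh.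
  by apply: H; exists (i, h).
pose X k : R := 3 * (k%:R + 1) * 4 ^+ k.
pose ih k := projT1 (cid (big (X k))); pose i k := (ih k).1; pose h k := (ih k).2.
have Hh k : [/\ ball1 (h k), X k < `|phi (i k) (h k)| &
    forall f, ball1 f -> `|phi (i k) f| <= 2 * `|phi (i k) (h k)|].
  by rewrite /h /i /ih; case: cid.
pose q k : R := 4 ^- k; have q0 k : 0 < q k by rewrite invr_gt0 exprn_gt0.
pose sg k (f : Z -> R) : R :=
  if q k * `|phi (i k) (h k)| <= `|phi (i k) (fun z => f z + q k * h k z)|
  then q k else - q k.
pose s := fix s n := if n is k.+1 then fun z => s k z + sg k (s k) * h k z
  else fun _ : Z => 0 : R.
have sgE k f : `|sg k f| = q k.
  by rewrite /sg; case: ifP => _; rewrite ?normrN ger0_norm// ltW.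
have sb n : bcont (s n).
  elim: n => [|n IH]; first exact: bcont0.
  by apply: bcont_lin => //; apply: ball1_bcont; case: (Hh n).
have [|n z|F [cF HF]] := @geo_limit Z s.
- by move=> n; exact: (sb n).1.
- rewrite /= addrAC subrr add0r normrM sgE (ler_piMr (ltW (q0 n)))//.
  by case: (Hh n) => -[_ h1] _ _; exact: h1.
have bF : bcont F.
  split=> //; exists (4 / 3 * 4 ^- 0) => z; have := HF 0%N z.
  by rewrite subr0.
have [B HB] := phiB F bF.
have large k : q k * `|phi (i k) (h k)| <= `|phi (i k) (s k.+1)|.
  rewrite /= /sg; case: ifPn => //; rewrite -ltNge.
  have bh : bcont (h k) by apply: ball1_bcont; case: (Hh k).
  rewrite !phiL//; set a := phi _ (s k); set b := phi _ (h k) => lt1.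
  have qb : `|q k * b| = q k * `|b| by rewrite normrM gtr0_norm.
  rewrite mulNr -qb; rewrite -qb in lt1.
  have := ler_normB (a + q k * b) (a - q k * b).
  rewrite (_ : a + q k * b - (a - q k * b) = 2 * (q k * b)); last by ring.
  by rewrite normrM ger0_norm//; lra.
have contra k : k%:R + 1 <= B.
  have [bh Xh Hb] := Hh k; have := HB (i k).
  have -> : F = fun z => s k.+1 z + 1 * (F z - s k.+1 z).
    by apply/funext => z; rewrite mul1r addrC subrK.
  have bFs : bcont (fun z => F z - s k.+1 z).
    have := bcont_lin (-1) bF (sb k.+1).
    by under eq_fun do rewrite mulN1r.
  rewrite phiL// mul1r.
  have : `|phi (i k) (fun z => F z - s k.+1 z)| <=
      2 * `|phi (i k) (h k)| * (q k / 3).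
    apply: lin_on_scale => //; [by rewrite divr_gt0|exact: bFs.1|].
    move=> z; apply: le_trans (HF k.+1 z) _.
    by rewrite exprS invfM mulrA /q; lra.
  have := large k; have := lerB_dist (phi (i k) (s k.+1))
     (- phi (i k) (fun z => F z - s k.+1 z)); rewrite opprK normrN.
  have : k%:R + 1 <= `|phi (i k) (h k)| * (q k / 3).
    rewrite (_ : k%:R + 1 = X k * (q k / 3)).
      by rewrite ler_wpM2r ?divr_ge0// ltW.
    by rewrite /X /q; field; rewrite expf_neq0.
  lra.
have := contra (Num.bound `|B|); have := archi_boundP (normr_ge0 B).
have := ler_norm B; lra.
Qed.

End UniformBoundedness.

(** * The spaces C_p([1, a]) as function spaces on ordinals *)

Section Glue.
Variable R : realType.

Lemma Cp_cvgP (X : topologicalType) (F : set_system (Cp R X)) (f : Cp R X) :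
  Filter F -> F --> f <-> forall x, (fun g : Cp R X => g x) @ F --> f x.
Proof.
move=> FF; pose i (g : Cp R X) := (g : X -> R) : {ptws X -> R}.
have FI : Filter (i @ F) by exact: fmap_filter.
split=> [Ff|H].
  apply/(pointwise_cvgP (i f) FI).
  apply: cvg_trans (_ : i @ F --> i @ nbhs f) _; first exact: cvg_app.
  exact: (@initial_continuous (Cp R X) {ptws X -> R} i f).
have /(pointwise_cvgP (i f) FI) FfI : forall x, (fun g => g x) @ (i @ F) --> i f x by [].
move=> A; rewrite nbhsE => -[B [[C oC CB] Bf] BA].
apply: filterS BA _; rewrite -CB; apply: FfI.
by apply: open_nbhs_nbhs; split=> //; rewrite -[C _]/((i @^-1` C) f) CB.
Qed.

Lemma Cp_eval_continuous (X : topologicalType) (x : X) :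
  continuous (fun g : Cp R X => g x).
Proof. by move=> f; apply: (Cp_cvgP f (nbhs_filter f)).1. Qed.

#[local] Instance Cp_nbhs_filter (X : topologicalType) (f : Cp R X) :
  ProperFilter (nbhs f) := nbhs_pfilter f.

Lemma Cp_continuousP (X Z : topologicalType) (T : Cp R X -> Cp R Z) :
  (forall z, continuous (fun f => T f z)) -> continuous T.
Proof. by move=> H f; apply: (Cp_cvgP (T f) (fmap_filter _ (nbhs_filter f))).2 => z; exact: H. Qed.

Lemma cseg_nbhs a (x : cseg a) (A : set (cseg a)) : nbhs x A <->
  exists2 b, b < val x & forall z : cseg a, b < val z <= val x -> A z.
Proof.
have ltE (y z : cseg a) : (y < z) = (val y < val z) by [].
split=> [|[b bx bA]].
  rewrite itv_nbhsE => -[[l r] [/= + xi] iA].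
  case: l xi iA => [[] l|[]]; case: r => [[] r|[]] //= xi iA _.
  - move: xi; rewrite in_itv /= => /andP[lx xr].
    exists (val l) => // z /andP[lz zx]; apply: iA; rewrite /= in_itv /= ltE lz /=.
    exact: le_lt_trans zx xr.
  - move: xi; rewrite in_itv /= andbT => lx.
    by exists (val l) => // z /andP[lz zx]; apply: iA; rewrite /= in_itv /= ltE lz.
  - move: xi; rewrite in_itv /= => xr.
    exists cord0; first by rewrite -csucc_leP; case/andP: (valP x).
    move=> z /andP[lz zx]; apply: iA; rewrite /= in_itv /= ltE.
    exact: le_lt_trans zx xr.
  - exists cord0; first by rewrite -csucc_leP; case/andP: (valP x).
    by move=> z _; apply: iA; rewrite /= in_itv.
have /andP[x1 xa] := valP x.
have L : nbhs x [set z : cseg a | b < val z].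
  have [b1|b1] := leP cord1 b; last first.
    apply: filterS (filterT) => z _ /=; apply: lt_le_trans b1 _.
    by case/andP: (valP z).
  have bP : cord1 <= b <= a by rewrite b1 ltW// (lt_le_trans bx).
  apply: filterS (open_nbhs_nbhs (conj (rray_open (Sub b bP : cseg a)) _)).
    by move=> z /=; rewrite in_itv /= andbT ltE SubK.
  by rewrite /= in_itv /= andbT ltE SubK.
have U : nbhs x [set z : cseg a | val z <= val x].
  have [ax|xa'] := leP a (val x).
    apply: filterS (filterT) => z _ /=; apply: le_trans ax.
    by case/andP: (valP z).
  have bP : cord1 <= csucc (val x) <= a.
    by rewrite csucc_leP xa' andbT; apply: le_trans x1 (ltW (lt_csucc _)).
  apply: filterS (open_nbhs_nbhs (conj (lray_open (Sub (csucc (val x)) bP : cseg a)) _)).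
    by move=> z /=; rewrite in_itv /= ltE SubK lt_csuccE.
  by rewrite /= in_itv /= ltE SubK lt_csucc.
by apply: filterS (filterI L U) => z [bz zx]; apply: bA; rewrite bz.
Qed.

Lemma cseg_continuousP a (f : cseg a -> R) : continuous f <->
  forall x e, 0 < e -> exists2 b, b < val x &
    forall z : cseg a, b < val z <= val x -> `|f z - f x| < e.
Proof.
split=> [/continuous_realP H x e /(H x) /cseg_nbhs[b bx bA]|H].
  by exists b => // z /bA; rewrite distrC.
apply/continuous_realP => x e /(H x)[b bx bA]; apply/cseg_nbhs.
by exists b => // z /bA; rewrite distrC.
Qed.

Definition cext a (f : cseg a -> R) x : R := if insub x is Some z then f z else 0.

Lemma cextE a (f : cseg a -> R) (z : cseg a) : cext f (val z) = f z.
Proof. by rewrite /cext valK. Qed.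

Lemma cseg_in a x : cord0 < x <= a -> exists z : cseg a, val z = x.
Proof. by rewrite -cord1_le => xa; exists (Sub x xa); rewrite SubK. Qed.

Lemma cseg_inP a (z : cseg a) : cord0 < val z <= a.
Proof. by have := valP z; rewrite cord1_le. Qed.

Lemma Cspace_cext a (f : cseg a -> R) : continuous f -> Cspace a (cext f).
Proof.
move=> /cseg_continuousP cf; split=> x xa.
  have [z xE] := cseg_in xa; rewrite -xE => e e0; have [b bx bA] := cf z e e0.
  exists b => // y /andP[by_ yz]; have [|u uE] := @cseg_in a y.
    rewrite (le_lt_trans (cord_le0x b))//=; apply: le_trans yz _.
    by case/andP: (cseg_inP z).
  by rewrite -uE !cextE; apply: bA; rewrite uE by_.
by rewrite /cext insubN // cord1_le.
Qed.

Lemma continuous_Cspace a (F : cord -> R) : Cspace a F -> continuous (fun z : cseg a => F (val z)).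
Proof.
move=> EF; apply/cseg_continuousP => x e e0.
have /andP[x0 _] := cseg_inP x; have [b bx bA] := Cspace_cont EF x0 e0.
by exists b => // z; exact: bA.
Qed.

Lemma cextK a (F : cord -> R) : Cspace a F -> cext (fun z : cseg a => F (val z)) = F.
Proof.
move=> EF; apply/funext => x; have [xa|xa] := boolP (cord0 < x <= a).
  by have [z <-] := cseg_in xa; rewrite cextE.
by rewrite EF.2// /cext insubN // cord1_le.
Qed.

Lemma cseg_countable a : countable [set: cseg a].
Proof.
have /countable_injP[h hI] := cord_countable_initial (csucc a).
apply/countable_injP; exists (fun z => h (val z)) => y z _ _ hyz.
by apply: val_inj; apply: hI => //; rewrite inE /= lt_csuccE;
  [case/andP: (cseg_inP y)|case/andP: (cseg_inP z)].
Qed.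

Lemma cseg_bounded a (f : cseg a -> R) : continuous f -> exists2 C, 0 < C & forall z, `|f z| <= C.
Proof.
move=> /Cspace_cext/Cspace_bounded[C C0 HC]; exists (C + 1); first by rewrite ltr_wpDl.
by move=> z; rewrite -cextE; apply: le_trans (HC _) _; rewrite lerDl.
Qed.

Section Operator.
Variables (a b : cord) (L : (cord -> R) -> cord -> R).
Hypotheses (kL : kop L) (EL : forall f, Cspace a f -> Cspace b (L f)).

Definition Cp_op_of (_ : kop L) (f : Cp R (cseg a)) : Cp R (cseg b) :=
  mkcts (continuous_Cspace (EL (Cspace_cext (@cts_fun _ _ f)))).

Local Notation Cp_op := (Cp_op_of kL).

Lemma Cp_opE f z : Cp_op f z = L (cext f) (val z). Proof. by []. Qed.

Lemma Cp_op_linear : linear Cp_op.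
Proof.
move=> c f g; apply/continuousEP => z.
have cextL : cext (c *: f + g) = fun x => cext g x + c * cext f x.
  apply/funext => x; rewrite /cext; case: insub => [y|]; last by rewrite mulr0 addr0.
  exact: addrC.
rewrite -[LHS]/(L (cext (c *: f + g)) (val z)) cextL (kop_lin _ _ _ kL) addrC.
by [].
Qed.

HB.instance Definition _ := GRing.isLinear.Build R (Cp R (cseg a)) (Cp R (cseg b)) _
  Cp_op Cp_op_linear.

Lemma Cp_op_continuous : continuous Cp_op.
Proof.
apply: Cp_continuousP => z; have [C HC] := kL; have [l [_ lE]] := HC (val z).
rewrite (_ : (fun f => Cp_op f z) = fun f : Cp R _ => \sum_(p <- l) p.1 * cext f p.2); last first.
  by apply/funext => g; rewrite Cp_opE lE.
elim: l {lE} => [|p l IH].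
  have -> : (fun f : Cp R (cseg a) => \sum_(p <- [::]) p.1 * cext f p.2) = fun=> 0.
    by apply/funext => g; rewrite big_nil.
  by move=> f; exact: cvg_cst.
have -> : (fun f : Cp R (cseg a) => \sum_(p <- p :: l) p.1 * cext f p.2) =
    (fun g : Cp R _ => p.1 * cext g p.2 + \sum_(p <- l) p.1 * cext g p.2).
  by apply/funext => g; rewrite big_cons.
move=> f; apply: cvgD; last exact: IH.
apply: cvgMr; rewrite /cext; case: insub => [y|]; last exact: cvg_cst.
exact: Cp_eval_continuous.
Qed.

End Operator.

Lemma iso_Cp a b : iso (@Cspace R a) (@Cspace R b) -> Cp_isomorphic R (cseg a) (cseg b).
Proof.
move=> [L [L' [[kL EL] [kL' EL'] K K']]].
exists (Cp_op_of EL kL), (Cp_op_of EL' kL'); split.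
- exact: Cp_op_continuous.
- exact: Cp_op_continuous.
- move=> f; apply/continuousEP => z; rewrite Cp_opE // cextK; last exact/EL/Cspace_cext/cts_fun.
  by rewrite K ?cextE//; apply: Cspace_cext; exact: cts_fun.
- move=> f; apply/continuousEP => z; rewrite Cp_opE // cextK; last exact/EL'/Cspace_cext/cts_fun.
  by rewrite K' ?cextE//; apply: Cspace_cext; exact: cts_fun.
Qed.

Section Composition.
Variables (X Z : topologicalType) (h : Z -> X).
Hypothesis ch : continuous h.

Fact Cp_comp_subproof (f : Cp R X) : continuous (fun z => f (h z)).
Proof. by move=> z; apply: (@continuous_comp _ _ _ h f z); [exact: ch|exact: (@cts_fun _ _ f)]. Qed.

Definition Cp_comp (f : Cp R X) : Cp R Z := mkcts (@Cp_comp_subproof f).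

Lemma Cp_comp_linear : linear Cp_comp.
Proof. by move=> c f g; apply/continuousEP. Qed.

HB.instance Definition _ := GRing.isLinear.Build R (Cp R X) (Cp R Z) _ Cp_comp Cp_comp_linear.

Lemma Cp_comp_continuous : continuous Cp_comp.
Proof. by apply: Cp_continuousP => z; exact: Cp_eval_continuous. Qed.

End Composition.

End Glue.

(** * Countable compact spaces are ordinal intervals *)

Section MazurkiewiczSierpinski.
Variable Y : topologicalType.
Implicit Types (U V W N : set Y) (y z : Y).

(** [h] is a homeomorphism from the subspace [V] onto the interval (0, b]. *)
Record isord_by V (b : cord) (h : Y -> cord) : Prop := IsordBy {
  isord_in : forall z, V z -> cord0 < h z <= b;
  isord_inj : forall y z, V y -> V z -> h y = h z -> y = z;
  isord_surj : forall x, cord0 < x <= b -> exists2 z, V z & h z = x;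
  isord_cont : forall z a, V z -> a < h z ->
    nbhs z [set z' | V z' -> a < h z' <= h z];
  isord_open : forall z N, V z -> nbhs z N ->
    exists2 a, a < h z & forall z', V z' -> a < h z' <= h z -> N z' }.

Definition isord V := exists b h, isord_by V b h.

Lemma isord_set0 V : (forall z, ~ V z) -> isord V.
Proof.
move=> V0; exists cord0, (fun=> cord0); split=> [z /V0//|y z /V0//| |z a /V0//|z N /V0//].
by move=> x /andP[x0]; rewrite leNgt x0.
Qed.

Lemma clopen_nbhs V z : clopen V -> V z -> nbhs z V.
Proof. by move=> [oV _] Vz; apply: open_nbhs_nbhs. Qed.

Lemma clopenC V : clopen V -> clopen (~` V).
Proof. by move=> [oV cV]; split; [exact: closed_openC|exact: open_closedC]. Qed.

Lemma clopen_setD V W : clopen V -> clopen W -> clopen (V `\` W).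
Proof. by move=> cV cW; rewrite setDE; apply: clopenI => //; exact: clopenC. Qed.

(** The interval of [W] is placed after the interval of [V]. *)
Lemma isordU V W : clopen V -> clopen W -> (forall z, V z -> ~ W z) ->
  isord V -> isord W -> isord (V `|` W).
Proof.
move=> cV cW VW [b [h [hin hinj hsurj hcont hopen]]] [c [k [kin kinj ksurj kcont kopen]]].
pose g z := if `[< V z >] then h z else cadd b (k z).
have gV z : V z -> g z = h z by move=> Vz; rewrite /g asboolT.
have gW z : W z -> g z = cadd b (k z).
  by move=> Wz; rewrite /g asboolF// => Vz; exact: VW Wz.
have gVb z : V z -> g z <= b by move=> Vz; rewrite gV//; case/andP: (hin z Vz).
have gWb z : W z -> b < g z.
  by move=> Wz; rewrite gW// lt_caddl; case/andP: (kin z Wz).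
exists (cadd b c), g; split.
- move=> z [Vz|Wz].
    rewrite (le_trans (gVb _ Vz)) ?le_caddl// andbT gV//.
    by case/andP: (hin z Vz).
  rewrite (le_lt_trans (cord_le0x b)) ?gWb//= gW// cadd_ler.
  by case/andP: (kin z Wz).
- move=> y z [Vy|Wy] [Vz|Wz].
  + by rewrite !gV//; exact: hinj.
  + by move=> E; have := gWb z Wz; rewrite -E ltNge gVb.
  + by move=> E; have := gWb y Wy; rewrite E ltNge gVb.
  + by rewrite !gW// => /caddI; exact: kinj.
- move=> x /andP[x0 xbc]; have [xb|bx] := leP x b.
    have [|z Vz <-] := hsurj x; first by rewrite x0.
    by exists z; [left|rewrite gV].
  have [u xu] := cadd_subK (ltW bx); move: bx xbc.
  rewrite xu lt_caddl cadd_ler => u0 uc; have [|z Wz <-] := ksurj u; first by rewrite u0.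
  by exists z; [right|rewrite gW].
- move=> z a [Vz|Wz] az.
    apply: filterS (filterI (clopen_nbhs cV Vz) (hcont z a Vz _)); last by rewrite -gV.
    by move=> z' [Vz' H] _; rewrite !gV//; exact: H.
  have [d dk ad] : exists2 d, d < k z & a <= cadd b d.
    have [ab|/ltW ba] := leP a b.
      by exists cord0; [case/andP: (kin z Wz)|rewrite caddx0].
    have [d ad] := cadd_subK ba; exists d; last by rewrite ad.
    by move: az; rewrite gW// ad cadd_ltr.
  apply: filterS (filterI (clopen_nbhs cW Wz) (kcont z d Wz dk)).
  move=> z' [Wz' /(_ Wz')/andP[dz zz]] _; rewrite !gW// cadd_ler zz andbT.
  by apply: le_lt_trans ad _; rewrite cadd_ltr.
- move=> z N [Vz|Wz] Nz.
    have [a ah aN] := hopen z N Vz Nz; exists a; first by rewrite gV.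
    move=> z' [Vz'|Wz']; first by rewrite !gV//; exact: aN.
    by move=> /andP[_]; rewrite leNgt (le_lt_trans (gVb _ Vz)) ?gWb.
  have [a ah aN] := kopen z N Wz Nz; exists (cadd b a); first by rewrite gW// cadd_ltr.
  move=> z' [Vz'|Wz'].
    by rewrite ltNge (le_trans (gVb _ Vz') (le_caddl b a)).
  by rewrite !gW// cadd_ltr cadd_ler; exact: aN.
Qed.

Variable e : Y -> nat.
Hypothesis eI : injective e.
(** Compactness, with finite subfamilies described by a bound on the index. *)
Hypothesis cover : forall U : Y -> set Y, (forall y, nbhs y (U y)) ->
  exists n, forall z, exists2 y, (e y < n)%N & U y z.
Hypothesis clopen_sep : forall y z, y <> z -> exists V, [/\ clopen V, V y & ~ V z].

(** Heredity allows to make a finite clopen cover disjoint. *)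
Definition hered V := clopen V /\ forall W, clopen W -> W `<=` V -> isord W.
Definition good y := exists2 V, V y & hered V.

Lemma good_isord V : clopen V -> (forall y, V y -> good y) -> isord V.
Proof.
move=> cV gV.
have /choice[U HU] y : exists U, [/\ clopen U, U y &
    hered U \/ forall z, U z -> ~ V z].
  have [/gV[U Uy hU]|nVy] := pselect (V y).
    by exists U; split=> //; [exact: hU.1|left].
  by exists (~` V); split=> //; [exact: clopenC|right].
have [|n Hn] := @cover U; first by move=> y; have [cU Uy _] := HU y; exact: clopen_nbhs.
suff H k W : clopen W -> W `<=` V ->
    (forall z, W z -> exists2 y, (e y < k)%N & U y z) -> isord W.
  by apply: (H n V) => // z _; exact: Hn.
elim: k W => [|k IH] W cW WV Wk.
  by apply: isord_set0 => z /Wk[y]; rewrite ltn0.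
have [[y ky]|noy] := pselect (exists y, e y = k); last first.
  apply: IH => // z /Wk[y]; rewrite ltnS leq_eqVlt => /orP[/eqP yk|yk Uyz].
    by exfalso; apply: noy; exists y.
  by exists y.
have [cU Uy hU] := HU y.
rewrite -(setUIDK W (U y)) setUC.
apply: isordU; rewrite ?setIDAC.
- exact: clopen_setD.
- exact: clopenI.
- by move=> z [_ nUz] [].
- apply: IH; [exact: clopen_setD|by move=> z [/WV]|].
  move=> z [/Wk[y' + Uy'z] nUz]; rewrite ltnS leq_eqVlt => /orP[/eqP y'k|y'k].
    by exfalso; apply: nUz; rewrite (eI (etrans ky (esym y'k))).
  by exists y'.
- case: hU => [[_ hU]|hU]; first by apply: hU; [exact: clopenI|move=> z []].
  by apply: isord_set0 => z [/WV Vz /hU].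
Qed.

(** A one-point compactification of a sequence of intervals: the intervals are
    placed one after another, and the limit point is sent to the least ordinal
    above all of them. *)
Lemma good_limit U y : clopen U -> U y -> (forall z, U z -> z <> y -> good z) -> good y.
Proof.
move=> cU Uy gU; exists U => //; split=> // V cV VU.
have gV z : V z -> z <> y -> good z by move=> /VU; exact: gU.
have [Vy|nVy] := pselect (V y); last first.
  by apply: good_isord => // z Vz; apply: gV => // zy; rewrite -zy in nVy.
have /choice[C HC] z : exists C, [/\ clopen C, C y & z <> y -> ~ C z].
  have [->|zy] := pselect (z = y); first by exists setT; split=> //; exact: clopenT.
  by have [C [cC Cy Cz]] := clopen_sep (fun yz => zy (esym yz)); exists C.
pose D k := if pselect (exists z, e z = k) is left ez then C (projT1 (cid ez)) else setT.
have DE z : D (e z) = C z.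
  rewrite /D; case: pselect => [ez|[]]; last by exists z.
  by case: cid => z' /= /eI ->.
have Dcl k : clopen (D k) /\ D k y.
  rewrite /D; case: pselect => [ez|_]; last by split=> //; exact: clopenT.
  by have [? ? _] := HC (projT1 (cid ez)).
pose P := fix P n := if n is k.+1 then P k `&` D k else V.
have Pcl n : clopen (P n) /\ P n y.
  by elim: n => [//|n [cP Py]]; have [cD Dy] := Dcl n; split=> //; exact: clopenI.
have Ple m n : (m <= n)%N -> P n `<=` P m.
  move=> /subnK <-; elim: (n - m)%N => [//|k IH] z.
  by rewrite addSn => -[/IH].
have PD z n : (e z < n)%N -> P n `<=` C z.
  by move=> zn x /(Ple _ _ zn)[_]; rewrite DE.
have Pbase N : nbhs y N -> exists n, P n `<=` N.
  move=> Ny; pose W z := if `[< z = y >] then N else ~` C z.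
  have [z|n Hn] := @cover W.
    rewrite /W; case: asboolP => [->//|zy]; have [cC Cy /(_ zy) nCz] := HC z.
    by apply: clopen_nbhs => //; exact: clopenC.
  exists n => z Pz; have [z' /PD PC] := Hn z.
  by rewrite /W; case: asboolP => // _ []; exact: PC.
pose Q n := P n `\` P n.+1.
have Qord n : isord (Q n).
  apply: good_isord; first by apply: clopen_setD; exact: (Pcl _).1.
  move=> z [Pz nPz]; apply: gV; first exact: (Ple 0%N n).
  by move=> zy; apply: nPz; rewrite zy; exact: (Pcl _).2.
have /choice[b /choice[h Hh]] : forall n, exists b, exists h, isord_by (Q n) b h by [].
have QV n z : Q n z -> V z by move=> [/(Ple 0%N n (leq0n n))].
have Qy n : ~ Q n y by move=> [_]; apply; exact: (Pcl _).2.
have Qex z : V z -> z <> y -> exists n, Q n z.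
  move=> Vz zy; have nP : ~ P (e z).+1 z.
    by move=> /(PD z _ (ltnSn _)); have [_ _] := HC z; apply.
  have [n nPn nmin] := ex_minnP (ex_intro (fun n => `[< ~ P n z >]) _ (asboolT nP)).
  case: n nPn nmin => [/asboolP//|n /asboolP nPn nmin]; exists n; split=> //.
  apply: contrapT => nPz; have := nmin n (asboolT nPz).
  by rewrite ltnn.
have Quniq m n z : Q m z -> Q n z -> m = n.
  move=> [Pm nPm] [Pn nPn]; apply/eqP; rewrite eqn_leq; apply/andP; split.
    by rewrite leqNgt; apply/negP => nm; apply: nPn; exact: (Ple _ _ nm).
  by rewrite leqNgt; apply/negP => mn; apply: nPm; exact: (Ple _ _ mn).
pose ix z := xget 0%N [set n | Q n z].
have ixE n z : Q n z -> ix z = n.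
  by move=> Qz; rewrite /ix; case: xgetP => [m _ /Quniq|/(_ n)//]; exact.
pose t := club (psum b).
pose g z := if `[< z = y >] then t else cadd (psum b (ix z)) (h (ix z) z).
have gy : g y = t by rewrite /g asboolT.
have gQ n z : Q n z -> g z = cadd (psum b n) (h n z).
  move=> Qz; rewrite /g asboolF ?(ixE _ _ Qz)// => zy.
  by apply: (@Qy n); rewrite -zy.
have gQlt n z : Q n z -> psum b n < g z <= psum b n.+1.
  move=> Qz; have /andP[h0 hb] := isord_in (Hh n) Qz.
  by rewrite (gQ _ _ Qz) lt_caddl h0 psumS cadd_ler.
have gQt n z : Q n z -> g z < t.
  by move=> /gQlt/andP[_]/le_lt_trans; apply; exact: lt_club.
have Vcase z : V z -> z = y \/ exists n, Q n z.
  by move=> Vz; have [?|/(Qex _ Vz)] := pselect (z = y); [left|right].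
have gP n z : P n z -> psum b n < g z.
  move=> Pz; have [->|[m Qz]] := Vcase z (Ple 0%N n (leq0n n) _ Pz).
    by rewrite gy; exact: lt_club.
  have /andP[mz _] := gQlt _ _ Qz; apply: le_lt_trans mz; apply: psum_le.
  by rewrite leqNgt; apply/negP => mn; apply: Qz.2; exact: (Ple _ _ mn).
exists t, g; split.
- move=> z Vz; have := gP 0%N z Vz => /= ->/=.
  by have [->|[n /gQt/ltW//]] := Vcase z Vz; rewrite gy.
- move=> u v Vu Vv.
  have [->|[m Qu]] := Vcase u Vu; have [->|[n Qv]] := Vcase v Vv => //.
  + by rewrite gy => tv; have := gQt _ _ Qv; rewrite -tv ltxx.
  + by rewrite gy => tv; have := gQt _ _ Qu; rewrite tv ltxx.
  + move=> guv; have mn : m = n.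
      apply/eqP; rewrite eqn_leq -ltnS -[(n <= m)%N]ltnS; apply/andP; split; apply: (@psum_lt_inv b).
        apply: lt_le_trans (_ : g u <= _); first by case/andP: (gQlt _ _ Qu).
        by rewrite guv; case/andP: (gQlt _ _ Qv).
      apply: lt_le_trans (_ : g v <= _); first by case/andP: (gQlt _ _ Qv).
      by rewrite -guv; case/andP: (gQlt _ _ Qu).
    move: guv; rewrite -mn in Qv *; rewrite (gQ _ _ Qu) (gQ _ _ Qv) => /caddI.
    exact: (isord_inj (Hh m)).
- move=> x /andP[x0]; rewrite le_eqVlt => /orP[/eqP ->|xt]; first by exists y.
  have [n xn] : exists n, x <= psum b n.
    apply: contrapT => H; move: xt; rewrite ltNge => /negP; apply.
    apply/club_leP => n; rewrite ltNge; apply/negP => xn.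
    by apply: H; exists n.
  have := xn; elim: n {xn} => [|n IH]; first by rewrite leNgt x0.
  have [/IH//|nx] := leP x (psum b n).
  have [u xu] := cadd_subK (ltW nx); rewrite psumS xu cadd_ler => ub.
  have [|z Qz hz] := isord_surj (Hh n) (x := u).
    by rewrite ub andbT; move: nx; rewrite xu lt_caddl.
  by exists z; [exact: QV Qz|rewrite (gQ _ _ Qz) hz].
- move=> z a Vz az; have [zy|[n Qz]] := Vcase z Vz.
    have [n an] : exists n, a <= psum b n.
      apply: contrapT => H; move: az; rewrite zy gy ltNge => /negP; apply.
      apply/club_leP => n; rewrite ltNge; apply/negP => an.
      by apply: H; exists n.
    rewrite zy; apply: filterS (clopen_nbhs (Pcl n).1 (Pcl n).2).
    move=> z' /gP Hz' Vz'; rewrite (le_lt_trans an Hz') gy /=.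
    by have [->|[m /gQt/ltW//]] := Vcase z' Vz'; rewrite gy.
  have [d dh ad] : exists2 d, d < h n z & a <= cadd (psum b n) d.
    have [ab|/ltW ba] := leP a (psum b n).
      by exists cord0; [case/andP: (isord_in (Hh n) Qz)|rewrite caddx0].
    have [d ad] := cadd_subK ba; exists d; last by rewrite ad.
    by move: az; rewrite (gQ _ _ Qz) ad cadd_ltr.
  have cQ : clopen (Q n) by apply: clopen_setD; exact: (Pcl _).1.
  apply: filterS (filterI (clopen_nbhs cQ Qz) (isord_cont (Hh n) Qz dh)).
  move=> z' [Qz' /(_ Qz')/andP[dz zz]] _; rewrite (gQ _ _ Qz) (gQ _ _ Qz') cadd_ler zz andbT.
  by apply: le_lt_trans ad _; rewrite cadd_ltr.
- move=> z N Vz Nz; have [zy|[n Qz]] := Vcase z Vz.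
    have [n PN] : exists n, P n `<=` N by apply: Pbase; rewrite -zy.
    exists (psum b n); first by rewrite zy gy; exact: lt_club.
    move=> z' Vz' /andP[nz _]; apply: PN.
    have [->|[m Qz']] := Vcase z' Vz'; first exact: (Pcl n).2.
    apply: (Ple n m); last exact: Qz'.1.
    rewrite -ltnS; apply: (@psum_lt_inv b); apply: lt_le_trans nz _.
    by case/andP: (gQlt _ _ Qz').
  have [a ah aN] := isord_open (Hh n) Qz Nz.
  exists (cadd (psum b n) a); first by rewrite (gQ _ _ Qz) cadd_ltr.
  move=> z' Vz' /andP[az' zz'].
  have [zy|[m Qz']] := Vcase z' Vz'.
    by move: zz'; rewrite zy gy leNgt (gQt _ _ Qz).
  have mn : m = n.
    apply/eqP; rewrite eqn_leq -ltnS -[(n <= m)%N]ltnS; apply/andP; split; apply: (@psum_lt_inv b).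
      apply: lt_le_trans (_ : g z' <= _); first by case/andP: (gQlt _ _ Qz').
      by apply: le_trans zz' _; case/andP: (gQlt _ _ Qz).
    apply: le_lt_trans (le_caddl _ a) _; apply: lt_le_trans az' _.
    by case/andP: (gQlt _ _ Qz').
  move: az' zz'; rewrite mn in Qz'; rewrite (gQ _ _ Qz) (gQ _ _ Qz') cadd_ltr cadd_ler => ? ?.
  by apply: aN => //; apply/andP.
Qed.

(** Otherwise the bad points form a nonempty set without isolated points; then
    shrinking clopen sets that meet it can avoid every point of the space in turn,
    against compactness. *)
Theorem isord_setT : isord setT.
Proof.
apply: good_isord; first exact: clopenT.
apply: contrapT => /existsNP[y0 /not_implyP[_ bad0]].
have step (W : set Y) p : clopen W /\ (exists2 z, W z & ~ good z) ->
    exists W', [/\ W' `<=` W, ~ W' p & clopen W' /\ exists2 z, W' z & ~ good z].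
  move=> [cW [z Wz bz]].
  have [z' [Wz' bz' z'p]] : exists z', [/\ W z', ~ good z' & z' <> p].
    have [zp|zp] := pselect (z = p); last by exists z.
    apply: contrapT => H; apply: bz; apply: (good_limit cW Wz) => z' Wz' z'z.
    by apply: contrapT => bz'; apply: H; exists z'; split=> //; rewrite -zp.
  have [C [cC Cz' Cp]] := clopen_sep z'p; exists (W `&` C); split.
  - by move=> x [].
  - by case.
  - by split; [exact: clopenI|exists z'].
pose S := {W : set Y | clopen W /\ exists2 z, W z & ~ good z}.
have /choice[nxt Hnxt] (Wp : S * Y) : exists W' : S,
    sval W' `<=` sval Wp.1 /\ ~ sval W' Wp.2.
  have [W' [WW' W'p HW']] := step _ Wp.2 (svalP Wp.1).
  by exists (exist _ W' HW').
have HT : clopen [set: Y] /\ exists2 z, [set: Y] z & ~ good z.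
  by split; [exact: clopenT|exists y0].
pose pt k := xget y0 [set z | e z = k].
have ptE z : pt (e z) = z by rewrite /pt; case: xgetP => [z' _ /eI//|/(_ z) []].
pose W := fix W n : S := if n is k.+1 then nxt (W k, pt k) else exist _ setT HT.
have Wle m n : (m <= n)%N -> sval (W n) `<=` sval (W m).
  move=> /subnK <-; elim: (n - m)%N => [//|k IH] z.
  by rewrite addSn => /(Hnxt (_, _)).1/IH.
have [|n Hn] := @cover (fun z => ~` sval (W (e z).+1)).
  move=> z; apply: clopen_nbhs; first by apply: clopenC; exact: (svalP (W _)).1.
  by have := (Hnxt (W (e z), pt (e z))).2; rewrite /= {2}ptE.
have [_ [z Wz _]] := svalP (W n).
by have [z' /Wle z'n] := Hn z; apply; exact: z'n.
Qed.

End MazurkiewiczSierpinski.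

(** * Linear continuous surjections from C_p([1, a]) *)

Section Surjection.
Variables (R : realType) (a : cord) (Y : topologicalType).
Let X := cseg a.
Variable T : {linear Cp R X -> Cp R Y}.
Hypothesis cT : continuous T.

Lemma CpDE (f g : Cp R X) c x : (f + c *: g) x = f x + c * g x.
Proof. by []. Qed.

(** By induction on s: if some e vanishing on the tail of s has phi e != 0, then
    e z != 0, and a multiple of the evaluation at z can be subtracted from phi. *)
Lemma vanishing_rep (s : seq X) (phi : Cp R X -> R) :
  (forall f g c, phi (f + c *: g) = phi f + c * phi g) ->
  (forall f : Cp R X, (forall x, x \in s -> f x = 0) -> phi f = 0) ->
  exists l : seq (R * X), forall f, phi f = \sum_(p <- l) p.1 * f p.2.
Proof.
elim: s phi => [|z s IH] phi phiL phi0.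
  by exists [::] => f; rewrite big_nil; exact: phi0.
have [|] := pselect (forall f : Cp R X, (forall x, x \in s -> f x = 0) -> phi f = 0).
  exact: IH.
move=> /existsNP[e /not_implyP[es /eqP ephi]].
have ez : e z != 0.
  apply: contra_neq ephi => ez; apply: phi0 => x; rewrite inE => /orP[/eqP ->//|].
  exact: es.
have [|f fs|l lE] := IH (fun f => phi f - f z / e z * phi e).
- by move=> f g c; rewrite phiL CpDE; field.
- have : phi (f + (- (f z / e z)) *: e) = 0.
    apply: phi0 => x; rewrite inE CpDE => /orP[/eqP ->|xs]; first by field.
    by rewrite (fs x)// (es x)// mulr0 addr0.
  by rewrite phiL mulNr.
exists ((phi e / e z, z) :: l) => f; rewrite big_cons -lE /=; field.
exact: ez.
Qed.

(** Otherwise there are functions f_n that vanish at the first n points of the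
    countable space [1, a] and satisfy T f_n y = 1; they tend pointwise to 0. *)
Lemma finite_support y :
  exists l : seq (R * X), forall f, T f y = \sum_(p <- l) p.1 * f p.2.
Proof.
have TL f g c : T (f + c *: g) y = T f y + c * T g y.
  by rewrite addrC linearP addrC.
have /countable_injP[h hI] := cseg_countable a.
have {}hI : injective h by move=> u v; apply: hI; rewrite inE.
suff [n Hn] : exists n, forall f : Cp R X, (forall x, (h x < n)%N -> f x = 0) -> T f y = 0.
  have hIn : {in h @^-1` `I_n &, injective h} by move=> u v _ _; exact: hI.
  have /finite_seqP[s sE] := finite_preimage hIn (finite_II n).
  apply: (vanishing_rep (s := s)) => // f fs; apply: Hn => x xn; apply: fs.
  by have : (h @^-1` `I_n) x by []; rewrite sE.
apply: contrapT => /forallNP H.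
have /choice[f Hf] n : exists f : Cp R X, (forall x, (h x < n)%N -> f x = 0) /\ T f y = 1.
  have /existsNP[f /not_implyP[f0 /eqP Tf]] := H n.
  exists ((T f y)^-1 *: f); split=> [x xn|].
    by rewrite -[LHS]/((T f y)^-1 * f x) f0// mulr0.
  by rewrite linearZ -[LHS]/((T f y)^-1 * T f y) mulVf.
have f0 : f @ \oo --> (0 : Cp R X).
  apply/Cp_cvgP => x; apply: cvg_near_cst.
  by exists (h x).+1 => // n /= xn; apply: (Hf n).1.
have : (fun n => T (f n) y) @ \oo --> T 0 y.
  have cTy : continuous (fun f => T f y).
    move=> g; apply: (@continuous_comp _ _ _ T (fun k : Cp R Y => k y) g).
      exact: cT.
    exact: Cp_eval_continuous.
  exact: (@cvg_comp _ _ _ f (fun f => T f y) _ _ _ f0 (cTy 0)).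
have -> : T 0 y = 0 by rewrite linear0.
rewrite (_ : (fun n => _) = fun=> 1); last by apply/funext => n; exact: (Hf n).2.
move=> c1; have /eqP : 1 = 0 :> R.
  by apply: (cvg_unique _ _ c1); [exact: norm_hausdorff|exact: cvg_cst].
by rewrite oner_eq0.
Qed.

(** The image of the point evaluation at y under the adjoint of T, extended by 0 to
    discontinuous functions to fit the uniform boundedness principle. *)
Definition adj y (f : X -> R) : R :=
  if pselect (continuous f) is left cf then T (mkcts cf) y else 0.

Lemma adjE y (f : Cp R X) : adj y f = T f y.
Proof.
rewrite /adj; case: pselect => [cf|[]]; last exact: cts_fun.
by congr (T _ y); apply/continuousEP.
Qed.

Lemma adj_rep y : exists l : seq (R * X),
  forall f, continuous f -> adj y f = \sum_(p <- l) p.1 * f p.2.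
Proof.
have [l lE] := finite_support y; exists l => f cf.
by rewrite -(lE (mkcts cf)) -adjE.
Qed.

Lemma adj_lin y : lin_on (adj y).
Proof.
move=> f g c [cf _] [cg _]; have [l lE] := adj_rep y.
rewrite !lE//; last exact: continuous_lin.
by rewrite mulr_sumr -big_split /=; apply: eq_bigr => p _; ring.
Qed.

Lemma adj_bounded y : exists2 K, 0 <= K & forall f, ball1 f -> `|adj y f| <= K.
Proof.
have [l lE] := adj_rep y; exists (\sum_(p <- l) `|p.1|); first exact: sumr_ge0.
move=> f [cf f1]; rewrite lE//; apply: le_trans (ler_norm_sum _ _ _) _.
by apply: ler_sum => p _; rewrite normrM ler_piMr.
Qed.

Hypothesis sT : forall g, exists f, T f = g.
Hypothesis Ytych : tychonoff_space Y.

Lemma adj_surj (g : Y -> R) : continuous g ->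
  exists f, continuous f /\ forall y, adj y f = g y.
Proof.
move=> cg; have [f Tf] := sT (mkcts cg); exists f; split; first exact: cts_fun.
by move=> y; rewrite adjE Tf.
Qed.

Lemma tychonoff_fun y (N : set Y) : nbhs y N -> exists f : Y -> R,
  [/\ continuous f, forall z, 0 <= f z <= 1, f y = 1 & forall z, ~ N z -> f z = 0].
Proof.
move=> Ny; have cC : closed (~` N^°) by apply: open_closedC; exact: open_interior.
have /(@uniform_separatorP _ R)[f [cf f01 f0 f1]] : uniform_separator [set y] (~` N^°).
  by apply: Ytych.1 => //; apply.
exists (fun z => 1 - f z); split.
- by move=> z; apply: cvgB; [exact: cvg_cst|exact: cf].
- move=> z; have := f01 (f z) (ex_intro2 _ _ z I erefl); rewrite /= in_itv /= => /andP[? ?].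
  by apply/andP; split; lra.
- by rewrite (f0 (f y))/= ?subr0//; exists y.
- by move=> z Nz; rewrite (f1 (f z))/= ?subrr//; exists z => // /interior_subset.
Qed.

Lemma hausdorff_nbhs (y z : Y) : y <> z -> nbhs y (~` [set z]).
Proof.
move=> yz; apply: open_nbhs_nbhs; split; last by [].
apply: closed_openC; apply: accessible_closed_set1; exact: hausdorff_accessible Ytych.2.
Qed.

(** Otherwise suitable functionals n (d_y - d_z) would be pointwise bounded on C_b(Y),
    as every function there is some T f, without being uniformly bounded. *)
Lemma adj_sep : exists2 c, 0 < c & forall y z, y <> z ->
  exists f, [/\ continuous f, forall x, `|f x| <= 1 & c <= adj y f - adj z f].
Proof.
apply: contrapT => H.
have /choice[yz Hyz] n : exists yz : Y * Y, yz.1 <> yz.2 /\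
    forall f, ball1 f -> adj yz.1 f - adj yz.2 f < n.+1%:R^-1.
  apply: contrapT => Hn; apply: H; exists n.+1%:R^-1; first by rewrite invr_gt0.
  move=> y z yz; apply: contrapT => Hf; apply: Hn; exists (y, z); split=> // f [cf f1].
  by rewrite ltNge; apply/negP => cle; apply: Hf; exists f.
pose psi n (g : Y -> R) : R := n.+1%:R * (g (yz n).1 - g (yz n).2).
have [n|n|g [cg _]|M HM] := @uniform_boundedness R Y nat psi.
- by move=> f g c _ _; rewrite /psi; ring.
- exists (n.+1%:R * (1 + 1)) => f [_ f1]; rewrite normrM ger0_norm//.
  by rewrite ler_wpM2l//; apply: le_trans (ler_normB _ _) _; exact: lerD.
- have [f [cf fE]] := adj_surj cg; have [C C0 HC] := cseg_bounded cf.
  exists C => n; rewrite /psi -!fE normrM ger0_norm// mulrC -ler_pdivlMr//.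
  have bf : bcont f by split=> //; exists C.
  pose delta n f : R := adj (yz n).1 f - adj (yz n).2 f.
  have dL : lin_on (delta n).
    by move=> u v k bu bv; rewrite /delta !adj_lin//; ring.
  rewrite -/(delta n f) mulrC; apply: lin_on_scale => // u bu.
  have b' := ball1N bu.
  have := (Hyz n).2 _ bu; have := (Hyz n).2 _ b'.
  have N w : adj w (fun x => - u x) = - adj w u.
    have := lin_onZ (@adj_lin w) (-1) (ball1_bcont bu).
    by under eq_fun do rewrite mulN1r; rewrite mulN1r.
  rewrite !N /delta ler_norml; move: n.+1%:R^-1 => d ? ?.
  by apply/andP; split; lra.
pose n := Num.bound `|M|.
have [g [cg g01 gy gz]] := tychonoff_fun (hausdorff_nbhs (Hyz n).1).
have bg : ball1 g.
  by split=> // z; have /andP[g0 g1] := g01 z; rewrite ger0_norm.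
have := HM n g bg; rewrite /psi gy (gz _ (fun H => H erefl)) subr0 mulr1 ger0_norm//.
have := archi_boundP (normr_ge0 M); rewrite -/n -natr1; have := ler_norm M; lra.
Qed.

(** Finite combinations of evaluations are approximated in norm by the countably many
    ones with rational coefficients, and one of these cannot be closer than c / 2 to
    two functionals at distance c. *)
Lemma countable_range : exists e : Y -> nat, injective e.
Proof.
have [c c0 Hc] := adj_sep.
have approx (l : seq (R * X)) d : 0 < d -> exists k : seq (rat * X),
    forall f : X -> R, (forall x, `|f x| <= 1) ->
      `|\sum_(p <- l) p.1 * f p.2 - \sum_(p <- k) ratr p.1 * f p.2| < d.
  elim: l d => [|[r x] l IH] d d0.
    by exists [::] => f _; rewrite !big_nil subrr normr0.
  have d2 : 0 < d / 2 by rewrite divr_gt0.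
  have [k Hk] := IH _ d2.
  have [q] : exists q : rat, ratr q \in `]r - d / 2, r + d / 2[.
    by apply: rat_in_itvoo; lra.
  rewrite in_itv /= => /andP[q1 q2].
  exists ((q, x) :: k) => f f1; rewrite !big_cons /= [d]splitr opprD addrACA -mulrBl.
  apply: le_lt_trans (ler_normD _ _) _; apply: ler_ltD; last exact: Hk.
  rewrite normrM -[leRHS]mulr1; apply: ler_pM => //.
  by rewrite ler_norml; apply/andP; split; lra.
have /choice[k Hk] y : exists k : seq (rat * X), forall f, ball1 f ->
    `|adj y f - \sum_(p <- k) ratr p.1 * f p.2| < c / 2.
  have [l lE] := adj_rep y; have [k Hk] := approx l _ (divr_gt0 c0 (ltr0Sn _ 1)).
  by exists k => f [cf f1]; rewrite lE//; exact: Hk.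
have /countable_injP[h hI] := cseg_countable a.
have {}hI : injective h by move=> u v; apply: hI; rewrite inE.
exists (fun y => pickle [seq (p.1, h p.2) | p <- k y]) => y z.
move=> /(pcan_inj pickleK)/(@inj_map _ _ _ _) kyz.
have {}kyz : k y = k z by apply: kyz => -[q x] [q' x'] [-> /hI ->].
apply: contrapT => yz; have [f [cf f1 cle]] := Hc y z yz.
have b1 : ball1 f by split.
have := Hk y f b1; have := Hk z f b1; rewrite kyz !ltr_norml => /andP[? ?] /andP[? ?].
by move: cle; rewrite leNgt => /negP; apply; lra.
Qed.

(** An unbounded function on Y, composed with a sufficiently fast growing function,
    would not be in the image of T, since each functional f |-> T f y is bounded. *)
Lemma pseudocompact_range (g : Y -> R) : continuous g -> exists C, forall y, `|g y| <= C.
Proof.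
move=> cg; apply: contrapT => H.
have /choice[y Hy] n : exists y, n.+1%:R <= `|g y|.
  apply: contrapT => Hn; apply: H; exists n.+1%:R => z.
  by rewrite leNgt; apply/negP => /ltW gz; apply: Hn; exists z.
have /choice[K HK] z : exists K, 0 <= K /\ forall f, ball1 f -> `|adj z f| <= K.
  by have [K K0 HK] := adj_bounded z; exists K.
pose b n : R := n.+1%:R * (K (y n) + 1).
have b0 n : 0 <= b n by rewrite mulr_ge0// addr_ge0// (HK _).1.
pose S n z : R := \sum_(k < n) b k * Num.max 0 (`|g z| - k%:R).
have cS n : continuous (S n).
  elim: n => [|n IH].
    have -> : S 0%N = fun=> 0 by apply/funext => z; rewrite /S big_ord0.
    by move=> z; exact: cvg_cst.
  have -> : S n.+1 = fun z => S n z + b n * Num.max 0 (`|g z| - n%:R).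
    by apply/funext => z; rewrite /S big_ord_recr.
  apply: continuous_lin => //.
  apply: (@max_fun_continuous _ Y R (fun=> 0) (fun z => `|g z| - n%:R)) => z.
    exact: cvg_cst.
  by apply: cvgB; [apply: cvg_norm; exact: cg|exact: cvg_cst].
have Sstab m n z : `|g z| <= m%:R -> (m <= n)%N -> S n z = S m z.
  move=> gm /subnK <-; elim: (n - m)%N => [//|k IH].
  rewrite addSn -IH /S big_ord_recr /= [X in _ + X](_ : _ = 0) ?addr0//.
  rewrite (_ : Num.max 0 _ = 0) ?mulr0//; apply/max_idPl.
  by rewrite subr_le0; apply: le_trans gm _; rewrite ler_nat leq_addl.
pose N z := Num.bound `|g z|.
have HN z : `|g z| < (N z)%:R by apply: archi_boundP.
pose G z := S (N z) z.
have cG : continuous G.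
  apply/continuous_realP => z e e0.
  have /continuous_realP/(_ z e e0) := cS (N z).
  have g1 : \forall w \near z, `|g w| < (N z)%:R.
    have /cvg_norm/cvgrPdist_lt := cg z => /(_ ((N z)%:R - `|g z|)).
    rewrite subr_gt0 HN => /(_ isT); apply: filterS => w.
    by rewrite ltr_norml => /andP[? ?]; lra.
  apply: filterS2 g1 => w gw; rewrite /G.
  suff -> : S (N w) w = S (N z) w by [].
  have [Nwz|/ltnW Nzw] := leqP (N w) (N z).
    by rewrite (Sstab (N w) (N z))// ltW.
  by rewrite (Sstab (N z) (N w))// ltW.
have Gy n : b n <= G (y n).
  have nN : (n < N (y n))%N.
    rewrite -(ltr_nat R); apply: le_lt_trans (HN _); apply: le_trans (Hy n).
    by rewrite ler_nat.
  rewrite /G /S (bigD1 (Ordinal nN)) //=.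
  apply: le_trans (_ : b n * Num.max 0 (`|g (y n)| - n%:R) <= _).
    rewrite ler_peMr//; apply: le_trans (_ : `|g (y n)| - n%:R <= _).
      by have := Hy n; rewrite -natr1; lra.
    by rewrite le_max lexx orbT.
  rewrite lerDl; apply: sumr_ge0 => i _; rewrite mulr_ge0// le_max lexx //.
have [f [cf fE]] := adj_surj cG; have [C C0 HC] := cseg_bounded cf.
have bound n : n.+1%:R <= C.
  have [K0 HKn] := HK (y n).
  have := lin_on_scale (@adj_lin (y n)) C0 cf HC HKn.
  rewrite fE => /(le_trans (ler_norm _))/(le_trans (Gy n)); rewrite /b => H1.
  have K1 : 0 < K (y n) + 1 by rewrite ltr_wpDl.
  rewrite -(ler_pM2r K1); apply: le_trans H1 _.
  by rewrite mulrC ler_pM2l// lerDl.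
have := bound (Num.bound `|C|); have := archi_boundP (normr_ge0 C).
have := ler_norm C; rewrite -natr1; lra.
Qed.

(** Let F k be a Urysohn function for the neighbourhood of the k-th point. The sum G
    of 4^-k F k is positive everywhere, and since 1 / G is bounded by
    pseudocompactness, G has a positive lower bound; then already a partial sum is
    positive everywhere. *)
Lemma compact_range (e : Y -> nat) (U : Y -> set Y) : injective e ->
  (forall y, nbhs y (U y)) ->
  exists n, forall z, exists2 y, (e y < n)%N & U y z.
Proof.
move=> eI HU.
have /choice[f Hf] y := tychonoff_fun (HU y).
pose F k : Y -> R := if pselect (exists y, e y = k) is left ey then f (projT1 (cid ey)) else fun=> 0.
have FE y : F (e y) = f y.
  by rewrite /F; case: pselect => [ey|[]]; [case: cid => y' /= /eI ->|exists y].
have F01 k : continuous (F k) /\ forall z, 0 <= F k z <= 1.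
  rewrite /F; case: pselect => [ey|_]; first by have [? ? _ _] := Hf (projT1 (cid ey)).
  by split=> [z|z]; [exact: cvg_cst|rewrite lexx ler01].
have FU k z : 0 < F k z -> exists2 y, e y = k & U y z.
  rewrite /F; case: pselect => [ey|_]; last by rewrite ltxx.
  case: cid => y /= yk fz; exists y => //; apply: contrapT => nU.
  by have [_ _ _ f0] := Hf y; move: fz; rewrite f0// ltxx.
pose S := fix S n := if n is k.+1 then fun z => S k z + 4 ^- k * F k z else fun _ : Y => 0 : R.
have [|n z|G [cG HG]] := @geo_limit R Y S.
- elim=> [|n IH]; first by move=> z; exact: cvg_cst.
  exact: continuous_lin IH (F01 n).1.
- rewrite /= addrAC subrr add0r normrM ger0_norm ?invr_ge0 ?exprn_ge0//.
  have /andP[F0 F1] := (F01 n).2 z.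
  by rewrite ger0_norm// ler_piMr// invr_ge0 exprn_ge0.
have Smono n k z : S n z <= S (k + n)%N z.
  elim: k => [//|k IH]; apply: le_trans IH _; rewrite addSn /= lerDl.
  by have /andP[F0 _] := (F01 (k + n)%N).2 z; rewrite mulr_ge0// invr_ge0 exprn_ge0.
have small (d : R) : 0 < d -> exists n, 4 / 3 * 4 ^- n < d.
  move=> d0; exists (Num.bound (4 / d)); set m := Num.bound _.
  have mE : 4 / d < m%:R by apply: archi_boundP; rewrite divr_ge0// ltW.
  have m4 : m%:R <= 4 ^+ m :> R by rewrite -natrX ler_nat ltnW// ltn_expl.
  rewrite ltr_pdivrMr ?exprn_gt0//.
  by have := lt_le_trans mE m4; rewrite ltr_pdivrMr// => H; lra.
have SG n z : S n z <= G z.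
  rewrite leNgt; apply/negP => lt1.
  have [k kE] := small (S n z - G z) ltac:(by rewrite subr_gt0).
  have := HG (k + n)%N z; have := Smono n k z.
  have : 4 / 3 * 4 ^- (k + n) <= 4 / 3 * 4 ^- k :> R.
    rewrite ler_pM2l ?divr_gt0// lef_pV2 ?posrE ?exprn_gt0//.
    by rewrite ler_weXn2l ?leq_addr// ler1n.
  by rewrite ler_norml => ? ? /andP[? ?]; lra.
have G0 z : 0 < G z.
  apply: lt_le_trans (SG (e z).+1 z); rewrite /= ltr_wpDl//.
    by have := Smono 0%N (e z) z; rewrite addn0.
  rewrite FE; have [_ _ -> _] := Hf z.
  by rewrite mulr1 invr_gt0 exprn_gt0.
have [C HC] : exists C, forall z, `|(G z)^-1| <= C.
  by apply: pseudocompact_range => z; apply: cvgV; [rewrite gt_eqF|exact: cG].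
have [Y0|/existsNP[y0 _]] := pselect (Y -> False); first by exists 0%N => z; case: (Y0 z).
have C0 : 0 < C by apply: lt_le_trans (HC y0); rewrite normr_gt0 invr_eq0 gt_eqF.
have [n nE] := small C^-1 ltac:(by rewrite invr_gt0).
exists n => z.
have GC : C^-1 <= G z.
  rewrite -[G z]invrK lef_pV2 ?posrE ?invr_gt0//.
  by apply: le_trans (HC z); exact: ler_norm.
have S0 : 0 < S n z by have := HG n z; rewrite ler_norml => /andP[? ?]; lra.
have [k kn Fk] : exists2 k, (k < n)%N & 0 < F k z.
  apply: contrapT => H; move: S0.
  suff -> : S n z = 0 by rewrite ltxx.
  have : forall k, (k < n)%N -> F k z = 0.
    move=> k kn; apply/eqP; rewrite eq_le; have /andP[-> _] := (F01 k).2 z.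
    by rewrite andbT leNgt; apply/negP => Fk; apply: H; exists k.
  elim: n {nE H} => [//|n IH] Hk /=; rewrite IH ?Hk ?mulr0 ?addr0// => k kn.
  by apply: Hk; exact: ltnW.
by have [y yk Uyz] := FU _ _ Fk; exists y; rewrite ?yk.
Qed.

Lemma countable_gap (A : set R) : countable A -> exists2 r, 0 < r < 1 & ~ A r.
Proof.
move=> cA; apply: contrapT => H.
have : countable (`]0, 1[%classic : set R).
  apply: sub_countable cA; apply: subset_card_le => r; rewrite /= in_itv /= => r01.
  by apply: contrapT => Ar; apply: H; exists r.
move=> /countable_lebesgue_measure0; rewrite lebesgue_measure_itv /= lte_fin ltr01.
by rewrite oppr0 adde0 => /eqP; rewrite eqe oner_eq0.
Qed.

(** A continuous function on a countable space omits a value between 0 and 1. *)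
Lemma clopen_separation (e : Y -> nat) y z : injective e -> y <> z ->
  exists V : set Y, [/\ clopen V, V y & ~ V z].
Proof.
move=> eI yz; have [f [cf f01 fy fz]] := tychonoff_fun (hausdorff_nbhs yz).
have cY : countable [set: Y] by apply/countable_injP; exists e => u v _ _; exact: eI.
have [r /andP[r0 r1] nr] := countable_gap (sub_countable (card_image_le f setT) cY).
exists (f @^-1` [set t | r < t]); split=> /=.
- split; first by move/continuousP: cf; apply; exact: open_gt.
  rewrite (_ : _ @^-1` _ = f @^-1` [set t | r <= t]).
    by move/continuous_closedP: cf; apply; exact: closed_ge.
  apply/seteqP; split=> w /=; first exact: ltW.
  by rewrite le_eqVlt => /orP[/eqP rw|//]; exfalso; apply: nr; exists w.
- by rewrite fy.
- by rewrite fz//; [move/lt_trans => /(_ _ r0); rewrite ltxx|apply].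
Qed.

Theorem ordinal_range : exists b h, isord_by [set: Y] b h.
Proof.
have [e eI] := countable_range; apply: (isord_setT eI).
  by move=> U; exact: compact_range.
by move=> y z; exact: clopen_separation eI.
Qed.

(** The norm of T is finite by uniform boundedness; pseudocompactness of Y provides
    the pointwise bounds. *)
Lemma isord_separates b h : isord_by [set: Y] b h -> separates R a b.
Proof.
move=> [hin hinj hsurj hcont hopen]; have [c c0 Hc] := adj_sep.
have [y|y|f [cf _]|M HM] := @uniform_boundedness R X Y adj.
- exact: adj_lin.
- by have [K _ HK] := adj_bounded y; exists K.
- have [C HC] := pseudocompact_range (@cts_fun _ _ (T (mkcts cf))).
  by exists C => y; have := HC y; rewrite -adjE.
pose k x : option Y := if pselect (exists2 y, setT y & h y = x) is left hx
  then Some (s2val (cid2 hx)) else None.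
have kE y : k (h y) = Some y.
  rewrite /k; case: pselect => [hx|[]]; last by exists y.
  by case: cid2 => y' _ /= /(hinj _ _ I I) ->.
exists (fun F x => if k x is Some y then adj y (fun z : X => F (val z)) else 0), M, c.
have E1 (F : cord -> R) : Cspace a F -> (forall x, `|F x| <= 1) -> ball1 (fun z : X => F (val z)).
  by move=> EF F1; split=> //; exact: continuous_Cspace.
split=> // [f g s x Ef Eg xb|f x Ef xb|f x Ef f1 xb|x z xb zb xz].
- have [y _ <-] := hsurj x xb; rewrite !kE.
  have bf (F : cord -> R) : Cspace a F -> bcont (fun z : X => F (val z)).
    move=> EF; split; first exact: continuous_Cspace.
    by have [C _ HC] := Cspace_bounded EF; exists C.
  exact: (@adj_lin y _ _ _ (bf _ Ef) (bf _ Eg)).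
- have [y _ hy] := hsurj x xb; rewrite -hy => e e0.
  have cf := continuous_Cspace Ef.
  have /continuous_realP/(_ y e e0) : continuous (T (mkcts cf)) by exact: cts_fun.
  move=> /(hopen y _ I)[d dh dN]; exists d => // z /andP[dz zy].
  have [|w _ hw] := hsurj z.
    by rewrite (le_lt_trans (cord_le0x d))//=; apply: le_trans zy _; case/andP: (hin y I).
  have := dN w I; rewrite /= hw dz zy => /(_ isT).
  by rewrite -hw !kE -!adjE distrC.
- have [y _ <-] := hsurj x xb; rewrite kE; apply: HM; exact: E1.
- have [y _ hy] := hsurj x xb; have [w _ hw] := hsurj z zb.
  have yw : y <> w by move=> yw; apply: xz; rewrite -hy -hw yw.
  have [f [cf f1 cle]] := Hc y w yw; exists (cext f); split.
  + exact: Cspace_cext.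
  + by move=> u; rewrite /cext; case: insub => [v|]; rewrite ?normr0.
  + have fE : (fun z : X => cext f (val z)) = f by apply/funext => v; rewrite cextE.
    by rewrite -hy -hw !kE fE.
Qed.

End Surjection.

Lemma isord_homeomorphic (Y : topologicalType) b h :
  isord_by [set: Y] b h -> homeomorphic Y (cseg b).
Proof.
move=> [hin hinj hsurj hcont hopen].
have /choice[f Hf] y : exists z : cseg b, val z = h y by apply: cseg_in; exact: hin.
have /choice[g Hg] z : exists y : Y, h y = val (z : cseg b).
  by have [y _ hy] := hsurj (val z) (cseg_inP z); exists y.
exists f, g; split.
- move=> y A /cseg_nbhs[a ay aA]; rewrite Hf in ay.
  apply: filterS (hcont y a I ay) => z /(_ I) Hz; apply: aA.
  by rewrite !Hf.
- move=> z N /hopen[//|a az aN]; apply/cseg_nbhs; rewrite Hg in az.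
  by exists a => // w Hw; apply: aN => //; rewrite !Hg.
- by move=> y; apply: hinj => //; rewrite Hg Hf.
- by move=> z; apply: val_inj; rewrite Hf Hg.
Qed.

Lemma continuous_cseg_incl a b (ab : a <= b) : exists j : cseg a -> cseg b,
  continuous j /\ forall z, val (j z) = val z.
Proof.
have /choice[j Hj] (z : cseg a) : exists w : cseg b, val w = val z.
  by apply: cseg_in; have /andP[-> /le_trans->] := cseg_inP z.
exists j; split=> // z A /cseg_nbhs[c cz cA]; apply/cseg_nbhs; rewrite Hj in cz.
by exists c => // w cw; apply: cA; rewrite !Hj.
Qed.

Section Surjections.
Variable R : realType.

Definition Cp_surjection (X Z : topologicalType) :=
  exists T : {linear Cp R X -> Cp R Z}, continuous T /\ forall g, exists f, T f = g.

Lemma Cp_surjection_trans (X Z W : topologicalType) :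
  Cp_surjection X Z -> Cp_surjection Z W -> Cp_surjection X W.
Proof.
move=> [T [cT sT]] [T' [cT' sT']]; exists (T' \o T); split=> [f|g].
  by apply: continuous_comp; [exact: cT|exact: cT'].
by have [f <-] := sT' g; have [k <-] := sT f; exists k.
Qed.

Lemma Cp_surjection_homeo (X Z : topologicalType) :
  homeomorphic Z X -> Cp_surjection X Z.
Proof.
move=> [f [g [cf cg fK gK]]]; exists (Cp_comp cf); split; first exact: Cp_comp_continuous.
move=> k; exists (Cp_comp cg k); apply/continuousEP => z.
by rewrite -[LHS]/(k (g (f z))) fK.
Qed.

Lemma Cp_surjection_iso (X Z : topologicalType) :
  Cp_isomorphic R X Z -> Cp_surjection X Z.
Proof. by move=> [f [g [cf _ _ gK]]]; exists f; split=> // h; exists (g h). Qed.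

Lemma Cp_surjection_le a b : a <= b -> Cp_surjection (cseg b) (cseg a).
Proof.
move=> ab; have [j [cj jE]] := continuous_cseg_incl ab.
exists (Cp_comp cj); split; first exact: Cp_comp_continuous.
move=> g; have Eg : Cspace b (cext g) by apply: (Cspace_le ab); apply: Cspace_cext; exact: cts_fun.
pose k : Cp R (cseg b) := mkcts (continuous_Cspace Eg).
exists k; apply/continuousEP => z.
by rewrite -[LHS]/(cext g (val (j z))) jE cextE.
Qed.

End Surjections.

Theorem theorem3p2 (R : realType) (alpha : cord) (alpha_inf : comega <= alpha)
    (Y : topologicalType) (Y_tychonoff : tychonoff_space Y) :
  [<-> (exists T : {linear Cp R (cseg alpha) -> Cp R Y},
          continuous T /\ forall g, exists f, T f = g);
       (exists beta : cord, homeomorphic Y (cseg beta) /\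
          (beta < alpha \/ alpha <= beta < cpow alpha comega));
       (exists beta : cord, homeomorphic Y (cseg beta) /\
          (alpha <= beta -> Cp_isomorphic R (cseg alpha) (cseg beta)))].
Proof.
tfae.
- move=> [T [cT sT]]; have [b [h bh]] := ordinal_range cT sT Y_tychonoff.
  exists b; split; first exact: isord_homeomorphic bh.
  have [ab|ba] := leP alpha b; [right|by left].
  rewrite ltNge; apply/negP => bpow.
  apply: (@not_separates_omega R alpha alpha_inf).
  exact: separates_le bpow (isord_separates cT sT Y_tychonoff bh).
- move=> [b [Yb [ba|/andP[ab bp]]]]; exists b; split=> //.
    by rewrite leNgt ba.
  move=> _; have [l [lc la al]] := pow_closed_exists alpha_inf.
  have li := pow_closed_indec lc; have l0 := climit_gt0 li.1.
  apply: iso_Cp; apply: iso_trans (iso_Cspace R li la al) (iso_sym (iso_Cspace R li _ _)).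
    exact: le_trans la ab.
  apply: lt_le_trans bp _; apply: cpow_omega_le2 => //.
  exact: lt_le_trans comega_gt0 alpha_inf.
- move=> [b [Yb H]]; apply: Cp_surjection_trans (Cp_surjection_homeo R Yb).
  have [ab|/ltW ba] := leP alpha b; first by apply: Cp_surjection_iso; exact: H.
  exact: Cp_surjection_le.
Qed.
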